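(* Let $(Y_i(0),\beta_{is},w_{is},\mathcal{X}_s)_{1\le i\le N,\,1\le s\le S}$ be a triangular array as in the context (indexed by $S$, with $N=N_S$), let $X_i=\sum_{s=1}^S w_{is}\mathcal{X}_s$, $n_s=\sum_{i=1}^N w_{is}$, and let $\mathcal{F}_0$ be the $\sigma$-field generated by $(Y_i(0),\beta_{is},w_{is})_{i,s}$. Suppose: (1) the observed outcome is $Y_i=Y_i(0)+\sum_{s=1}^S w_{is}\mathcal{X}_s\beta_{is}$ for all $i$; (2) $E[\mathcal{X}_s\mid\mathcal{F}_0]=0$ for all $s$; (3) conditional on $\mathcal{F}_0$, $\mathcal{X}_1,\dots,\mathcal{X}_S$ are independent; (4) $\max_s n_s/\sum_{t=1}^S n_t\to 0$ and $\max_s n_s^2/\sum_{t=1}^S n_t^2\to 0$; (5) the support of $\beta_{is}$ is bounded (uniformly in $i,s,S$); (6) $\frac1N\sum_{i=1}^N\sum_{s=1}^S \mathrm{var}(\mathcal{X}_s\mid\mathcal{F}_0)\,w_{is}^2$ converges in probability to a strictly positive non-random limit; (7) for some $\nu>0$, $E[|\mathcal{X}_s|^{4+\nu}\mid\mathcal{F}_0]$ is uniformly bounded, and conditional on $W=(w_{is})$ the fourth moments of $Y_i(0)$ exist and are bounded uniformly over $i$ (in particular the corresponding $(2+\nu)$-th and second moment bounds hold). Let $$\hat\beta=\frac{\sum_{i=1}^N X_iY_i}{\sum_{i=1}^N X_i^2},\qquad \beta=\frac{\sum_{i=1}^N E[X_iY_i\mid\mathcal{F}_0]}{\sum_{i=1}^N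 E[X_i^2\mid\mathcal{F}_0]},\qquad \epsilon_i=Y_i-X_i\beta,$$ and suppose that $$\mathcal{V}_N=\frac{1}{\sum_{s=1}^S n_s^2}\,\mathrm{var}\Big(\sum_{i=1}^N X_i\epsilon_i\;\Big|\;\mathcal{F}_0\Big)$$ converges in probability to a non-random limit. Then $$\frac{N}{\sqrt{\sum_{s=1}^S n_s^2}}\,(\hat\beta-\beta)=\mathcal{N}\left(0,\frac{\mathcal{V}_N}{\left(\frac1N\sum_{i=1}^N X_i^2\right)^2}\right)+o_p(1).$$
   Context: All limits are as $S\to\infty$, with the number of regions $N=N_S$ depending on $S$. For each $S$ there are, on some probability space, random variables $Y_i(0)\in\mathbb{R}$, $\beta_{is}\in\mathbb{R}$, shares $w_{is}\ge 0$ with $\sum_{s=1}^S w_{is}\le 1$ for every $i$, and shifters $\mathcal{X}_s\in\mathbb{R}$ ($i=1,\dots,N$, $s=1,\dots,S$); their joint distribution may change with $S$ (the index $S$ is suppressed). $W=(w_{is})$ is the $N\times S$ share matrix. ''Uniformly bounded'' means bounded (almost surely) by a non-random constant not depending on $S$. Limit conditions on functions of $W$ alone are understood to hold almost surely. Notation: for random sequences $A_S$, $D_S$ and $V_S$, where $V_S$ converges in probability to a non-random $v\ge 0$, the statement $A_S=\mathcal{N}(0,V_S/D_S^2)+o_p(1)$ means that $D_SA_S$ converges in distribution to $\mathcal{N}(0,v)$ (a point mass at $0$ if $v=0$). *)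

(* Defs.v *)
From HB Require Import structures.
From mathcomp Require Import all_boot all_order all_algebra.
From mathcomp Require Import all_classical all_reals all_analysis.

Set Implicit Arguments.
Unset Strict Implicit.
Unset Printing Implicit Defensive.

Import Order.TTheory GRing.Theory Num.Theory.
Import numFieldNormedType.Exports.

Local Open Scope classical_set_scope.
Local Open Scope ring_scope.

Section conditioning.
Context {d : measure_display} {T : measurableType d} {R : realType}.
Variable P : probability T R.
Implicit Types (G : set (set T)) (f g : T -> R).

(* g is a version of E[f | G], for a sub-sigma-algebra G of the one of T. *)
Definition is_condexp G f g :=
  [/\ P.-integrable setT (EFin \o f),
      P.-integrable setT (EFin \o g),
      (forall B : set R, measurable B -> G (g @^-1` B)) &
      forall A, G A ->
        (\int[P]_(x in A) (f x)%:E = \int[P]_(x in A) (g x)%:E)%E].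

(* A chosen version of E[f | G]. It is the constant 0 when f is not integrable,
   so bounds on conditional moments have to be stated together with
   integrability, as in [condexp_bounded]. *)
Definition condexp G f : T -> R := xget (cst 0) [set g | is_condexp G f g].

Definition condvar G f : T -> R :=
  condexp G (fun x => (f x - condexp G f x) ^+ 2).

(* E[f | G] exists and is almost surely at most C. *)
Definition condexp_bounded G f (C : R) :=
  P.-integrable setT (EFin \o f) /\ {ae P, forall x, condexp G f x <= C}.

Definition cond_independent G (m : nat) (X : 'I_m -> {RV P >-> R}) :=
  forall (J : {set 'I_m}) (B : 'I_m -> set R), (forall s, measurable (B s)) ->
    {ae P, forall x,
      condexp G (\1_(\bigcap_(s in [set` J]) (X s @^-1` B s))) x =
      \prod_(s in J) condexp G (\1_(X s @^-1` B s)) x}.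

End conditioning.

Section asymptotics.
Context {d : measure_display} {T : measurableType d} {R : realType}.
Variable P : probability T R.

Definition cvg_in_prob (Z : nat -> T -> R) (l : R) :=
  forall e : R, 0 < e ->
    P [set x | e < `|Z S x - l|] @[S --> \oo] --> 0%E.

(* Convergence of the distribution functions at every continuity point of the
   distribution function of mu. *)
Definition cvg_in_distribution (Z : nat -> T -> R) (mu : set R -> \bar R) :=
  forall t : R, mu [set t] = 0%E ->
    P [set x | Z S x <= t] @[S --> \oo] --> mu `]-oo, t]%classic.

(* N(0, v), where v is the variance; the library's [normal_prob m s] takes the
   standard deviation and is not a point mass for s = 0. *)
Definition centered_normal (v : R) : set R -> \bar R :=
  if v == 0 then dirac (0 : R) else normal_prob 0 (Num.sqrt v).

(* A_S = N(0, V_S / D_S ^ 2) + o_p(1) *)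
Definition approx_normal (A V D : nat -> T -> R) :=
  exists v : R, [/\ 0 <= v, cvg_in_prob V v &
    cvg_in_distribution (fun S x => D S x * A S x) (centered_normal v)].

End asymptotics.

Section shift_share.
Context {d : measure_display} {T : measurableType d} {R : realType}.

(* n regions and m sectors. An array of designs, one for each m, lives on a single
   probability space, so that limits in m can be taken almost surely; arrays on
   separate spaces are transported to the product space. *)
Record design (P : probability T R) (n m : nat) := Design {
  outcome0 : 'I_n -> {RV P >-> R} ;
  effect : 'I_n -> 'I_m -> {RV P >-> R} ;
  share : 'I_n -> 'I_m -> {RV P >-> R} ;
  shifter : 'I_m -> {RV P >-> R} }.

Context {P : probability T R} {n m : nat}.
Variable A : design P n m.
Variable Y : 'I_n -> {RV P >-> R}.

Definition sigma_W : set (set T) :=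
  <<s \bigcup_(k : 'I_n * 'I_m) g_sigma_algebra_preimage (share A k.1 k.2) >>.

Definition sigma_F0 : set (set T) :=
  <<s (\bigcup_(i : 'I_n) g_sigma_algebra_preimage (outcome0 A i)) `|`
      (\bigcup_(k : 'I_n * 'I_m) g_sigma_algebra_preimage (effect A k.1 k.2)) `|`
      (\bigcup_(k : 'I_n * 'I_m) g_sigma_algebra_preimage (share A k.1 k.2)) >>.

(* X_i *)
Definition exposure (i : 'I_n) (x : T) : R :=
  \sum_(s < m) share A i s x * shifter A s x.

(* n_s *)
Definition sector_size (s : 'I_m) (x : T) : R := \sum_(i < n) share A i s x.

Definition sum_size (x : T) : R := \sum_(s < m) sector_size s x.

Definition sum_size2 (x : T) : R := \sum_(s < m) sector_size s x ^+ 2.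

(* Sizes being nonnegative, 0 is neutral for these maxima. *)
Definition max_size (x : T) : R := \big[Num.max/0]_(s < m) sector_size s x.

Definition max_size2 (x : T) : R :=
  \big[Num.max/0]_(s < m) sector_size s x ^+ 2.

Definition beta_hat (x : T) : R :=
  (\sum_(i < n) exposure i x * Y i x) / (\sum_(i < n) exposure i x ^+ 2).

Definition beta (x : T) : R :=
  (\sum_(i < n) condexp P sigma_F0 (fun y => exposure i y * Y i y) x) /
  (\sum_(i < n) condexp P sigma_F0 (fun y => exposure i y ^+ 2) x).

Definition residual (i : 'I_n) (x : T) : R := Y i x - exposure i x * beta x.

Definition score_variance (x : T) : R :=
  condvar P sigma_F0 (fun y => \sum_(i < n) exposure i y * residual i y) x /
  sum_size2 x.

End shift_share.

(* Main.v *)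
(** Given F_0, [beta] is the mean of the effects [beta_is] with weights
    [w_is ^ 2 * var(X_s | F_0)]. Hence the normalised estimation error, which is exactly
    [sum_i X_i eps_i / sqrt (sum_s n_s ^ 2)], is a quadratic form in the shifters whose
    conditional mean vanishes, and revealing the shifters one at a time turns it into a
    sum of martingale differences. Their conditional variances add up to [V_N] plus a
    fluctuation that is again a quadratic form in the shifters; by the Schur test its
    second moment is at most a constant times the expectation of
    [max_s n_s ^ 2 / sum_s n_s ^ 2]. The same ratio controls the Lyapunov sum of the
    [E min (xi ^ 2, |xi| ^ 3)].

    The martingale central limit theorem is proved by Lindeberg's method, run along the
    solution [Phi ((t - x) / sqrt s)] of the heat equation: [x] is the partial sum and
    [s] is [v] plus a small constant minus the conditional variance used so far, the
    martingale being stopped before [s] gets too small. *)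

Require Import Defs.
From HB Require Import structures.
From mathcomp Require Import all_boot all_order all_algebra.
From mathcomp Require Import all_classical all_reals all_analysis.
From mathcomp Require Import measurable_realfun ring lra.

Set Implicit Arguments.
Unset Strict Implicit.
Unset Printing Implicit Defensive.

Import Order.TTheory GRing.Theory Num.Theory.
Import numFieldNormedType.Exports.

Local Open Scope classical_set_scope.
Local Open Scope ring_scope.

(** Two features of the hypotheses shape the estimates. The outcomes [Y_i(0)] are unbounded and
    their moments are controlled given [W] only, so every moment of an outcome is taken against a
    [W]-measurable weight; the outcomes enter through averages with weights [w_is / n_s], to which
    Jensen's inequality applies. The shifters have little more than four moments, so the diagonal
    terms [X_s ^ 2 - var] have little more than two, and a Lyapunov condition with fourth powers is
    out of reach. Since [min (xi ^ 2, |xi| ^ 3)] is at most [|xi| ^ p] for every [p] between 2 and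
    3, each piece of an increment can use the power it affords. The Schur test rests on the row sums
    of [sum_i w_is w_it], which are at most [n_s] because the shares of a region add up to at most
    1. Conditional expectations are handled by testing against events, and their versions are
    truncated so that bounds hold at every point; this keeps null sets out of the estimates. *)

Section expectation.
Context {d : measure_display} {T : measurableType d} {R : realType}.
Variable P : probability T R.
Implicit Types (f g h : T -> R) (G : set (set T)).
Local Notation integ f := (P.-integrable setT (EFin \o f)).
Local Notation Ex f := (Rintegral P setT f).

Lemma integ_meas f : integ f -> measurable_fun setT f.
Proof. by move=> /integrableP[/measurable_EFinP]. Qed.

Lemma integ_le f g : measurable_fun setT f -> integ g ->
  (forall x, `|f x| <= g x) -> integ f.
Proof.
move=> mf ig fg; apply: le_integrable ig => //; first exact/measurable_EFinP.
move=> x _ /=; rewrite lee_fin; apply: le_trans (fg x) _; exact: ler_norm.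
Qed.

Lemma integ_cst (c : R) : integ (fun=> c).
Proof. exact: finite_measure_integrable_cst. Qed.

Lemma integ_bnd f (M : R) : measurable_fun setT f -> (forall x, `|f x| <= M) ->
  integ f.
Proof. move=> mf fM; exact: integ_le (integ_cst M) fM. Qed.

Lemma integ_ext f g : f =1 g -> integ f -> integ g.
Proof. by move=> /funext ->. Qed.

Lemma integD f g : integ f -> integ g -> integ (fun x => f x + g x).
Proof. move=> i j; exact: (integrableD measurableT i j). Qed.

Lemma integN f : integ f -> integ (fun x => - f x).
Proof. move=> i; exact: (integrableN i). Qed.

Lemma integB f g : integ f -> integ g -> integ (fun x => f x - g x).
Proof. by move=> i j; apply: integD => //; apply: integN. Qed.

Lemma integZ (c : R) f : integ f -> integ (fun x => c * f x).
Proof. by move=> i; apply: (@integrableZl _ _ _ P setT measurableT c (EFin \o f)). Qed.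

Lemma integ_sum I (s : seq I) (Q : pred I) (F : I -> T -> R) :
  (forall i, Q i -> integ (F i)) -> integ (fun x => \sum_(i <- s | Q i) F i x).
Proof.
move=> iF; elim: s => [|i s IH].
  by apply: integ_ext (integ_cst 0) => x; rewrite big_nil.
have [Qi|nQi] := boolP (Q i).
  by apply: integ_ext (integD (iF i Qi) IH) => x; rewrite big_cons Qi.
by apply: integ_ext IH => x; rewrite big_cons (negbTE nQi).
Qed.

Lemma integ_norm f : integ f -> integ (fun x => `|f x|).
Proof. exact: integrable_norm. Qed.

Lemma integM_bnd f g (M : R) : integ f -> measurable_fun setT g ->
  (forall x, `|g x| <= M) -> integ (fun x => f x * g x).
Proof.
move=> i mg gM.
apply: (@integ_le _ (fun x => M * `|f x|)).
- by apply: measurable_funM => //; exact: integ_meas.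
- exact/integZ/integ_norm.
- by move=> x; rewrite normrM mulrC ler_wpM2r.
Qed.

Lemma integ_ae f g : integ f -> measurable_fun setT g ->
  {ae P, forall x, f x = g x} -> integ g.
Proof.
move=> /integrableP[mf fi] mg fg; apply/integrableP; split.
  exact/measurable_EFinP.
rewrite (_ : (\int[P]_x _ = \int[P]_x `|(EFin \o f) x|)%E)//.
apply: ae_eq_integral => //.
- by apply: measurableT_comp => //; exact/measurable_EFinP.
- by apply: measurableT_comp.
- by apply: filterS fg => x /= ->.
Qed.

Lemma Ex_ae f g : measurable_fun setT f -> measurable_fun setT g ->
  {ae P, forall x, f x = g x} -> Ex f = Ex g.
Proof.
move=> mf mg fg; congr fine; apply: ae_eq_integral => //.
- exact/measurable_EFinP.
- exact/measurable_EFinP.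
- by apply: filterS fg => x /= ->.
Qed.

Lemma Ex_ext f g : f =1 g -> Ex f = Ex g.
Proof. by move=> /funext ->. Qed.

Lemma ExD f g : integ f -> integ g -> Ex (fun x => f x + g x) = Ex f + Ex g.
Proof. exact: RintegralD. Qed.

Lemma ExB f g : integ f -> integ g -> Ex (fun x => f x - g x) = Ex f - Ex g.
Proof. exact: RintegralB. Qed.

Lemma ExZ (c : R) f : integ f -> Ex (fun x => c * f x) = c * Ex f.
Proof. exact: RintegralZl. Qed.

Lemma Ex_cst (c : R) : Ex (fun=> c) = c.
Proof. by rewrite Rintegral_cst//= (_ : _ setT = 1%E) ?mulr1//; exact: probability_setT. Qed.

Lemma Ex_sum I (s : seq I) (Q : pred I) (F : I -> T -> R) :
  (forall i, Q i -> integ (F i)) ->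
  Ex (fun x => \sum_(i <- s | Q i) F i x) = \sum_(i <- s | Q i) Ex (F i).
Proof.
move=> iF; elim: s => [|i s IH].
  by rewrite big_nil -[RHS](Ex_cst 0); apply: Ex_ext => x; rewrite big_nil.
rewrite big_cons; case: ifPn => [Qi|nQi].
  rewrite -IH -ExD//; [|exact: iF|exact: integ_sum].
  by apply: Ex_ext => x; rewrite big_cons Qi.
by rewrite -IH; apply: Ex_ext => x; rewrite big_cons (negbTE nQi).
Qed.

Lemma Ex_le f g : integ f -> integ g -> (forall x, f x <= g x) -> Ex f <= Ex g.
Proof. by move=> i j fg; apply: le_Rintegral. Qed.

Lemma Ex_ge0 f : (forall x, 0 <= f x) -> 0 <= Ex f.
Proof. by move=> f0; apply: Rintegral_ge0. Qed.

Lemma Ex_norm f : integ f -> `|Ex f| <= Ex (fun x => `|f x|).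
Proof. exact: le_normr_Rintegral. Qed.

Lemma Ex_norm_le f g : integ f -> integ g -> (forall x, `|f x| <= g x) ->
  `|Ex f| <= Ex g.
Proof.
move=> i j fg; apply: le_trans (Ex_norm i) _.
by apply: Ex_le => //; exact: integ_norm.
Qed.

Lemma norm_indic (A : set T) x : `|\1_A x : R| <= 1.
Proof. by rewrite indicE; case: (x \in A); rewrite ?normr1 ?normr0. Qed.

Lemma integ_indicM f (A : set T) : measurable A -> integ f ->
  integ (fun x => f x * \1_A x).
Proof.
move=> mA i; apply: (@integM_bnd _ _ 1) => //; by move=> x; exact: norm_indic.
Qed.

Lemma Ex_indic (A : set T) : measurable A -> Ex (\1_A) = fine (P A).
Proof.
by move=> mA; rewrite /Rintegral integral_indic// setIT.
Qed.

Lemma integral_Ex f (A : set T) : measurable A -> integ f ->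
  (\int[P]_(x in A) (f x)%:E)%E = (Ex (fun x => f x * \1_A x))%:E.
Proof.
move=> mA i; rewrite /Rintegral fineK; last first.
  exact: (integrable_fin_num measurableT (integ_indicM mA i)).
rewrite [LHS]integral_mkcond; apply: eq_integral => x _.
by rewrite patchE indicE; case: ifP; rewrite ?mulr1 ?mulr0.
Qed.

Lemma dominated_Ex (f_ : nat -> T -> R) f g :
  (forall n, measurable_fun setT (f_ n)) -> measurable_fun setT f -> integ g ->
  {ae P, forall x, f_ n x @[n --> \oo] --> f x} ->
  (forall n x, `|f_ n x| <= g x) ->
  Ex (f_ n) @[n --> \oo] --> Ex f.
Proof.
move=> mf_ mf ig cv dom.
have [|||||i _ h] := @dominated_convergence _ _ _ P setT measurableT
  (fun n x => (f_ n x)%:E) (EFin \o f) (EFin \o g).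
- by move=> n; exact/measurable_EFinP.
- exact/measurable_EFinP.
- by apply: filterS cv => x c _; apply: cvg_EFin => //; apply: nearW.
- exact: ig.
- by apply: aeW => x n _ /=; rewrite lee_fin.
- apply: fine_cvg; rewrite fineK//; exact: (integrable_fin_num measurableT i).
Qed.

End expectation.

(** * Measurability and orthogonality with respect to a sub-sigma-algebra *)

(** Inversion is continuous off 0, and the value at 0 is dealt with on a measurable singleton. *)
Lemma measurable_invr (R : realType) : measurable_fun setT (@GRing.inv R).
Proof.
rewrite -(setUv [set (0:R)]); apply/measurable_funU => //.
  exact: measurableC.
split; first exact: measurable_fun_set1.
apply: open_continuous_measurable_fun; first exact/closed_openC/closed_eq.
by move=> x; rewrite inE /= => /eqP x0; exact: inv_continuous.
Qed.

Section sub_sigma_algebra.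
Context {d : measure_display} {T : measurableType d} {R : realType}.
Implicit Types (f g h : T -> R) (G : set (set T)).

Definition subsig G := sigma_algebra setT G /\ G `<=` measurable.

(** Several sub-sigma-algebras live on the same type [T], so measurability is stated on preimages
    instead of changing the type; [gmeasP] passes to the library notion. *)
Definition gmeas G f := forall B : set R, measurable B -> G (f @^-1` B).

Lemma gmeasP G f : subsig G ->
  gmeas G f <-> measurable_fun setT (f : g_sigma_algebraType G -> R).
Proof.
move=> [sG _]; have e := measurable_g_measurableTypeE sG; split.
  by move=> gf _ B mB; rewrite setTI e; exact: gf.
by move=> mf B mB; rewrite -e -[X in measurable X]setTI; exact: mf.
Qed.

Lemma gmeas_meas G f : subsig G -> gmeas G f -> measurable_fun setT f.
Proof. by move=> [_ sG] gf _ B mB; rewrite setTI; apply/sG/gf. Qed.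

Lemma gmeas_sub G G' f : G `<=` G' -> gmeas G f -> gmeas G' f.
Proof. by move=> s gf B mB; apply/s/gf. Qed.

Lemma gmeas_ext G f g : f =1 g -> gmeas G f -> gmeas G g.
Proof. by move=> /funext ->. Qed.

Lemma gmeas_comp G f (k : R -> R) : measurable_fun setT k -> gmeas G f ->
  gmeas G (fun x => k (f x)).
Proof.
move=> mk gf B mB; rewrite -[X in G X]/(f @^-1` (k @^-1` B)); apply: gf.
by rewrite -[X in measurable X]setTI; exact: mk.
Qed.

Section closure.
Variable G : set (set T).
Hypothesis sG : subsig G.

Lemma gmeas_cst (c : R) : gmeas G (fun=> c).
Proof. exact/(gmeasP _ sG)/measurable_cst. Qed.

Lemma gmeasD f g : gmeas G f -> gmeas G g -> gmeas G (fun x => f x + g x).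
Proof.
move=> /(gmeasP _ sG) mf /(gmeasP _ sG) mg; apply/(gmeasP _ sG).
exact: measurable_funD.
Qed.

Lemma gmeasM f g : gmeas G f -> gmeas G g -> gmeas G (fun x => f x * g x).
Proof.
move=> /(gmeasP _ sG) mf /(gmeasP _ sG) mg; apply/(gmeasP _ sG).
exact: measurable_funM.
Qed.

Lemma gmeasN f : gmeas G f -> gmeas G (fun x => - f x).
Proof.
by apply: (gmeas_comp (k := -%R)); exact: oppr_measurable.
Qed.

Lemma gmeasB f g : gmeas G f -> gmeas G g -> gmeas G (fun x => f x - g x).
Proof. by move=> mf mg; apply: gmeasD => //; exact: gmeasN. Qed.

Lemma gmeas_sum I (s : seq I) (Q : pred I) (F : I -> T -> R) :
  (forall i, Q i -> gmeas G (F i)) ->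
  gmeas G (fun x => \sum_(i <- s | Q i) F i x).
Proof.
move=> gF; elim: s => [|i s IH].
  by apply: gmeas_ext (gmeas_cst 0) => x; rewrite big_nil.
have [Qi|nQi] := boolP (Q i).
  by apply: gmeas_ext (gmeasD (gF i Qi) IH) => x; rewrite big_cons Qi.
by apply: gmeas_ext IH => x; rewrite big_cons (negbTE nQi).
Qed.

Lemma gmeasX f n : gmeas G f -> gmeas G (fun x => f x ^+ n).
Proof. by apply: (gmeas_comp (k := fun y => y ^+ n)); exact: exprn_measurable. Qed.

Lemma gmeas_indic (A : set T) : G A -> gmeas G (\1_A).
Proof.
move=> GA; apply/(gmeasP _ sG); apply: (@measurable_indic _ (g_sigma_algebraType G)).
by rewrite (measurable_g_measurableTypeE sG.1).
Qed.

Lemma gmeas_max f g : gmeas G f -> gmeas G g ->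
  gmeas G (fun x => Num.max (f x) (g x)).
Proof.
move=> /(gmeasP _ sG) mf /(gmeasP _ sG) mg; apply/(gmeasP _ sG).
exact: measurable_maxr.
Qed.

Lemma gmeas_min f g : gmeas G f -> gmeas G g ->
  gmeas G (fun x => Num.min (f x) (g x)).
Proof.
move=> /(gmeasP _ sG) mf /(gmeasP _ sG) mg; apply/(gmeasP _ sG).
exact: measurable_minr.
Qed.

Lemma gmeasV f : gmeas G f -> gmeas G (fun x => (f x)^-1).
Proof. by apply: (gmeas_comp (k := GRing.inv)); exact: measurable_invr. Qed.

Lemma gmeas_le_set f (c : R) : gmeas G f -> G [set x | f x <= c].
Proof.
move=> gf; rewrite (_ : [set _ | _] = f @^-1` `]-oo, c]%classic); first exact: gf.
by apply/seteqP; split=> x; rewrite /= in_itv.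
Qed.

End closure.
End sub_sigma_algebra.

Section orthogonality.
Context {d : measure_display} {T : measurableType d} {R : realType}.
Variable P : probability T R.
Implicit Types (f g h : T -> R) (G : set (set T)).
Local Notation integ f := (P.-integrable setT (EFin \o f)).
Local Notation Ex f := (Rintegral P setT f).

(** This says E[f | G] = 0 without choosing a version: it is stable under sums, under multiplication
    by [G]-measurable factors and under shrinking [G], with no null sets to collect. *)
Definition orth G f :=
  integ f /\ forall A, G A -> Ex (fun x => f x * \1_A x) = 0.

Import HBNNSimple.

(** The approximating simple functions are built over [g_sigma_algebraType G], so their level sets
    are events of [G] and each of them integrates to 0 against [f]. Domination by [|f * g|] passes
    to the limit. *)
Lemma orthE_ge0 G f g : subsig G -> orth G f -> gmeas G g ->
  (forall x, 0 <= g x) -> integ (fun x => f x * g x) ->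
  Ex (fun x => f x * g x) = 0.
Proof.
move=> sG [fi fA] gg g0 fgi.
have mg : measurable_fun setT (EFin \o (g : g_sigma_algebraType G -> R)).
  exact/measurable_EFinP/gmeasP.
pose g_ n := nnsfun_approx measurableT mg n.
have g0' (x : g_sigma_algebraType G) : [set: g_sigma_algebraType G] x ->
    (0 <= (EFin \o g) x)%E by rewrite lee_fin.
have cg x : g_ n x @[n --> \oo] --> g x.
  have := cvg_nnsfun_approx measurableT mg g0' (x := x) I.
  by move=> /fine_cvg; exact.
have g_le n x : g_ n x <= g x.
  have := le_approx (f := EFin \o g) n g0' (x := x) I.
  by rewrite /g_ nnsfun_approxE lee_fin.
have mg_ n : gmeas G (g_ n).
  apply/(gmeasP _ sG); exact: measurable_funPT.
have zero n : Ex (fun x => f x * g_ n x) = 0.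
  have [m [s gE]] : exists m (s : seq R), forall x,
      g_ n x = \sum_(i < m) s`_i * \1_(g_ n @^-1` [set s`_i]) x.
    by do 2!eexists; exact: fimfunEord.
  have GA (y : R) : G (g_ n @^-1` [set y]) by exact: mg_.
  rewrite (@Ex_ext _ _ _ _ _ (fun x => \sum_(i < m) (s`_i *
     (f x * \1_(g_ n @^-1` [set s`_i]) x)))); last first.
    by move=> x; rewrite gE mulr_sumr; apply: eq_bigr => i _; rewrite mulrCA.
  rewrite Ex_sum => [|i _].
    rewrite big1// => i _; rewrite ExZ ?fA ?mulr0//.
    by apply: integ_indicM => //; exact: sG.2.
  by apply/integZ/integ_indicM => //; exact: sG.2.
have cv : Ex (fun x => f x * g_ n x) @[n --> \oo] --> Ex (fun x => f x * g x).
  apply: (@dominated_Ex _ _ _ _ _ _ (fun x => `|f x * g x|)).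
  - move=> n; apply: measurable_funM; first exact: integ_meas fi.
    exact: gmeas_meas (mg_ n).
  - exact: integ_meas fgi.
  - exact: integ_norm.
  - by apply: aeW => x; apply: cvgM; [exact: cvg_cst|exact: cg].
  - move=> n x; rewrite !normrM ler_wpM2l// (ger0_norm (g0 x)) ger0_norm ?fun_ge0//.
rewrite -(cvg_lim (@Rhausdorff R) cv).
rewrite (_ : (fun n => _) = cst 0) ?lim_cst//; exact/funext.
Qed.

Lemma orthE G f g : subsig G -> orth G f -> gmeas G g ->
  integ (fun x => f x * g x) -> Ex (fun x => f x * g x) = 0.
Proof.
move=> sG fo gg fgi.
have gp : gmeas G (fun x => Num.max (g x) 0).
  by apply: gmeas_max => //; exact: gmeas_cst.
have gn : gmeas G (fun x => Num.max (- g x) 0).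
  by apply: gmeas_max => //; [exact: gmeasN|exact: gmeas_cst].
have le_i (k : T -> R) : gmeas G k -> (forall x, `|k x| <= `|g x|) ->
    integ (fun x => f x * k x).
  move=> gk kg; apply: integ_le (integ_norm fgi) _.
    by apply: measurable_funM; [exact: (integ_meas fo.1)|exact: gmeas_meas gk].
  by move=> x; rewrite !normrM ler_wpM2l.
have ip : integ (fun x => f x * Num.max (g x) 0).
  apply: le_i => // x; have [h|h] := leP (g x) 0; last by [].
  by rewrite normr0.
have in_ : integ (fun x => f x * Num.max (- g x) 0).
  apply: le_i => // x; have [h|h] := leP (- g x) 0; first by rewrite normr0.
  by rewrite normrN.
rewrite (@Ex_ext _ _ _ _ _ (fun x => f x * Num.max (g x) 0 - f x * Num.max (- g x) 0)).
  rewrite ExB// (orthE_ge0 sG fo gp)// ?(orthE_ge0 sG fo gn)// ?subr0// => x;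
  by rewrite le_max lexx orbT.
move=> x; rewrite -mulrBr; congr (_ * _).
have [h|h] := leP (g x) 0; have [h'|h'] := leP (- g x) 0; lra.
Qed.

Lemma orthM G f g : subsig G -> orth G f -> gmeas G g ->
  integ (fun x => f x * g x) -> orth G (fun x => f x * g x).
Proof.
move=> sG fo gg fgi; split=> // A GA.
rewrite -(@orthE G f (fun x => g x * \1_A x))//.
- by apply: Ex_ext => x; rewrite mulrA.
- by apply: gmeasM => //; exact: gmeas_indic.
- apply: integ_ext (integ_indicM (sG.2 _ GA) fgi) => x; exact/esym/mulrA.
Qed.

Lemma orthD G f g : subsig G -> orth G f -> orth G g ->
  orth G (fun x => f x + g x).
Proof.
move=> sG [fi f0] [gi g0]; split; first exact: integD.
move=> A GA; rewrite (@Ex_ext _ _ _ _ _ (fun x => f x * \1_A x + g x * \1_A x)).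
  by rewrite ExD ?f0 ?g0 ?addr0//; apply: integ_indicM => //; exact: sG.2.
by move=> x; rewrite mulrDl.
Qed.

Lemma orth_ext G f g : f =1 g -> orth G f -> orth G g.
Proof. by move=> /funext ->. Qed.

Lemma orth0 G : orth G (fun=> 0).
Proof.
split; first exact: integ_cst.
by move=> A _; rewrite -[RHS](Ex_cst P 0); apply: Ex_ext => x; rewrite mul0r.
Qed.

Lemma orthZ G (c : R) f : subsig G -> orth G f -> orth G (fun x => c * f x).
Proof.
move=> sG fo; apply: (@orth_ext _ (fun x => f x * c)) => [x|]; first exact: mulrC.
apply: orthM => //; first exact: gmeas_cst.
by apply: integ_ext (integZ c fo.1) => x; exact: mulrC.
Qed.

Lemma orth_sum G I (s : seq I) (Q : pred I) (F : I -> T -> R) : subsig G ->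
  (forall i, Q i -> orth G (F i)) -> orth G (fun x => \sum_(i <- s | Q i) F i x).
Proof.
move=> sG oF; elim: s => [|i s IH].
  by apply: orth_ext (orth0 G) => x; rewrite big_nil.
have [Qi|nQi] := boolP (Q i).
  by apply: orth_ext (orthD sG (oF i Qi) IH) => x; rewrite big_cons Qi.
by apply: orth_ext IH => x; rewrite big_cons (negbTE nQi).
Qed.

Lemma orth_sub G G' f : G `<=` G' -> orth G' f -> orth G f.
Proof. by move=> s [fi f0]; split=> // A /s; exact: f0. Qed.

Lemma orth_ae G f g : subsig G -> orth G f -> measurable_fun setT g ->
  {ae P, forall x, f x = g x} -> orth G g.
Proof.
move=> sG [fi f0] mg fg; have mf := integ_meas fi.
split; first exact: integ_ae fg.
move=> A GA; rewrite -(f0 A GA); have mA := sG.2 _ GA; apply: Ex_ae.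
- by apply: measurable_funM => //; exact: measurable_indic.
- by apply: measurable_funM => //; exact: measurable_indic.
- by apply: filterS fg => x ->.
Qed.

(** Monotone convergence as a criterion of integrability. [Rintegral] sends an infinite integral to
    a finite default, so the bound is first proved for the extended integral. *)
Lemma monotone_integ f (f_ : nat -> T -> R) (K : R) : measurable_fun setT f ->
  (forall n, integ (f_ n)) -> (forall n x, 0 <= f_ n x) ->
  (forall x, {homo f_ ^~ x : m n / (m <= n)%N >-> m <= n}) ->
  (forall x, f_ n x @[n --> \oo] --> f x) -> (forall n, Ex (f_ n) <= K) ->
  integ f /\ Ex f <= K.
Proof.
move=> mf fi f0 nd cv fK.
have ffin n : (\int[P]_x (f_ n x)%:E)%E = (Ex (f_ n))%:E.
  by rewrite /Rintegral fineK//; exact: (integrable_fin_num measurableT (fi n)).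
have lE x : limn (fun n => (f_ n x)%:E) = (f x)%:E.
  by apply: cvg_lim => //; apply: cvg_EFin (cv x); apply: nearW.
have fge0 x : 0 <= f x.
  rewrite (le_trans (f0 0%N x))//.
  have := nondecreasing_cvgn_le (nd x) (cvgP _ (cv x)) 0%N.
  by rewrite (cvg_lim _ (cv x)).
have bd : (\int[P]_x (f x)%:E <= K%:E)%E.
  have cvm : (\int[P]_x (f_ n x)%:E)%E @[n --> \oo] --> (\int[P]_x (f x)%:E)%E.
    rewrite -(eq_integral _ _ (fun x _ => lE x)).
    apply: cvg_monotone_convergence => //.
    - by move=> n; apply/measurable_EFinP; exact: integ_meas (fi n).
    - by move=> n x _; rewrite lee_fin.
    - by move=> x _ m n mn; rewrite lee_fin; exact: nd.
  apply: (cvge_to_le cvm); apply: nearW => n.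
  by rewrite ffin lee_fin.
have fi' : integ f.
  apply/integrableP; split; first exact/measurable_EFinP.
  apply: le_lt_trans (ltry K); apply: le_trans bd.
  rewrite le_eqVlt; apply/orP; left; apply/eqP; apply: eq_integral => x _ /=.
  by rewrite ger0_norm.
split=> //; rewrite -lee_fin /Rintegral fineK//.
exact: (integrable_fin_num measurableT fi').
Qed.

(* E[f | G] <= C, tested against nonnegative [G]-measurable weights. *)
Definition cond_le G f (C : R) := forall g, gmeas G g -> (forall x, 0 <= g x) ->
  integ g -> integ (fun x => f x * g x) /\ Ex (fun x => f x * g x) <= C * Ex g.

(* Truncating [g] at level [n] and letting [n] grow gives integrability of [f * g]
   as well as the bound. *)
Lemma cond_bound G f m (K : R) : subsig G -> integ f -> (forall x, 0 <= f x) ->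
  (forall x, 0 <= m x <= K) -> orth G (fun x => f x - m x) -> gmeas G m ->
  cond_le G f K.
Proof.
move=> sG fi f0 mK o gm g gg g0 gi.
have mf := integ_meas fi; have mg := gmeas_meas sG gg.
pose g_ (n : nat) x := Num.min (g x) n%:R.
have g_0 n x : 0 <= g_ n x by rewrite le_min g0 ler0n.
have g_n n x : g_ n x <= n%:R by rewrite ge_min lexx orbT.
have g_g n x : g_ n x <= g x by rewrite ge_min lexx.
have gg_ n : gmeas G (g_ n) by apply: gmeas_min => //; exact: gmeas_cst.
have mg_ n := gmeas_meas sG (gg_ n).
have fgi n : integ (fun x => f x * g_ n x).
  by apply: (@integM_bnd _ _ _ _ _ _ n%:R) => // x; rewrite ger0_norm.
have mi : integ m.
  by apply: integ_ext (integB fi o.1) => x; rewrite opprB addrCA subrr addr0.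
have mgi n : integ (fun x => m x * g_ n x).
  by apply: (@integM_bnd _ _ _ _ _ _ n%:R) => // x; rewrite ger0_norm.
apply: (@monotone_integ _ (fun n x => f x * g_ n x)).
- exact: measurable_funM.
- exact: fgi.
- by move=> n x; rewrite mulr_ge0.
- move=> x n k nk; rewrite ler_wpM2l// le_min g_g/= (le_trans (g_n _ _))//.
  by rewrite ler_nat.
- move=> x; apply: cvgM; first exact: cvg_cst.
  apply: cvg_near_cst; exists (Num.trunc (g x)).+1 => // n /= gn.
  by apply/min_idPl/ltW/(lt_le_trans (truncnS_gt _)); rewrite ler_nat.
move=> n.
have zi : integ (fun x => (f x - m x) * g_ n x).
  by apply: integ_ext (integB (fgi n) (mgi n)) => x; rewrite mulrBl.
have z := orthE sG o (gg_ n) zi.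
rewrite (@Ex_ext _ _ _ _ _ (fun x => (f x - m x) * g_ n x + m x * g_ n x)); last first.
  by move=> x; rewrite -mulrDl subrK.
rewrite ExD// z add0r -ExZ//; apply: Ex_le => //; first exact: integZ.
move=> x; have /andP[m0 m1] := mK x.
by apply: (le_trans (ler_wpM2l m0 (g_g n x))); exact: ler_wpM2r.
Qed.

End orthogonality.

(** * Conditional expectations *)

Section restriction.
Context {d : measure_display} {T : measurableType d} {R : realType}.
Variable P : probability T R.
Variable G : set (set T).
Hypothesis sG : subsig G.

(** The pushforward of [P] along this identity map is the restriction of [P] to [G]. The proof of
    [subsig G] is carried in the term so that the measurability instance can be attached to it. *)
Definition restr_id (_ : subsig G) : T -> g_sigma_algebraType G := id.

Lemma measurable_restr_id : measurable_fun setT (restr_id sG).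
Proof.
move=> _ B; rewrite setTI (measurable_g_measurableTypeE sG.1); exact: sG.2.
Qed.

HB.instance Definition _ :=
  isMeasurableFun.Build _ _ _ _ (restr_id sG) measurable_restr_id.

Variable f : T -> R.
Hypothesis fi : P.-integrable setT (EFin \o f).

(** The signed measure with density [f], seen on [G] only; its density with respect to the
    restricted probability is E[f | G]. *)
Definition restr_charge (_ : subsig G) (_ : P.-integrable setT (EFin \o f)) :
  set (g_sigma_algebraType G) -> \bar R := fun A => (\int[P]_(x in A) (f x)%:E)%E.

Let mG (A : set (g_sigma_algebraType G)) : measurable A -> d.-measurable A.
Proof. by rewrite (measurable_g_measurableTypeE sG.1); exact: sG.2. Qed.

Let restr_charge0 : restr_charge sG fi set0 = 0%E.
Proof. exact: (charge0 (induced_charge fi)). Qed.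

Let restr_charge_fin A : measurable A -> restr_charge sG fi A \is a fin_num.
Proof. by move=> /mG mA; exact: (fin_num_measure (induced_charge fi)). Qed.

Let restr_charge_additive : semi_sigma_additive (restr_charge sG fi).
Proof.
move=> F mF tF mU; apply: (@charge_semi_sigma_additive _ _ _ (induced_charge fi)) => //.
- by move=> n; exact: mG.
- exact: mG.
Qed.

HB.instance Definition _ := isCharge.Build _ _ _ (restr_charge sG fi)
  restr_charge0 restr_charge_fin restr_charge_additive.

(** Radon-Nikodym on [G]: the charge of [f] vanishes on the null sets of the restricted probability.
    The integrals of the density return to [T] through the pushforward by the identity. *)
Lemma condexp_ex : exists g, is_condexp P G f g.
Proof.
pose Q := distribution P (restr_id sG).
have dom : restr_charge sG fi `<< Q.
  apply/null_content_dominatesP => A mA QA.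
  apply: null_set_integral => //; first exact: mG.
  by apply: measurable_funTS; case/integrableP: fi.
have [D [Dfin Di DE]] : exists D : g_sigma_algebraType G -> \bar R,
    [/\ (forall x, D x \is a fin_num), Q.-integrable setT D &
    forall A, measurable A -> restr_charge sG fi A = (\int[Q]_(x in A) D x)%E].
  exists (Radon_Nikodym (restr_charge sG fi) Q); split.
  - by move=> x; exact: Radon_Nikodym_fin_num.
  - exact: Radon_Nikodym_integrable.
  - by move=> A mA; exact: Radon_Nikodym_integral.
pose g : g_sigma_algebraType G -> R := fine \o D.
have DEg : D = EFin \o g by apply/funext => x /=; rewrite fineK.
have mD : measurable_fun setT D by case/integrableP: Di.
have gg : gmeas G g by apply/(gmeasP _ sG)/measurable_EFinP; rewrite -DEg.
have gi : P.-integrable setT (EFin \o (g : T -> R)).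
  apply/integrableP; split; first exact/measurable_EFinP/(gmeas_meas sG).
  have /integrableP[_] := Di; rewrite (@ge0_integral_distribution _ _ _ _ _ P (restr_id sG)) ?DEg//.
  by apply: measurableT_comp => //; rewrite -DEg.
exists g; split=> // A GA.
have mA : measurable (A : set (g_sigma_algebraType G)).
  by rewrite (measurable_g_measurableTypeE sG.1).
have := DE A mA; rewrite /restr_charge => ->.
rewrite [LHS]integral_mkcond [RHS]integral_mkcond.
rewrite (@integral_distribution _ _ _ _ _ P (restr_id sG)).
- by rewrite DEg.
- exact/(measurable_restrictT _ _).1/measurable_funTS.
- rewrite DEg; apply: ((integrable_mkcond (EFin \o (g : T -> R)) (mG mA)).1 _).
  exact: (integrableS measurableT (mG mA)).
Qed.

End restriction.

Section condexp_theory.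
Context {d : measure_display} {T : measurableType d} {R : realType}.
Variable P : probability T R.
Implicit Types (f g h : T -> R) (G : set (set T)).
Local Notation integ f := (P.-integrable setT (EFin \o f)).
Local Notation Ex f := (Rintegral P setT f).

Lemma condexpP G f : subsig G -> integ f -> is_condexp P G f (condexp P G f).
Proof.
move=> sG fi; have [g gE] := condexp_ex sG fi.
rewrite /condexp; apply: (xgetPex _ (P := [set g | is_condexp P G f g])); by exists g.
Qed.

Lemma is_condexp_orth G f g : subsig G -> is_condexp P G f g ->
  orth P G (fun x => f x - g x).
Proof.
move=> sG [fi gi gg E]; split; first exact: integB.
move=> A GA; have mA := sG.2 _ GA; have := E A GA.
rewrite !integral_Ex// => -[e].
rewrite (@Ex_ext _ _ _ _ _ (fun x => f x * \1_A x - g x * \1_A x)); last first.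
  by move=> x; rewrite mulrBl.
by rewrite ExB ?e ?subrr//; exact: integ_indicM.
Qed.

Lemma condexp_orth G f : subsig G -> integ f ->
  orth P G (fun x => f x - condexp P G f x).
Proof. by move=> sG fi; exact/is_condexp_orth/condexpP. Qed.

Lemma condexp_integ G f : subsig G -> integ f -> integ (condexp P G f).
Proof. by move=> sG /(condexpP sG)[]. Qed.

(** For non-integrable [f] this is about the default version, a constant. *)
Lemma condexp_gmeas G f : subsig G -> gmeas G (condexp P G f).
Proof.
move=> sG; rewrite /condexp; case: xgetP => [g _ [] //|_]; exact: gmeas_cst.
Qed.

(** Test on the event where [h] is positive: there the positive part of [h] has nonpositive
    expectation, so it vanishes almost surely. *)
Lemma gmeas_le0 G h : subsig G -> gmeas G h -> integ h ->
  (forall A, G A -> Ex (fun x => h x * \1_A x) <= 0) -> {ae P, forall x, h x <= 0}.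
Proof.
move=> sG gh hi hA.
have GA : G [set x | 0 < h x].
  rewrite (_ : [set _ | _] = h @^-1` `]0, +oo[%classic); first exact: gh.
  by apply/seteqP; split=> x; rewrite /= in_itv/= andbT.
have mA := sG.2 _ GA.
pose k x := h x * \1_[set x | 0 < h x] x.
have k0 x : 0 <= k x.
  rewrite /k indicE; have [hx|hx] := ltP 0 (h x).
    by rewrite mem_set// mulr1 ltW.
  by rewrite memNset ?mulr0//=; apply/negP; rewrite -leNgt.
have ki : integ k by exact: integ_indicM.
have Ek : (\int[P]_x `|(k x)%:E| = 0)%E.
  rewrite (eq_integral (fun x => (k x)%:E)); last first.
    by move=> x _; rewrite gee0_abs// lee_fin.
  rewrite -[LHS]fineK ?(integrable_fin_num measurableT ki)//.
  by congr EFin; apply/eqP; rewrite eq_le (hA _ GA) Ex_ge0.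
have /ae_eq_integral_abs : measurable_fun setT (EFin \o k).
  by apply/measurable_EFinP; exact: integ_meas ki.
move=> /(_ P measurableT)[+ _] => /(_ Ek); apply: filterS => x /(_ I)[].
rewrite /k indicE; have [hx|//] := ltP 0 (h x).
by rewrite mem_set// mulr1 => h0; rewrite h0 ltxx in hx.
Qed.

Lemma orth_ge0 G (f h : T -> R) : subsig G -> (forall x, 0 <= f x) -> integ f ->
  gmeas G h -> integ h -> orth P G (fun x => f x - h x) -> {ae P, forall x, 0 <= h x}.
Proof.
move=> sG f0 fi gh hi [_ o].
have : {ae P, forall x, - h x <= 0}.
  apply: (gmeas_le0 sG); [exact: gmeasN|exact: integN|move=> E GE].
  have mE := sG.2 _ GE.
  rewrite (@Ex_ext _ _ _ _ _ (fun x => (f x - h x) * \1_E x - f x * \1_E x)).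
    rewrite ExB ?o ?sub0r ?oppr_le0//; [|by apply: integ_indicM => //; exact: integB|
      exact: integ_indicM].
    by apply: Ex_ge0 => x; rewrite mulr_ge0// indicE.
  by move=> x; ring.
by apply: filterS => x; rewrite oppr_le0.
Qed.

(** Uniqueness of versions: both differences integrate to 0 over every event of [G], so [gmeas_le0]
    applies in both directions. *)
Lemma condexp_ae G f g : subsig G -> gmeas G g -> integ f ->
  orth P G (fun x => f x - g x) -> {ae P, forall x, condexp P G f x = g x}.
Proof.
move=> sG gg fi o.
have o' := condexp_orth sG fi; set c := condexp P G f in o' *.
have ci : integ c by exact: condexp_integ.
have gi : integ g.
  by apply: integ_ext (integB fi o.1) => x; rewrite opprB addrCA subrr addr0.
have gc : gmeas G c by exact: condexp_gmeas.
have ae_le u v : gmeas G u -> gmeas G v -> integ u -> integ v ->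
    orth P G (fun x => f x - u x) -> orth P G (fun x => f x - v x) ->
    {ae P, forall x, u x - v x <= 0}.
  move=> gu gv ui vi ou ov; apply: (@gmeas_le0 G) => //; first exact: gmeasB.
    exact: integB.
  move=> A GA; have mA := sG.2 _ GA.
  rewrite (@Ex_ext _ _ _ _ _ (fun x => (f x - v x) * \1_A x - (f x - u x) * \1_A x)).
    by rewrite ExB ?ou.2 ?ov.2 ?subrr//; apply: integ_indicM => //; exact: integB.
  by move=> x; ring.
apply: filterS2 (ae_le c g gc gg ci gi o' o) (ae_le g c gg gc gi ci o o') => x.
by rewrite !subr_le0 => h1 h2; apply: le_anti; rewrite h1 h2.
Qed.

Lemma subsigT G : subsig G -> G setT.
Proof. by move=> [[g0 gC _] _]; rewrite -(setD0 setT); exact: gC. Qed.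

(** The bound on events forces the conditional expectation into the interval from [- K] to [K]
    almost surely, so clamping changes it on a null set only and yields a version bounded at every
    point. *)
Lemma cond_version G f (K : R) : subsig G -> integ f ->
  (forall A, G A -> `|Ex (fun x => f x * \1_A x)| <= K * Ex (\1_A)) ->
  exists m, [/\ gmeas G m, (forall x, `|m x| <= K) &
    orth P G (fun x => f x - m x)].
Proof.
move=> sG fi fK.
have K0 : 0 <= K.
  have := fK setT (subsigT sG); rewrite Ex_indic// probability_setT/= mulr1.
  exact: le_trans.
pose c := condexp P G f; have gc : gmeas G c := condexp_gmeas f sG.
have o := condexp_orth sG fi; have ci : integ c := condexp_integ sG fi.
have cA A : G A -> Ex (fun x => c x * \1_A x) = Ex (fun x => f x * \1_A x).
  move=> GA; have mA := sG.2 _ GA; apply/esym/eqP.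
  rewrite -subr_eq0 -ExB ?integ_indicM//; apply/eqP; rewrite -[RHS](o.2 A GA).
  by apply: Ex_ext => x; rewrite mulrBl.
have i1 A : G A -> integ (\1_A : T -> R).
  move=> GA; apply: integ_bnd (norm_indic A).
  by apply: measurable_indic; exact: sG.2.
have le1 : {ae P, forall x, c x - K <= 0}.
  apply: (@gmeas_le0 G) => //.
  - by apply: gmeasB => //; exact: gmeas_cst.
  - by apply: integB => //; exact: integ_cst.
  - move=> A GA; have mA := sG.2 _ GA.
    rewrite (@Ex_ext _ _ _ _ _ (fun x => c x * \1_A x - K * \1_A x)); last first.
      by move=> x; rewrite mulrBl.
    rewrite ExB ?integ_indicM//; last exact: integ_cst.
    rewrite (ExZ _ (i1 _ GA)) (cA _ GA) subr_le0.
    exact: le_trans (ler_norm _) (fK A GA).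
have le2 : {ae P, forall x, - c x - K <= 0}.
  apply: (@gmeas_le0 G) => //.
  - by apply: gmeasB => //; [exact: gmeasN|exact: gmeas_cst].
  - by apply: integB => //; [exact: integN|exact: integ_cst].
  - move=> A GA; have mA := sG.2 _ GA.
    rewrite (@Ex_ext _ _ _ _ _ (fun x => (-1) * (c x * \1_A x) - K * \1_A x)); last first.
      by move=> x; rewrite mulrBl mulN1r mulNr.
    rewrite ExB; [|by apply: integZ; exact: integ_indicM|exact: integZ (i1 _ GA)].
    have iA := i1 _ GA; have icA := integ_indicM mA ci.
    rewrite !ExZ// (cA _ GA) subr_le0.
    by rewrite mulN1r; apply: le_trans (fK A GA); rewrite -normrN ler_norm.
pose m x := Num.max (- K) (Num.min K (c x)).
have gm : gmeas G m.
  by apply: gmeas_max; rewrite //; [exact: gmeas_cst|apply: gmeas_min => //; exact: gmeas_cst].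
exists m; split=> //.
  move=> x; rewrite ler_norml /m le_max lexx/= ge_max ge_min lexx/= andbT.
  by rewrite (le_trans _ K0)// oppr_le0.
apply: orth_ae o _ _ => //.
  apply: measurable_funB; first exact: integ_meas fi.
  exact: gmeas_meas gm.
apply: filterS2 le1 le2 => x; rewrite subr_le0 => h1 h2; rewrite /m.
by rewrite (min_idPr h1) (max_idPr _)// lerNl -subr_le0.
Qed.

(** The almost sure bound is made pointwise by taking the minimum with [C], which changes no
    integral. *)
Lemma condexp_boundedP G f (C : R) : subsig G -> condexp_bounded P G f C ->
  forall A, G A -> Ex (fun x => f x * \1_A x) <= C * Ex (\1_A).
Proof.
move=> sG [fi fC] A GA; have mA := sG.2 _ GA.
have o := condexp_orth sG fi; have ci := condexp_integ sG fi.
have i1 : integ (\1_A : T -> R).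
  by apply: integ_bnd (norm_indic A); exact: measurable_indic.
have -> : Ex (fun x => f x * \1_A x) = Ex (fun x => condexp P G f x * \1_A x).
  apply/eqP; rewrite -subr_eq0 -ExB ?integ_indicM//.
  apply/eqP; rewrite -[RHS](o.2 A GA).
  by apply: Ex_ext => x; rewrite mulrBl.
pose k x := Num.min (condexp P G f x) C.
have mk : measurable_fun setT k.
  by apply: measurable_minr => //; exact: integ_meas ci.
have ek : {ae P, forall x, condexp P G f x = k x}.
  by apply: filterS fC => x h; rewrite /k (min_idPl h).
have ki : integ k by exact: integ_ae ek.
rewrite (@Ex_ae _ _ _ _ _ (fun x => k x * \1_A x)).
- rewrite -ExZ//; apply: Ex_le; [exact: integ_indicM|exact: integZ|] => x.
  by rewrite ler_wpM2r ?indicE// /k ge_min lexx orbT.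
- by apply: measurable_funM; [exact: integ_meas ci|exact: measurable_indic].
- by apply: measurable_funM => //; exact: measurable_indic.
- by apply: filterS ek => x ->.
Qed.

End condexp_theory.

(** * Orthogonality tested on a generating pi-system *)

Section pi_system.
Context {d : measure_display} {T : measurableType d} {R : realType}.
Variable P : probability T R.
Local Notation integ f := (P.-integrable setT (EFin \o f)).
Local Notation Ex f := (Rintegral P setT f).

Lemma subsig_gen (C : set (set T)) : C `<=` measurable -> subsig <<s C >>.
Proof.
move=> Cm; split; first exact: smallest_sigma_algebra.
by apply: smallest_sub => //; exact: sigma_algebra_measurable.
Qed.

(** The events over which [f] integrates to 0 form a Dynkin system: the whole space gives
    complements, and sigma-additivity of the charge induced by [f] gives disjoint unions. *)
Lemma orth_pi (C : set (set T)) (f : T -> R) : C `<=` measurable ->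
  setI_closed C -> C setT -> integ f ->
  (forall A, C A -> Ex (fun x => f x * \1_A x) = 0) -> orth P <<s C >> f.
Proof.
move=> Cm CI CT fi f0; split=> // A.
rewrite -setI_closed_g_dynkin_g_sigma_algebra// => sA.
suff [] : [set A | measurable A /\ Ex (fun x => f x * \1_A x) = 0] A by [].
apply: sA; split; last by move=> B CB; split; [exact: Cm|exact: f0].
split.
- by split=> //; exact: f0.
- move=> B [mB B0]; split; first exact: measurableC.
  rewrite (@Ex_ext _ _ _ _ _ (fun x => f x * \1_setT x - f x * \1_B x)).
    by rewrite ExB ?integ_indicM// f0// B0 subrr.
  move=> x; rewrite -mulrBr !indicE in_setT; congr (_ * _).
  have [Bx|nBx] := pselect (B x).
    by rewrite (mem_set Bx) memNset ?subrr// => /(_ Bx).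
  by rewrite (memNset nBx) mem_set ?subr0.
- move=> F tF F0; have mF n := (F0 n).1; have mU := bigcupT_measurable F mF.
  split=> //.
  have iE B (mB : measurable B) : induced_charge fi B = (Ex (fun x => f x * \1_B x))%:E.
    exact: integral_Ex.
  have : (fun n => \sum_(0 <= i < n) induced_charge fi (F i))%E @ \oo -->
      induced_charge fi (\bigcup_n F n).
    exact: (@charge_semi_sigma_additive _ _ _ (induced_charge fi)).
  rewrite iE// (_ : (fun n => _) = cst 0%E); last first.
    by apply/funext => n; rewrite big1// => i _; rewrite iE// (F0 _).2.
  move=> /(cvg_lim (@ereal_hausdorff R)); rewrite lim_cst; last exact: ereal_hausdorff.
  by case=> <-.
Qed.

End pi_system.

(** * Enlarging a sigma-algebra by conditionally independent variables *)

Section filtration.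
Context {d : measure_display} {T : measurableType d} {R : realType}.
Variables (P : probability T R) (G : set (set T)) (m : nat).
Variable X : 'I_m -> {RV P >-> R}.
Hypothesis sG : subsig G.
Local Notation integ f := (P.-integrable setT (EFin \o f)).
Local Notation Ex f := (Rintegral P setT f).

Definition before (k : nat) : {set 'I_m} := [set t : 'I_m | (t < k)%N].

Definition event_on (J : {set 'I_m}) (B : 'I_m -> set R) : set T :=
  \bigcap_(t in [set` J]) (X t @^-1` B t).

(** Products of an event of [G] and a rectangle in the earlier variables: a pi-system, so that
    orthogonality to [filt k] has to be checked on these sets only. *)
Definition cylinders (k : nat) : set (set T) :=
  [set E | exists A B, [/\ G A, (forall t, measurable (B t)) &
    E = A `&` event_on (before k) B]].

Definition filt (k : nat) : set (set T) := <<s cylinders k >>.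

Lemma RV_preimage_measurable t (B : set R) : measurable B ->
  measurable (X t @^-1` B).
Proof. by move=> mB; rewrite -[X in measurable X]setTI; exact: measurable_funPT. Qed.

Lemma event_on_measurable J B : (forall t, measurable (B t)) ->
  measurable (event_on J B).
Proof.
move=> mB; apply: fin_bigcap_measurable => // t _; exact: RV_preimage_measurable.
Qed.

Lemma cylinders_measurable k : cylinders k `<=` measurable.
Proof.
by move=> _ [A [B [GA mB ->]]]; apply: measurableI; [exact: sG.2|exact: event_on_measurable].
Qed.

Lemma filt_subsig k : subsig (filt k).
Proof. exact/subsig_gen/cylinders_measurable. Qed.

Lemma cylinders_setI k : setI_closed (cylinders k).
Proof.
move=> _ _ [A [B [GA mB ->]]] [A' [B' [GA' mB' ->]]].
exists (A `&` A'), (fun t => B t `&` B' t); split.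
- have : measurable ((A : set (g_sigma_algebraType G)) `&` A').
    by apply: measurableI; rewrite (measurable_g_measurableTypeE sG.1).
  by rewrite (measurable_g_measurableTypeE sG.1).
- by move=> t; exact: measurableI.
- rewrite setIACA; congr (_ `&` _); apply/seteqP; split.
    by move=> x [h h'] t Jt; split; [exact: h|exact: h'].
  by move=> x h; split=> t Jt; case: (h t Jt).
Qed.

Lemma filt_sub k : G `<=` filt k.
Proof.
move=> A GA; apply: sub_gen_smallest; exists A, (fun=> setT); split=> //.
by apply/seteqP; split=> [x Ax|x []//].
Qed.

Lemma filt_le k l : (k <= l)%N -> filt k `<=` filt l.
Proof.
move=> kl; apply: smallest_sub; first exact: smallest_sigma_algebra.
move=> _ [A [B [GA mB ->]]]; apply: sub_gen_smallest.
exists A, (fun t : 'I_m => if (t < k)%N then B t else setT); split=> //.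
  by move=> t; case: ifP.
congr (_ `&` _); apply/seteqP; split=> x h t; rewrite /= inE => tk.
  by case: ifP => // tk'; apply: (h t); rewrite /= inE.
by have := h t; rewrite /= inE tk; apply; exact: leq_trans tk kl.
Qed.

Lemma gmeas_filt k (t : 'I_m) : (t < k)%N -> gmeas (filt k) (X t).
Proof.
move=> tk B mB; apply: sub_gen_smallest.
exists setT, (fun s => if s == t then B else setT); split.
- exact: subsigT.
- by move=> s; case: ifP.
- rewrite setTI; apply/seteqP; split=> x h.
    by move=> s _; case: eqP => // ->.
  by have := h t; rewrite /= inE tk eqxx; exact.
Qed.

Hypothesis indep : cond_independent G X.

(** Conditional independence makes the earlier variables irrelevant for the conditional moments of
    [X k]. On a cylinder built from [A] and an event [E] of the earlier variables, the indicator of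
    [E] is replaced by a version [p] of its conditional probability, and the error of this
    replacement is orthogonal to [X k]. *)
Lemma orth_filt (k : 'I_m) (h : R -> R) (mu : T -> R) (K : R) :
  measurable_fun setT h -> integ (fun x => h (X k x)) -> gmeas G mu ->
  (forall x, `|mu x| <= K) -> orth P G (fun x => h (X k x) - mu x) ->
  orth P (filt k) (fun x => h (X k x) - mu x).
Proof.
move=> mh hi gmu muK o; apply: orth_pi.
- exact: cylinders_measurable.
- exact: cylinders_setI.
- exists setT, (fun=> setT); split=> //; first exact: subsigT.
  by rewrite setTI; apply/seteqP; split.
- exact: o.1.
move=> _ [A [B [GA mB ->]]].
pose J := before k; pose E := event_on J B.
have mE : measurable E by exact: event_on_measurable.
have mA : measurable A := sG.2 _ GA.
have version (F : set T) : measurable F -> exists p, [/\ gmeas G p,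
    (forall x, `|p x| <= 1) & orth P G (fun x => \1_F x - p x)].
  move=> mF; have iF : integ (\1_F : T -> R).
    by apply: integ_bnd (norm_indic F); exact: measurable_indic.
  apply: cond_version => // C GC; have mC := sG.2 _ GC; rewrite mul1r.
  have iC : integ (\1_C : T -> R).
    by apply: integ_bnd (norm_indic C); exact: measurable_indic.
  apply: Ex_norm_le => //; first exact: integ_indicM.
  move=> x; rewrite normrM -[leRHS]mul1r ger0_norm ?indicE// ger0_norm//.
  by rewrite ler_wpM2r// lern1 leq_b1.
have [p [gp p1 op]] := version E mE.
(* Replacement error on [A]. It has to be shown orthogonal to all of sigma([X k]), so that it can be
   integrated against [h (X k)]. *)
pose Z x := (\1_E x - p x) * \1_A x : R.
have gA : gmeas G (\1_A : T -> R) by exact: gmeas_indic.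
have mp := gmeas_meas sG gp; have mmu := gmeas_meas sG gmu.
have m1E : measurable_fun setT (\1_E : T -> R) by exact: measurable_indic.
have m1A : measurable_fun setT (\1_A : T -> R) by exact: measurable_indic.
have Z2 x : `|Z x| <= 2.
  rewrite /Z normrM -[leRHS]mulr1; apply: ler_pM => //; last exact: norm_indic.
  by rewrite (le_trans (ler_normB _ _))// -[2]/(1 + 1) lerD// norm_indic.
have mZ : measurable_fun setT Z.
  by apply: measurable_funM => //; exact: measurable_funB.
have Zi : integ Z by exact: integ_bnd Z2.
have ZB C : measurable C -> Ex (fun x => Z x * \1_(X k @^-1` C) x) = 0.
  move=> mC; have mXC := RV_preimage_measurable k mC.
  have [c [gc c1 oc]] := version _ mXC.
  (* The independence hypothesis speaks of families of sets, so the event on [X k] is appended to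
     the family defining [E]; the product formula for [k |: J] then splits off the factor of [k]. *)
  pose B' t := if t == k then C else B t.
  have mB' t : measurable (B' t) by rewrite /B'; case: ifP.
  have kJ : k \notin J by rewrite inE ltnn.
  have EU : event_on (k |: J) B' = E `&` X k @^-1` C.
    apply/seteqP; split=> x.
      move=> hx; split; last first.
        by have := hx k; rewrite /B' eqxx; apply; rewrite /= in_setU1 eqxx.
      move=> t /= tJ; have := hx t; rewrite /B' /= in_setU1 tJ orbT => /(_ isT).
      by case: eqP tJ => // ->; rewrite (negbTE kJ).
    move=> [h1 h2] t /=; rewrite /B' in_setU1; case: eqP => [-> //|_ /= tJ].
    exact: h1.
  have mc := gmeas_meas sG gc.
  have oEC : orth P G (fun x => \1_(E `&` X k @^-1` C) x - p x * c x).
    have mEC : measurable (E `&` X k @^-1` C) by exact: measurableI.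
    have iEC : integ (\1_(E `&` X k @^-1` C) : T -> R).
      by apply: integ_bnd (norm_indic _); exact: measurable_indic.
    apply: orth_ae (condexp_orth sG iEC) _ _ => //.
      apply: measurable_funB; first exact: measurable_indic.
      exact: measurable_funM.
    have iE : integ (\1_E : T -> R) by exact: integ_bnd (norm_indic E).
    have iC : integ (\1_(X k @^-1` C) : T -> R).
      by apply: integ_bnd (norm_indic _); exact: measurable_indic.
    have h1 := indep (k |: J) mB'; have h2 := indep J mB.
    have h3 := condexp_ae sG gp iE op; have h4 := condexp_ae sG gc iC oc.
    apply: filterS2 (filterI h1 h2) (filterI h3 h4) => x [e1 e2] [e3 e4].
    congr (_ - _); rewrite -EU; move: e1; rewrite /event_on => ->.
    rewrite big_setU1//= {1}/B' eqxx e4 mulrC; congr (_ * _).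
    rewrite -e3 /E /event_on e2; apply: eq_bigr => t tJ.
    by rewrite /B'; case: eqP tJ => // ->; rewrite (negbTE kJ).
  pose u x := \1_(E `&` X k @^-1` C) x - p x * c x : R.
  pose w x := \1_(X k @^-1` C) x - c x : R.
  have bnd2 : forall x, `|p x * \1_A x| <= 1.
    move=> x; rewrite normrM -[leRHS]mulr1; apply: ler_pM => //; exact: norm_indic.
  have mpA : measurable_fun setT (fun x => p x * \1_A x) by exact: measurable_funM.
  have i1 : integ (fun x => u x * \1_A x) by apply: integ_indicM => //; exact: oEC.1.
  have i2 : integ (fun x => w x * (p x * \1_A x)).
    by apply: integM_bnd bnd2 => //; exact: oc.1.
  rewrite (@Ex_ext _ _ _ _ _ (fun x => u x * \1_A x - w x * (p x * \1_A x))).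
    rewrite ExB// oEC.2// (orthE sG oc) ?subrr//; exact: gmeasM.
  by move=> x; rewrite /Z /u /w indicI /=; ring.
have oZ : orth P (g_sigma_algebra_preimage (X k)) Z.
  split=> // F [C mC <-]; rewrite setTI; exact: ZB.
have sX : subsig (g_sigma_algebra_preimage (X k)).
  split; first exact: (sigma_algebra_preimage _ _ (sigma_algebra_measurable _)).
  by move=> F [C mC <-]; rewrite setTI; exact: RV_preimage_measurable.
have gX : gmeas (g_sigma_algebra_preimage (X k)) (fun x => h (X k x)).
  apply: gmeas_comp => // C mC; exists C => //; exact: setTI.
have mhX := integ_meas hi.
have iZh : integ (fun x => Z x * h (X k x)).
  by apply: integ_ext (integM_bnd hi mZ Z2) => x; rewrite mulrC.
have e1 : Ex (fun x => Z x * h (X k x)) = 0 by exact: orthE sX oZ gX iZh.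
have e2 : Ex (fun x => (\1_E x - p x) * (\1_A x * mu x)) = 0.
  apply: (orthE sG op); first exact: gmeasM.
  apply: integ_ext (integM_bnd Zi mmu muK) => x; exact/esym/mulrA.
have i3 : integ (fun x => (\1_E x - p x) * (\1_A x * mu x)).
  apply: integ_ext (integM_bnd Zi mmu muK) => x; exact/esym/mulrA.
have bpA : forall x, `|p x * \1_A x| <= 1.
  move=> x; rewrite normrM -[leRHS]mulr1; apply: ler_pM => //; exact: norm_indic.
have i4 : integ (fun x => (h (X k x) - mu x) * (p x * \1_A x)).
  by apply: integM_bnd bpA => //; [exact: o.1|exact: measurable_funM].
have e3 : Ex (fun x => (h (X k x) - mu x) * (p x * \1_A x)) = 0.
  by apply: (orthE sG o) => //; exact: gmeasM.
(* The three terms vanish for different reasons: independence of the earlier variables, the choice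
   of [p], and the hypothesis on [mu] given [G]. *)
rewrite (@Ex_ext _ _ _ _ _ (fun x => Z x * h (X k x) -
   (\1_E x - p x) * (\1_A x * mu x) + (h (X k x) - mu x) * (p x * \1_A x))).
  rewrite ExD//; last exact: integB.
  by rewrite ExB// e1 e2 e3 subrr addr0.
by move=> x; rewrite /Z indicI /=; ring.
Qed.

End filtration.

(** * The Gaussian solution of the heat equation *)

Section taylor.
Context {R : realType}.
Implicit Types (f : R -> R) (x y a L : R).

(** Unordered interval: the Taylor bounds are used with increments of either sign. *)
Definition between x y z := (x <= z <= y) || (y <= z <= x).

Lemma between_dist x y z : between x y z -> `|z - x| <= `|y - x|.
Proof.
move=> /orP[/andP[h1 h2]|/andP[h1 h2]].
  by rewrite !ger0_norm ?subr_ge0 ?lerD2r ?(le_trans h1 h2).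
by rewrite !ler0_norm ?subr_le0 ?lerN2 ?lerD2r ?(le_trans h1 h2).
Qed.

Lemma betweenP x y z : reflect (Num.min x y <= z <= Num.max x y) (between x y z).
Proof.
rewrite /between; have [xy|yx] := leP x y.
  apply: (iffP orP) => [[//|/andP[h1 h2]]|]; last by left.
  by apply/andP; split; lra.
apply: (iffP orP) => [[/andP[h1 h2]|//]|]; last by right.
by apply/andP; split; lra.
Qed.

Lemma between_itv x y u v z : between x y u -> between x y v ->
  u <= z <= v -> between x y z.
Proof.
move=> /betweenP/andP[h1 _] /betweenP/andP[_ h2] /andP[h3 h4].
by apply/betweenP; rewrite (le_trans h1 h3) (le_trans h4 h2).
Qed.

Lemma betweenl x y : between x y x.
Proof. by apply/betweenP; rewrite ge_min le_max lexx. Qed.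

Lemma betweenr x y : between x y y.
Proof. by apply/betweenP; rewrite ge_min le_max lexx !orbT. Qed.

Lemma between_sub x y c z : between x y c -> between x c z -> between x y z.
Proof.
move=> cb /orP[]; apply: between_itv => //; exact: betweenl.
Qed.

Lemma mvt f (f1 : R -> R) x y :
  (forall z, between x y z -> is_derive z 1 f (f1 z)) ->
  exists2 c, between x y c & f y - f x = f1 c * (y - x).
Proof.
move=> df.
have cf u v : between x y u -> between x y v ->
    {within `[u, v], continuous f}.
  move=> bu bv; apply: derivable_within_continuous => z.
  rewrite in_itv/=.
  by move=> /(between_itv bu bv)/df[].
have [xy|yx] := leP x y.
  have [||c cab e] := @MVT_segment R f f1 x y xy.
  - by move=> z; rewrite in_itv/= => /andP[h1 h2]; apply: df; rewrite /between (ltW h1) (ltW h2).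
  - by apply: cf; [exact: betweenl|exact: betweenr].
  - by exists c => //; move: cab; rewrite in_itv/= /between => ->.
have [||c cab e] := @MVT_segment R f f1 y x (ltW yx).
- by move=> z; rewrite in_itv/= => /andP[h1 h2]; apply: df; rewrite /between (ltW h1) (ltW h2) ?orbT.
- by apply: cf; [exact: betweenr|exact: betweenl].
- exists c; first by move: cab; rewrite in_itv/= /between => ->; rewrite orbT.
  by rewrite -(opprB (f x)) e -mulrN opprB.
Qed.

Lemma lipschitz_mvt f (f1 : R -> R) L x y :
  (forall z, between x y z -> is_derive z 1 f (f1 z)) ->
  (forall z, between x y z -> `|f1 z| <= L) -> `|f y - f x| <= L * `|y - x|.
Proof.
move=> df fL; have [c cb ->] := mvt df.
by rewrite normrM ler_wpM2r// fL.
Qed.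

(** Two applications of the mean value theorem; this gives the factor [L] in place of the sharp
    [L / 2]. *)
Lemma taylor1 f (f1 f2 : R -> R) L x y :
  (forall z, between x y z -> is_derive z 1 f (f1 z)) ->
  (forall z, between x y z -> is_derive z 1 f1 (f2 z)) ->
  (forall z, between x y z -> `|f2 z| <= L) ->
  `|f y - f x - f1 x * (y - x)| <= L * (y - x) ^+ 2.
Proof.
move=> df df1 fL; have [c cb ->] := mvt df.
rewrite -mulrBl normrM -real_normK ?num_real// expr2 mulrA ler_wpM2r//.
apply: (@le_trans _ _ (L * `|c - x|)).
  by apply: (lipschitz_mvt (f1 := f2)) => z /(between_sub cb); [exact: df1|exact: fL].
apply: ler_wpM2l; last exact: between_dist.
exact: le_trans (normr_ge0 _) (fL x (betweenl x y)).
Qed.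

End taylor.

Section normal_cdf.
Context {R : realType}.
Implicit Types (x y z s a : R).
Local Notation mu := (@lebesgue_measure R).

Definition phi : R -> R := normal_pdf 0 1.

Definition Phi x : R := fine (normal_prob 0 1 `]-oo, x]%classic).

Definition phi_peak : R := normal_peak (1 : R).

Lemma phiE y : phi y = phi_peak * expR (- (2^-1 * y ^+ 2)).
Proof.
rewrite /phi normal_pdfE ?oner_neq0// /normal_fun subr0 expr1n; congr (_ * expR _).
by rewrite -(mulr_natr 1 2) mul1r mulNr mulrC.
Qed.

Lemma phi_peak_bnd : 0 <= phi_peak <= 1.
Proof.
rewrite normal_peak_ge0/= /phi_peak /normal_peak expr1n mul1r invf_le1.
  rewrite -sqrtr1; apply: ler_wsqrtr; have := @pi_ge2 R; rewrite -mulr_natr; lra.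
by rewrite sqrtr_gt0 -mulr_natr mulr_gt0// pi_gt0.
Qed.

Lemma phi_ge0 y : 0 <= phi y.
Proof. exact: normal_pdf_ge0. Qed.

Lemma phi_le1 y : phi y <= 1.
Proof.
have /andP[p0 p1] := phi_peak_bnd.
rewrite phiE -[leRHS]mulr1 ler_pM ?expR_ge0// -expR0 ler_expR oppr_le0.
by rewrite mulr_ge0// sqr_ge0.
Qed.

(** The constant comes from exp u >= u^2 / 2 at u = y^2 / 2, which is y^4 / 8. *)
Lemma phi_y4 y : y ^+ 4 * phi y <= 8.
Proof.
have /andP[p0 p1] := phi_peak_bnd.
set u := 2^-1 * y ^+ 2; have u0 : 0 <= u by rewrite mulr_ge0// sqr_ge0.
have := expR_ge1Dxn 1 u0 => h.
rewrite phiE -/u expRN mulrCA ; apply: (@le_trans _ _ (y ^+ 4 / expR u)).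
  by rewrite ler_piMl// mulr_ge0 ?invr_ge0 ?expR_ge0// (exprM y 2 2) sqr_ge0.
rewrite ler_pdivrMr ?expR_gt0//; apply: le_trans (ler_wpM2l _ h) => //.
have -> : u ^+ 2 = 4^-1 * y ^+ 4 by rewrite /u; field.
rewrite (_ : 2`!%:R = 2)//; lra.
Qed.

Lemma phi_pow n y : (n <= 4)%N -> `|y| ^+ n * phi y <= 9.
Proof.
move=> n4; apply: (@le_trans _ _ ((1 + y ^+ 4) * phi y)).
  apply: ler_wpM2r; first exact: phi_ge0.
  have y4 : y ^+ 4 = `|y| ^+ 4 by rewrite (exprM y 2 2) -(real_normK (num_real y)) -exprM.
  have [y1|y1] := leP `|y| 1.
    by rewrite (le_trans (exprn_ile1 _ _ _))// y4 lerDl exprn_ge0.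
  rewrite y4; apply: (@le_trans _ _ (`|y| ^+ 4)); last by rewrite lerDr.
  by apply: ler_weXn2l => //; exact: ltW.
by rewrite mulrDl mul1r (_ : 9 = 1 + 8)%R ?lerD ?phi_le1 ?phi_y4//; ring.
Qed.

Lemma is_derive_phi y : is_derive y 1 phi (- (y * phi y)).
Proof.
have h : is_derive y 1 (fun x : R => - (2^-1 * x ^+ 2)) (- y).
  apply: is_derive_eq; rewrite /GRing.scale/= -mulr_natr; lra.
have he := is_derive1_comp (is_derive_expR _) h.
have -> : phi = (fun x => phi_peak * (expR \o (fun x : R => - (2^-1 * x ^+ 2))) x).
  by apply/funext => x; exact: phiE.
apply: is_derive_eq.
by rewrite /GRing.scale/=; ring.
Qed.

Lemma is_derive_phi1 y : is_derive y 1 (fun x => - (x * phi x)) ((y ^+ 2 - 1) * phi y).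
Proof.
have h := is_derive_phi y.
apply: is_derive_eq; rewrite /GRing.scale/=; ring.
Qed.

Lemma is_derive_Phi y : is_derive y 1 Phi (phi y).
Proof.
have y1 : y < y + 1 by rewrite ltrDl.
have i : mu.-integrable `]-oo, y + 1] (EFin \o phi).
  by apply: (integrableS measurableT) => //; exact: integrable_normal_pdf.
have cphi : {for y, continuous phi} by exact/continuous_normal_pdf/oner_neq0.
have [dP eP] := continuous_FTC1 y1 i (ltNyr y) cphi.
by apply: DeriveDef; [exact: dP|rewrite -derive1E; exact: eP].
Qed.

Lemma Phi_ge0 y : 0 <= Phi y.
Proof. by rewrite fine_ge0. Qed.

Lemma PhiE y : (Phi y)%:E = normal_prob 0 1 `]-oo, y]%classic.
Proof. by rewrite /Phi fineK// fin_num_measure. Qed.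

Lemma Phi_le1 y : Phi y <= 1.
Proof. by rewrite -lee_fin PhiE probability_le1. Qed.

Lemma Phi_homo : {homo Phi : x y / x <= y}.
Proof.
move=> x y xy; rewrite -lee_fin !PhiE le_measure ?inE//.
exact: subitvPr.
Qed.

Let idTR : measurableTypeR R -> R := idfun.

#[local] HB.instance Definition _ :=
  @isMeasurableFun.Build _ _ _ _ idTR (@measurable_id _ _ setT).

Lemma Phi_cvgy : Phi x @[x --> +oo%R] --> (1 : R).
Proof.
by have /fine_cvg := @cvg_cdfy1 _ _ R (normal_prob 0 1) idTR.
Qed.

Lemma Phi_cvgNy : Phi x @[x --> -oo%R] --> (0 : R).
Proof.
by have /fine_cvg := @cvg_cdfNy0 _ _ R (normal_prob 0 1) idTR.
Qed.

Lemma normal_prob_scale s t : 0 < s ->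
  normal_prob 0 s `]-oo, t]%classic = (Phi (t / s))%:E.
Proof.
move=> s0; rewrite PhiE /normal_prob; have sn0 : s != 0 by rewrite gt_eqF.
pose F (y : R) : R := s * y.
have iF z : is_derive z 1 F s.
  by apply: is_derive_eq; rewrite /GRing.scale/= mulr1.
have dF : (F^`())%classic = cst s.
  by apply/funext => y; rewrite derive1E; apply: derive_val.
have eF : t = F (t / s) by rewrite /F mulrC divfK.
rewrite [in LHS]eF increasing_ge0_integration_by_substitutionNy.
- apply: eq_integral => y _; congr EFin.
  rewrite dF /= !fctE/= !normal_pdfE ?oner_neq0// /normal_fun /normal_peak.
  rewrite -!mulrnAr (sqrtrM (pi *+ 2) (sqr_ge0 s)) sqrtr_sqr gtr0_norm//.
  rewrite expr1n mul1r invfM -[in LHS]mulrA [X in _ * X]mulrC mulrA.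
  rewrite (mulrC s^-1) mulfVK//.
  congr (_ * expR _); rewrite /F !subr0 -(mulr_natr s 2); field.
  by rewrite sn0.
- by move=> x y _ _ xy; rewrite /F ltr_pM2l.
- by rewrite dF => ? _; exact: cst_continuous.
- by rewrite dF; exact: is_cvg_cst.
- by rewrite dF; exact: cvg_cst.
- split=> [z _|]; first by case: (iF z).
  apply: cvg_at_left_filter; apply: cvgM; [exact: cvg_cst|exact: cvg_id].
- by apply: gt0_cvgMrNy.
- by apply: continuous_subspaceT; exact: continuous_normal_pdf.
- by move=> y _; exact: normal_pdf_ge0.
Qed.

(** The cubic bound holds because the derivative of the remainder in [h] is a first-order Taylor
    remainder of [phi], at most [10 * h ^ 2]. The quadratic bound adds the second-order term to the
    first-order remainder, at most [(9 + 9 / 2) * h ^ 2]. Both constants are below 20. *)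
Lemma Phi_taylor y h : `|Phi (y + h) - Phi y - phi y * h + 2^-1 * (y * phi y) * h ^+ 2|
  <= 20 * Num.min (h ^+ 2) (`|h| ^+ 3).
Proof.
have b1 z : `|- (z * phi z)| <= 9.
  by rewrite normrN normrM (ger0_norm (phi_ge0 z)) -[`|z|]expr1 phi_pow.
have b2 z : `|(z ^+ 2 - 1) * phi z| <= 10.
  rewrite normrM (ger0_norm (phi_ge0 z)).
  apply: (@le_trans _ _ ((`|z| ^+ 2 + 1) * phi z)).
    rewrite ler_wpM2r ?phi_ge0// (le_trans (ler_normB _ _))//.
    by rewrite normr1 normrX.
  by rewrite mulrDl mul1r (_ : 10 = 9 + 1)%R ?lerD ?phi_pow ?phi_le1//; ring.
have t1 : `|Phi (y + h) - Phi y - phi y * h| <= 9 * h ^+ 2.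
  have := @taylor1 R Phi phi (fun z => - (z * phi z)) 9 y (y + h).
  rewrite [y + h]addrC addrK; apply=> z _ //; first exact: is_derive_Phi.
  exact: is_derive_phi.
rewrite -ler_pdivrMl// le_min; apply/andP; split.
  rewrite ler_pdivrMl//; apply: le_trans (ler_normD _ _) _.
  have := b1 y; rewrite normrN => b1y.
  rewrite normrM (ger0_norm (sqr_ge0 h)) normrM (@ger0_norm _ 2^-1)//.
  have : `|y * phi y| * h ^+ 2 <= 9 * h ^+ 2 by rewrite ler_wpM2r// sqr_ge0.
  have h2 := sqr_ge0 h; lra.
rewrite ler_pdivrMl//.
pose g k := Phi (y + k) - Phi y - phi y * k + 2^-1 * (y * phi y) * k ^+ 2.
pose g1 k := phi (y + k) - phi y - - (y * phi y) * k.
have dg z : is_derive z 1 g (g1 z).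
  have h1 := is_derive_Phi (y + z).
  have h2 : is_derive z 1 (fun k : R => y + k) 1.
    by have := is_deriveD (is_derive_cst y z 1) (is_derive_id z 1); rewrite add0r.
  have h3 := is_derive1_comp h1 h2.
  have -> : g = (fun k => (Phi \o (fun k : R => y + k)) k - Phi y - phi y * k +
       2^-1 * (y * phi y) * k ^+ 2) by [].
  by apply: is_derive_eq; rewrite /g1 /GRing.scale/=; field.
have g1b k : between 0 h k -> `|g1 k| <= 10 * h ^+ 2.
  move=> kb; apply: (@le_trans _ _ (10 * k ^+ 2)).
    have := @taylor1 R phi (fun z => - (z * phi z)) (fun z => (z ^+ 2 - 1) * phi z)
      10 y (y + k).
    rewrite [y + k]addrC addrK [k + y]addrC; apply=> z _ //.
      exact: is_derive_phi.
    exact: is_derive_phi1.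
  rewrite ler_pM2l// -(real_normK (num_real k)) -(real_normK (num_real h)).
  by rewrite lerXn2r ?nnegrE//; have := between_dist kb; rewrite !subr0.
have := @lipschitz_mvt R g g1 (10 * h ^+ 2) 0 h (fun z _ => dg z) g1b.
rewrite subr0 {2}/g addr0 subrr mulr0 expr0n/= mulr0 addr0 subrr subr0 -/(g h) => H.
apply: (le_trans H).
rewrite -(real_normK (num_real h)) -mulrA -exprSr ler_wpM2r ?exprn_ge0//.
by rewrite ler_nat.
Qed.

Definition heat s z : R := Phi (z / Num.sqrt s).
Definition heat_z s z : R := phi (z / Num.sqrt s) / Num.sqrt s.
Definition heat_zz s z : R := - (z / Num.sqrt s * phi (z / Num.sqrt s)) / s.

(** Rescaling by [Num.sqrt s] with [s >= a] multiplies the two branches of the minimum by at most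
    a^(-1) and a^(-3/2); the fourth power dominates both. *)
Definition heatC a : R := 40 * (1 + (Num.sqrt a)^-1) ^+ 4.

Lemma heat_space s a z h : 0 < a -> a <= s ->
  `|heat s (z + h) - heat s z - heat_z s z * h - 2^-1 * heat_zz s z * h ^+ 2|
  <= heatC a * Num.min (h ^+ 2) (`|h| ^+ 3).
Proof.
move=> a0 as_; have s0 : 0 < s := lt_le_trans a0 as_.
have r0 : 0 < Num.sqrt s by rewrite sqrtr_gt0.
have ra0 : 0 < Num.sqrt a by rewrite sqrtr_gt0.
have sE : s = Num.sqrt s ^+ 2 by rewrite sqr_sqrtr// ltW.
have := Phi_taylor (z / Num.sqrt s) (h / Num.sqrt s).
rewrite -mulrDl /heat /heat_z /heat_zz => H.
set q := Num.sqrt s in H r0 sE *; set y := z / q in H *.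
rewrite (_ : _ - _ - 2^-1 * _ * _ = Phi ((z + h) / q) - Phi y - phi y * (h / q) +
  2^-1 * (y * phi y) * (h / q) ^+ 2); last by rewrite sE; field; rewrite gt_eqF.
apply: (le_trans H).
have qa : q^-1 <= (Num.sqrt a)^-1 by rewrite lef_pV2 ?posrE// ler_wsqrtr.
set A := (Num.sqrt a)^-1 in qa *; have A0 : 0 < A by rewrite invr_gt0.
have q0 : 0 < q^-1 by rewrite invr_gt0.
rewrite /heatC -/A.
have [h1 h2] : (h / q) ^+ 2 <= (1 + A) ^+ 4 * h ^+ 2 /\
    `|h / q| ^+ 3 <= (1 + A) ^+ 4 * `|h| ^+ 3.
  split.
    rewrite exprMn mulrC ler_wpM2r ?sqr_ge0//.
    apply: (@le_trans _ _ ((1 + A) ^+ 2)); first by rewrite lerXn2r ?nnegrE; lra.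
    by rewrite ler_weXn2l//; lra.
  rewrite normrM exprMn mulrC ler_wpM2r ?exprn_ge0// (gtr0_norm q0).
  apply: (@le_trans _ _ ((1 + A) ^+ 3)); first by rewrite lerXn2r ?nnegrE; lra.
  by rewrite ler_weXn2l//; lra.
have mm : Num.min ((h / q) ^+ 2) (`|h / q| ^+ 3) <=
    (1 + A) ^+ 4 * Num.min (h ^+ 2) (`|h| ^+ 3).
  have A4 : 0 <= (1 + A) ^+ 4 by rewrite exprn_ge0//; lra.
  rewrite (minr_pMr _ _ A4); rewrite le_min !ge_min h1 h2 orbT/=.
  by [].
apply: (le_trans (ler_wpM2l _ mm)) => //; rewrite mulrA ler_wpM2r//.
  by rewrite le_min sqr_ge0 exprn_ge0.
rewrite ler_wpM2r ?exprn_ge0//; lra.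
Qed.

Lemma heat_zz_bound s a z : 0 < a -> a <= s -> `|heat_zz s z| <= 9 / a.
Proof.
move=> a0 as_; have s0 : 0 < s := lt_le_trans a0 as_.
rewrite /heat_zz normrM normrN ger0_norm ?invr_ge0 ?(ltW s0)//.
rewrite ler_pM ?invr_ge0 ?(ltW s0)//; last by rewrite lef_pV2 ?posrE.
by rewrite normrM (ger0_norm (phi_ge0 _)) -[X in X * _]expr1 phi_pow.
Qed.

Lemma heat_z_bound s a z : 0 < a -> a <= s -> `|heat_z s z| <= (Num.sqrt a)^-1.
Proof.
move=> a0 as_; have s0 : 0 < s := lt_le_trans a0 as_.
rewrite /heat_z normrM (ger0_norm (phi_ge0 _)) -[leRHS]mul1r.
rewrite ler_pM ?phi_ge0 ?phi_le1// ger0_norm ?invr_ge0 ?sqrtr_ge0//.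
by rewrite lef_pV2 ?posrE ?sqrtr_gt0// ler_wsqrtr.
Qed.

Lemma heat_bound s z : `|heat s z| <= 1.
Proof. by rewrite ger0_norm ?Phi_ge0// Phi_le1. Qed.

Lemma is_derive_scale (f : R -> R) f1 z s : 0 < s ->
  (forall y, is_derive y 1 f (f1 y)) ->
  is_derive s 1 (fun s => f (z / Num.sqrt s))
    (f1 (z / Num.sqrt s) * - (z / Num.sqrt s / (2 * s))).
Proof.
move=> s0 df; have r0 : 0 < Num.sqrt s by rewrite sqrtr_gt0.
have h1 := is_derive1_sqrt s0.
have h2 : is_derive s 1 (fun s : R => z / Num.sqrt s) (- (z / Num.sqrt s / (2 * s))).
  have h3 := is_deriveV (lt0r_neq0 r0) h1.
  apply: is_derive_eq; rewrite /GRing.scale/=.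
  have sE : s = Num.sqrt s ^+ 2 by rewrite sqr_sqrtr// ltW.
  set q := Num.sqrt s in r0 sE *; rewrite sE.
  by rewrite -exprVn; field; rewrite gt_eqF.
exact: is_derive1_comp (df _) h2.
Qed.

(** The heat equation: the time derivative is half the second space derivative. It lets the
    conditional variance of a step cancel the second-order term in space. *)
Lemma is_derive_heat s z : 0 < s ->
  is_derive s 1 (fun s => heat s z) (2^-1 * heat_zz s z).
Proof.
move=> s0; have h := is_derive_scale z s0 is_derive_Phi.
apply: (is_derive_eq h); rewrite /heat_zz.
by field; rewrite !gt_eqF// sqrtr_gt0.
Qed.

Definition heat_tt s z : R :=
  let y := z / Num.sqrt s in (y * phi y / 2 - (y ^+ 2 - 1) * phi y * y / 4) / s ^+ 2.

Lemma is_derive_heat_zz s z : 0 < s ->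
  is_derive s 1 (fun s => 2^-1 * heat_zz s z) (heat_tt s z).
Proof.
move=> s0; have h := is_derive_scale z s0 is_derive_phi1.
have hV := is_deriveV (lt0r_neq0 s0) (is_derive_id s 1).
rewrite /heat_zz /heat_tt.
apply: is_derive_eq; rewrite /GRing.scale/= -exprVn.
by field; rewrite !gt_eqF// sqrtr_gt0.
Qed.

Lemma heat_tt_bound s a z : 0 < a -> a <= s -> `|heat_tt s z| <= 9 / a ^+ 2.
Proof.
move=> a0 as_; have s0 : 0 < s := lt_le_trans a0 as_.
rewrite /heat_tt normrM; set y := z / _.
have y1 : `|y * phi y| <= 9.
  by rewrite normrM (ger0_norm (phi_ge0 _)) -[X in X * _]expr1 phi_pow.
have y3 : `|y ^+ 3 * phi y| <= 9.
  by rewrite normrM (ger0_norm (phi_ge0 _)) normrX phi_pow.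
apply: ler_pM => //.
  (* The weights 3/4 and 1/4 add up to 1, so the common bound 9 is kept. *)
  rewrite (_ : _ - _ = 3 / 4 * (y * phi y) - 4^-1 * (y ^+ 3 * phi y)); last by field.
  by move: y1 y3; rewrite !ler_norml => /andP[? ?] /andP[? ?]; apply/andP; split; lra.
by rewrite ger0_norm ?invr_ge0 ?sqr_ge0// lef_pV2 ?posrE ?exprn_gt0// lerXn2r ?nnegrE// ltW.
Qed.

(** The linear branch keeps the error integrable for large steps in time, the quadratic one makes it
    negligible for small steps. *)
Lemma heat_time s a z q : 0 < a -> a <= s -> a <= q ->
  `|heat q z - heat s z - 2^-1 * heat_zz s z * (q - s)| <=
  (9 / a + 9 / a ^+ 2) * Num.min `|q - s| ((q - s) ^+ 2).
Proof.
move=> a0 as_ aq.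
have ab t : between s q t -> a <= t.
  by move=> /betweenP/andP[+ _]; apply: le_trans; rewrite le_min as_ aq.
have t0 t : between s q t -> 0 < t by move=> /ab; exact: lt_le_trans.
have h2 : `|heat q z - heat s z - 2^-1 * heat_zz s z * (q - s)| <=
    9 / a ^+ 2 * (q - s) ^+ 2.
  apply: (@taylor1 R (fun s => heat s z) (fun s => 2^-1 * heat_zz s z)
    (fun s => heat_tt s z)) => t tb.
  - exact/is_derive_heat/t0.
  - exact/is_derive_heat_zz/t0.
  - exact/heat_tt_bound/ab.
have b t : between s q t -> `|2^-1 * heat_zz t z| <= 9 / a / 2.
  move=> tb; rewrite normrM (@ger0_norm _ 2^-1)// mulrC ler_wpM2r//.
  exact/heat_zz_bound/ab.
have h1 : `|heat q z - heat s z - 2^-1 * heat_zz s z * (q - s)| <= 9 / a * `|q - s|.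
  apply: le_trans (ler_normB _ _) _.
  have l : `|heat q z - heat s z| <= 9 / a / 2 * `|q - s|.
    apply: (@lipschitz_mvt R (fun s => heat s z) (fun s => 2^-1 * heat_zz s z)) => t tb.
      exact/is_derive_heat/t0.
    exact: b.
  have l2 : `|2^-1 * heat_zz s z * (q - s)| <= 9 / a / 2 * `|q - s|.
    by rewrite normrM ler_wpM2r// b// betweenl.
  by rewrite [9 / a]splitr mulrDl lerD.
have p1 : 0 <= 9 / a by rewrite divr_ge0// ltW.
have p2 : 0 <= 9 / a ^+ 2 by rewrite divr_ge0// exprn_ge0// ltW.
have [_|_] := leP `|q - s| ((q - s) ^+ 2).
  by apply: le_trans h1 _; rewrite ler_wpM2r// lerDl.
by apply: le_trans h2 _; rewrite ler_wpM2r ?sqr_ge0// lerDr.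
Qed.

Lemma heat_lip s a z q : 0 < a -> a <= s -> a <= q ->
  `|heat q z - heat s z| <= 9 / a * `|q - s|.
Proof.
move=> a0 as_ aq.
have ab t : between s q t -> a <= t.
  by move=> /betweenP/andP[+ _]; apply: le_trans; rewrite le_min as_ aq.
apply: (@lipschitz_mvt R (fun s => heat s z) (fun s => 2^-1 * heat_zz s z)) => t tb.
  by apply: is_derive_heat; exact: lt_le_trans (ab _ tb).
rewrite normrM (@ger0_norm _ 2^-1)//; have := heat_zz_bound z a0 (ab _ tb).
have := normr_ge0 (heat_zz t z); lra.
Qed.

End normal_cdf.

(** * Martingale central limit theorem *)

Section martingale_clt.
Context {d : measure_display} {T : measurableType d} {R : realType}.
Variable P : probability T R.
Local Notation integ f := (P.-integrable setT (EFin \o f)).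
Local Notation Ex f := (Rintegral P setT f).

(** The size of the Taylor remainder in space. The square makes it integrable under second moments
    alone, the cube makes it small for small increments. *)
Definition lyap (z : R) : R := Num.min (z ^+ 2) (`|z| ^+ 3).

Lemma lyap_ge0 z : 0 <= lyap z.
Proof. by rewrite le_min sqr_ge0 exprn_ge0. Qed.

Lemma lyap_le z : lyap z <= z ^+ 2.
Proof. by rewrite ge_min lexx. Qed.

Lemma measurable_lyap : measurable_fun setT lyap.
Proof.
apply: measurable_minr; first exact: exprn_measurable.
exact: (measurable_funX 3 (@normr_measurable R setT)).
Qed.

Variables (G : nat -> set (set T)) (xi q : nat -> T -> R).
Hypothesis sG : forall k, subsig (G k).
Hypothesis Gle : forall k, G k `<=` G k.+1.
Hypothesis gxi : forall k, gmeas (G k.+1) (xi k).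
Hypothesis gq : forall k, gmeas (G k) (q k).
Hypothesis q_ge0 : forall k x, 0 <= q k x.
Hypothesis qi : forall k, integ (q k).
Hypothesis xi2 : forall k, integ (fun x => xi k x ^+ 2).
Hypothesis oxi : forall k, orth P (G k) (xi k).
Hypothesis oq : forall k, orth P (G k) (fun x => xi k x ^+ 2 - q k x).

Let M k x := \sum_(j < k) xi j x.
Let V k x := \sum_(j < k) q j x.

Variables (a v : R).
Hypotheses (a_gt0 : 0 < a) (v_ge0 : 0 <= v).

(* [alive k] is known at time [k], so that stopping at the first [k] where it fails
   keeps the martingale property. *)
Let alive k x : R := \1_[set x | V k.+1 x <= v + a] x.
Let xi' k x := alive k x * xi k x.
Let q' k x := alive k x * q k x.
Let M' k x := \sum_(j < k) xi' j x.
Let V' k x := \sum_(j < k) q' j x.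

Let Gle' k l : (k <= l)%N -> G k `<=` G l.
Proof.
move=> /subnKC <-; elim: (l - k)%N => [|i IH]; first by rewrite addn0.
by rewrite addnS; exact: (subset_trans IH (@Gle _)).
Qed.

Let gV k : gmeas (G k) (V k.+1).
Proof.
apply: gmeas_sum => // i _; apply: gmeas_sub (gq i); apply: Gle'.
by rewrite -ltnS.
Qed.

Let galive k : gmeas (G k) (alive k).
Proof. by apply: gmeas_indic => //; exact: gmeas_le_set. Qed.

Let alive01 k x : 0 <= alive k x <= 1.
Proof. by rewrite /alive indicE ler0n lern1 leq_b1. Qed.

Let gxi' k : gmeas (G k.+1) (xi' k).
Proof. by apply: gmeasM => //; exact: gmeas_sub (@Gle k) (galive k). Qed.

Let gq' k : gmeas (G k) (q' k).
Proof. exact: gmeasM. Qed.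

Let gM' k : gmeas (G k) (M' k).
Proof.
apply: gmeas_sum => // i _; apply: gmeas_sub (gxi' i); exact: Gle'.
Qed.

Let gV' k : gmeas (G k) (V' k.+1).
Proof.
apply: gmeas_sum => // i _; apply: gmeas_sub (gq' i); apply: Gle'.
by rewrite -ltnS.
Qed.

Let q'0 k x : 0 <= q' k x.
Proof. by rewrite mulr_ge0//; case/andP: (alive01 k x). Qed.

(** As long as the unstopped sum is below the level it dominates the stopped one; at a step where it
    exceeds the level, [alive] is 0 and nothing is added. *)
Let V'_le k x : V' k x <= v + a.
Proof.
elim: k => [|k IH]; first by rewrite /V' big_ord0 addr_ge0// ltW.
have [h|h] := leP (V k.+1 x) (v + a).
  apply: le_trans h; apply: ler_sum => i _.
  by rewrite -[leRHS]mul1r ler_wpM2r//; case/andP: (alive01 i x).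
rewrite /V' big_ord_recr/= -/(V' k x) /q' /alive indicE memNset ?mul0r ?addr0//=.
by apply/negP; rewrite -ltNge.
Qed.

Let aliveP n x : V n x <= v + a -> forall k, (k < n)%N -> alive k x = 1.
Proof.
move=> h k kn; rewrite /alive indicE mem_set//=; apply: le_trans h.
rewrite /V (big_ord_widen _ (fun j => q j x) kn) [leRHS](bigID (fun i : 'I_n => (i < k.+1)%N))/=.
by rewrite lerDl sumr_ge0.
Qed.

Variable t : R.
(** The stopped variance may exceed [v] by [a]. Starting with [a + a] in reserve leaves at least [a]
    of time at every step, where the derivatives of [heat] are bounded. *)
Let c := a + a.
Let s k x := c + v - V' k x.
Let W k x := heat (s k x) (t - M' k x).

Let s_ge k x : a <= s k x.
Proof. by have := V'_le k x; rewrite /s /c; lra. Qed.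

Let measurable_sqrt : measurable_fun setT (@Num.sqrt R).
Proof. by apply: continuous_measurable_fun; exact: sqrt_continuous. Qed.

Let measurable_heat (f : R -> R) (u w : T -> R) k : measurable_fun setT f ->
  gmeas (G k) u -> gmeas (G k) w -> gmeas (G k) (fun x => f (w x / Num.sqrt (u x))).
Proof.
move=> mf gu gw; apply: (gmeas_comp mf); apply: gmeasM => //; apply: gmeasV => //.
exact: (gmeas_comp measurable_sqrt).
Qed.

Let measurable_phi : measurable_fun setT (@phi R).
Proof. exact: measurable_normal_pdf. Qed.

Let measurable_Phi : measurable_fun setT (@Phi R).
Proof.
apply: continuous_measurable_fun => x.
by have [/derivable1_diffP/differentiable_continuous] := is_derive_Phi x.
Qed.

Let gs k : gmeas (G k) (s k.+1).
Proof. by apply: gmeasB => //; exact: gmeas_cst. Qed.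

Let gz k : gmeas (G k) (fun x => t - M' k x).
Proof. by apply: gmeasB => //; exact: gmeas_cst. Qed.

Let mW k : measurable_fun setT (W k).
Proof.
apply: (gmeas_meas (sG k)); apply: measurable_heat => //.
case: k => [|k]; last by apply: gmeas_sub (@Gle k) (gs k).
apply: (gmeas_ext (f := fun=> c + v)); last exact: gmeas_cst.
by move=> x; rewrite /s /V' big_ord0 subr0.
Qed.

Let iW k : integ (W k).
Proof. by apply: (@integ_bnd _ _ _ _ _ 1) => // x; exact: heat_bound. Qed.

Let il k : integ (fun x => lyap (xi k x)).
Proof.
apply: integ_le (xi2 k) _; last by move=> x; rewrite ger0_norm ?lyap_ge0 ?lyap_le.
apply: (measurableT_comp measurable_lyap); exact: gmeas_meas (gxi k).
Qed.

Let iq' k : integ (q' k).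
Proof.
apply: integ_le (qi k) _; first exact: gmeas_meas (gq' k).
move=> x; rewrite ger0_norm// -[leRHS]mul1r ler_wpM2r//; by case/andP: (alive01 k x).
Qed.

Let m' k x := q' k x * Num.min 1 (q' k x).

(** The error of a time step is [q] times a predictable weight, so [q] may be replaced by [xi ^ 2]
    under the expectation. Where [|xi| <= e] the product is at most [e ^ 2 * q']; where [|xi| > e]
    the square is at most [lyap xi / e]. *)
Let m'_bound k e : 0 < e -> e <= 1 ->
  integ (m' k) /\
  Ex (m' k) <= e^-1 * Ex (fun x => lyap (xi k x)) + e ^+ 2 * Ex (q' k).
Proof.
move=> e0 e1.
pose w x := alive k x * Num.min 1 (q' k x).
have gw : gmeas (G k) w.
  by apply: gmeasM => //; apply: gmeas_min => //; exact: gmeas_cst.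
have w01 x : 0 <= w x <= 1.
  have /andP[h1 h2] := alive01 k x.
  have n0 : 0 <= Num.min 1 (q' k x) by rewrite le_min ler01 q'0.
  have n1 : Num.min 1 (q' k x) <= 1 by rewrite ge_min lexx.
  by rewrite /w mulr_ge0//= -[leRHS]mul1r ler_pM.
have wb x : `|w x| <= 1 by have /andP[? ?] := w01 x; rewrite ger0_norm.
have mw := gmeas_meas (sG k) gw.
have i1 : integ (fun x => q k x * w x) by exact: integM_bnd (qi k) mw wb.
have i2 : integ (fun x => xi k x ^+ 2 * w x) by exact: integM_bnd (xi2 k) mw wb.
have mE : m' k =1 fun x => q k x * w x.
  by move=> x; rewrite /m' /w /q'; ring.
split; first by apply: integ_ext i1 => x; rewrite mE.
have e2 : Ex (fun x => q k x * w x) = Ex (fun x => xi k x ^+ 2 * w x).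
  apply/esym/eqP; rewrite -subr_eq0 -ExB//.
  rewrite (@Ex_ext _ _ _ _ _ (fun x => (xi k x ^+ 2 - q k x) * w x)); last first.
    by move=> x; rewrite mulrBl.
  apply/eqP/(orthE (sG k) (oq k) gw).
  by apply: integ_ext (integB i2 i1) => x; rewrite mulrBl.
rewrite (Ex_ext _ mE) e2 -!ExZ// -ExD; [|exact: integZ|exact: integZ].
apply: Ex_le => //; first by apply: integD; exact: integZ.
move=> x; have /andP[al0 al1] := alive01 k x; have /andP[w0 w1] := w01 x.
have [h|h] := leP `|xi k x| e.
  apply: (@le_trans _ _ (e ^+ 2 * q' k x)); last first.
    by rewrite lerDr mulr_ge0 ?invr_ge0 ?lyap_ge0// ltW.
  apply: ler_pM => //; first exact: sqr_ge0.
    by rewrite -(real_normK (num_real (xi k x))) lerXn2r ?nnegrE// ltW.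
  rewrite /w; apply: (@le_trans _ _ (1 * q' k x)); last by rewrite mul1r.
  have n0 : 0 <= Num.min 1 (q' k x) by rewrite le_min ler01 q'0.
  by rewrite ler_pM// ge_min lexx orbT.
apply: (@le_trans _ _ (e^-1 * lyap (xi k x))); last first.
  by rewrite lerDl mulr_ge0 ?sqr_ge0.
apply: (@le_trans _ _ (xi k x ^+ 2)).
  by rewrite -[leRHS]mulr1 ler_wpM2l ?sqr_ge0.
rewrite ler_pdivlMl// /lyap le_min; apply/andP; split.
  by rewrite ler_piMl ?sqr_ge0.
by rewrite -(real_normK (num_real (xi k x))) exprS ler_wpM2r ?exprn_ge0// ltW.
Qed.

Let D : R := 9 / a + 9 / a ^+ 2.

(** One Lindeberg step: move in space at the fixed time [s k.+1], then in time at the fixed point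
    [z]. Only the two Taylor remainders survive in expectation. *)
Let step k e : 0 < e -> e <= 1 ->
  `|Ex (W k.+1) - Ex (W k)| <=
  (heatC a + D / e) * Ex (fun x => lyap (xi k x)) + D * e ^+ 2 * Ex (q' k).
Proof.
move=> e0 e1.
have D0 : 0 <= D by rewrite addr_ge0// divr_ge0 ?exprn_ge0// ltW.
have C0 : 0 <= heatC a.
  by rewrite mulr_ge0 ?exprn_ge0// addr_ge0 ?invr_ge0 ?sqrtr_ge0.
have [im' bm'] := m'_bound k e0 e1.
pose z x := t - M' k x.
(* The derivatives are taken at time [s k.+1], already known at stage [k] because [q] is
   predictable; so [u1] and [u2] are legitimate test functions for [xi] and [xi ^ 2 - q]. *)
pose u1 x := alive k x * heat_z (s k.+1 x) (z x).
pose u2 x := alive k x * (2^-1 * heat_zz (s k.+1 x) (z x)).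
have gsq : gmeas (G k) (fun x => Num.sqrt (s k.+1 x)).
  exact: (gmeas_comp measurable_sqrt).
have gy : gmeas (G k) (fun x => z x / Num.sqrt (s k.+1 x)).
  by apply: gmeasM => //; exact: gmeasV.
have gph : gmeas (G k) (fun x => phi (z x / Num.sqrt (s k.+1 x))).
  exact: (gmeas_comp measurable_phi).
have gu1 : gmeas (G k) u1.
  by apply: gmeasM => //; apply: gmeasM => //; exact: gmeasV.
have gu2 : gmeas (G k) u2.
  apply: gmeasM => //; apply: gmeasM => //; first exact: gmeas_cst.
  by apply: gmeasM => //; [apply: gmeasN => //; exact: gmeasM|exact: gmeasV].
have alb x : `|alive k x| <= 1.
  by have /andP[? ?] := alive01 k x; rewrite ger0_norm.
have b1 x : `|u1 x| <= (Num.sqrt a)^-1.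
  by rewrite normrM -[leRHS]mul1r ler_pM// heat_z_bound.
have b2 x : `|u2 x| <= 9 / a.
  rewrite normrM -[leRHS]mul1r ler_pM// normrM -[leRHS]mul1r ler_pM//.
    by rewrite ger0_norm// invf_le1// ler1n.
  exact: heat_zz_bound.
have mu1 := gmeas_meas (sG k) gu1; have mu2 := gmeas_meas (sG k) gu2.
have i1 : integ (fun x => xi k x * u1 x) by apply: integM_bnd b1 => //; exact: (oxi k).1.
have i2 : integ (fun x => (xi k x ^+ 2 - q k x) * u2 x).
  by apply: integM_bnd b2 => //; exact: (oq k).1.
have z1 := orthE (sG k) (oxi k) gu1 i1; have z2 := orthE (sG k) (oq k) gu2 i2.
pose E x := W k.+1 x - W k x + xi k x * u1 x - (xi k x ^+ 2 - q k x) * u2 x.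
have iE : integ E by apply: integB => //; apply: integD => //; apply: integB.
have EE : Ex E = Ex (W k.+1) - Ex (W k).
  rewrite ExB//; last by apply: integD => //; exact: integB.
  by rewrite ExD//; [rewrite ExB// z1 z2 addr0 subr0|exact: integB].
rewrite -EE; apply: (@le_trans _ _ (Ex (fun x => heatC a * lyap (xi k x) + D * m' k x))).
  apply: Ex_norm_le => //; first by apply: integD; exact: integZ.
  move=> x.
  have sE : s k.+1 x = s k x - q' k x.
    by rewrite /s /V' big_ord_recr/= opprD addrA.
  have zE : t - M' k.+1 x = z x + - xi' k x.
    by rewrite /z /M' big_ord_recr/= opprD addrA.
  have h1 := heat_space (z x) (- xi' k x) a_gt0 (s_ge k.+1 x).
  have h2 := heat_time (z x) a_gt0 (s_ge k.+1 x) (s_ge k x).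
  have dE : s k x - s k.+1 x = q' k x by rewrite sE; ring.
  rewrite dE in h2.
  have al2 : alive k x ^+ 2 = alive k x.
    by rewrite /alive indicE; case: (_ \in _); rewrite ?expr1n// expr0n.
  (* By the heat equation the same coefficient [2^-1 * heat_zz] multiplies [xi' ^ 2] in space and
     [q'] in time, which leaves exactly the compensated term with [u2]. *)
  rewrite (_ : E x = (heat (s k.+1 x) (z x + - xi' k x) - heat (s k.+1 x) (z x) -
      heat_z (s k.+1 x) (z x) * - xi' k x -
      2^-1 * heat_zz (s k.+1 x) (z x) * (- xi' k x) ^+ 2) -
      (heat (s k x) (z x) - heat (s k.+1 x) (z x) -
      2^-1 * heat_zz (s k.+1 x) (z x) * q' k x)); last first.
    rewrite /E /W zE -/(z x) /u1 /u2 /q' sqrrN {1 2 3}/xi' exprMn al2; ring.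
  apply: (le_trans (ler_normB _ _)); apply: lerD.
    apply: (le_trans h1); rewrite ler_wpM2l// sqrrN normrN /xi' /lyap.
    have xa : `|alive k x * xi k x| <= `|xi k x|.
      by rewrite normrM -[leRHS]mul1r ler_wpM2r.
    rewrite le_min !ge_min; apply/andP; split.
      by rewrite -(real_normK (num_real (_ * _))) -[X in _ <= X](real_normK (num_real _)) lerXn2r ?nnegrE// .
    by rewrite [X in _ || X](_ : _ = true) ?orbT// lerXn2r ?nnegrE.
  apply: (le_trans h2); rewrite ler_wpM2l// /m' (ger0_norm (q'0 k x)).
  by rewrite minr_pMr// mulr1 expr2.
rewrite ExD; [|exact: integZ|exact: integZ].
rewrite !ExZ//; apply: (le_trans (lerD (lexx _) (ler_wpM2l D0 bm'))).
rewrite le_eqVlt; apply/orP; left; apply/eqP; ring.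
Qed.

Let Ex_V' n : \sum_(k < n) Ex (q' k) <= v + a.
Proof.
rewrite -Ex_sum// -[leRHS](Ex_cst P); apply: Ex_le; last exact: V'_le.
  exact: integ_sum.
exact: integ_cst.
Qed.

Lemma martingale_clt_bound n e : 0 < e -> e <= 1 -> e <= a ->
  `|Ex (fun x => Phi ((t - M n x) / Num.sqrt c)) - Phi (t / Num.sqrt (c + v))| <=
  (heatC a + D / e) * \sum_(k < n) Ex (fun x => lyap (xi k x)) +
  D * e ^+ 2 * (v + a) + 9 / a * e + fine (P [set x | e < `|V n x - v| ]).
Proof.
move=> e0 e1 ea.
have D0 : 0 <= D by rewrite addr_ge0// divr_ge0 ?exprn_ge0// ltW.
have W0 : Ex (W 0) = Phi (t / Num.sqrt (c + v)).
  rewrite -[RHS](Ex_cst P); apply: Ex_ext => x.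
  by rewrite /W /s /heat /M' /V' !big_ord0 !subr0.
have tele m : `|Ex (W m) - Ex (W 0)| <=
    (heatC a + D / e) * \sum_(k < m) Ex (fun x => lyap (xi k x)) +
    D * e ^+ 2 * \sum_(k < m) Ex (q' k).
  elim: m => [|m IH]; first by rewrite !big_ord0 !mulr0 addr0 subrr normr0.
  rewrite !big_ord_recr/= !mulrDr addrACA.
  apply: le_trans (lerD IH (step m e0 e1)).
  by rewrite [leRHS]addrC; exact: ler_distD.
set B := [set x | e < `|V n x - v| ].
have mV : measurable_fun setT (V n).
  by apply: measurable_sum => i; exact: gmeas_meas (sG i) (gq i).
have mB : measurable B.
  rewrite (_ : B = (fun x => `|V n x - v|) @^-1` `]e, +oo[%classic); last first.
    by apply/seteqP; split=> x; rewrite /= in_itv/= andbT.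
  rewrite -[X in measurable X]setTI.
  suff mf : measurable_fun setT (fun x => `|V n x - v|) by exact: mf.
  apply: (measurableT_comp (@normr_measurable R setT)).
  exact: measurable_funB.
have mM : measurable_fun setT (M n).
  by apply: measurable_sum => i; exact: gmeas_meas (sG i.+1) (gxi i).
have iPhi : integ (fun x => Phi ((t - M n x) / Num.sqrt c)).
  apply: (@integ_bnd _ _ _ _ _ 1); last by move=> x; exact: (heat_bound c).
  apply: (measurableT_comp measurable_Phi (g := fun x => (t - M n x) / Num.sqrt c)).
  apply: measurable_funM => //.
  exact: measurable_funB.
(* Off [B] the sum [V n] is at most [v + e <= v + a], so nothing was stopped, and the remaining time
   differs from [c] by at most [e]. On [B] the trivial bound 1 is used. *)
have last_ : `|Ex (fun x => Phi ((t - M n x) / Num.sqrt c)) - Ex (W n)| <=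
    9 / a * e + fine (P B).
  have iB : integ (\1_B : T -> R).
    by apply: integ_bnd (norm_indic _); exact: measurable_indic.
  rewrite -ExB// -(Ex_indic P mB) -[9 / a * e](Ex_cst P) -ExD//; last exact: integ_cst.
  apply: Ex_norm_le; first exact: integB.
    by apply: integD => //; exact: integ_cst.
  move=> x; rewrite indicE; have [h|h] := ltP e `|V n x - v|.
    rewrite mem_set//= (@le_trans _ _ 1)//.
      rewrite ler_norml; apply/andP.
      have := @Phi_ge0 R ((t - M n x) / Num.sqrt c).
      have := @Phi_le1 R ((t - M n x) / Num.sqrt c).
      have := @Phi_ge0 R ((t - M' n x) / Num.sqrt (s n x)).
      have := @Phi_le1 R ((t - M' n x) / Num.sqrt (s n x)).
      rewrite /W /heat; split; lra.
    by rewrite lerDr mulr_ge0 ?divr_ge0// ltW.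
  rewrite memNset ?addr0/=; last by apply/negP; rewrite -leNgt.
  have hV : V n x <= v + a by move: h; rewrite ler_norml => /andP[_]; lra.
  have MM : M' n x = M n x.
    by apply: eq_bigr => i _; rewrite /xi' (aliveP hV) ?mul1r.
  have VV : V' n x = V n x.
    by apply: eq_bigr => i _; rewrite /q' (aliveP hV) ?mul1r.
  rewrite /W MM /s VV -/(heat c (t - M n x)).
  have ac : a <= c by rewrite /c; lra.
  have asn : a <= c + v - V n x by rewrite -VV; exact: s_ge.
  have := heat_lip (t - M n x) a_gt0 asn ac; move=> /le_trans; apply.
  rewrite ler_wpM2l ?divr_ge0 ?(ltW a_gt0)//.
  by have -> : c - (c + v - V n x) = V n x - v by ring.
rewrite -W0.
set H := Ex (fun x => Phi _) in last_ *.
apply: (le_trans (ler_distD (Ex (W n)) _ _)).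
rewrite addrC -addrA; apply: lerD => //; apply: (le_trans (tele n)).
by rewrite lerD2l ler_wpM2l// mulr_ge0// sqr_ge0.
Qed.

End martingale_clt.

(** * Limits of Gaussian distribution functions, point mass included *)

Section normal_limit.
Context {R : realType}.
Implicit Types (u : nat -> R) (l t v : R).

Lemma Phi_cvg u l : u n @[n --> \oo] --> l -> Phi (u n) @[n --> \oo] --> Phi l.
Proof.
move=> ul; have c : Phi x @[x --> l] --> Phi l.
  by have [/derivable1_diffP/differentiable_continuous] := is_derive_Phi l.
exact: (cvg_comp u Phi ul c).
Qed.

Lemma Phi_cvg1 u : u n @[n --> \oo] --> +oo -> Phi (u n) @[n --> \oo] --> (1 : R).
Proof. by move=> uy; exact: (cvg_comp u Phi uy (@Phi_cvgy R)). Qed.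

Lemma Phi_cvg0 u : u n @[n --> \oo] --> -oo -> Phi (u n) @[n --> \oo] --> (0 : R).
Proof. by move=> uy; exact: (cvg_comp u Phi uy (@Phi_cvgNy R)). Qed.

Definition normal_cdf v t : R :=
  if v == 0 then (0 <= t)%R%:R else Phi (t / Num.sqrt v).

Lemma centered_normal_cdf v t : 0 <= v ->
  centered_normal v `]-oo, t]%classic = (normal_cdf v t)%:E.
Proof.
move=> v0; rewrite /centered_normal /normal_cdf; case: eqP => [_|/eqP vn].
  by rewrite diracE mem_setE in_itv.
by rewrite normal_prob_scale// sqrtr_gt0 lt0r vn.
Qed.

(** The smoothing has standard deviation [n.+1%:R^-1 ^+ 2], of smaller order than the shift
    [n.+1%:R^-1]. If [v] is 0 the argument of [Phi] is [n.+1%:R * (t * n.+1%:R + sg)], which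
    diverges with the sign of [t]; this is where continuity points enter. *)
Lemma normal_smoothing v t (sg : R) : 0 <= v -> (v == 0 -> t != 0) -> `|sg| = 1 ->
  Phi ((t + sg * n.+1%:R^-1) / Num.sqrt (n.+1%:R^-1 ^+ 4 + v)) @[n --> \oo] -->
  normal_cdf v t.
Proof.
move=> v0 vt s1.
have harm : n.+1%:R^-1 @[n --> \oo] --> (0 : R) by exact: cvg_harmonic.
rewrite /normal_cdf; case: eqP => [v00|/eqP vn]; last first.
  have h4 : n.+1%:R^-1 ^+ 4 @[n --> \oo] --> (0 : R).
    have := @exprn_continuous R 4 0; rewrite /continuous_at expr0n => h4.
    exact: (cvg_comp _ _ harm h4).
  have h5 : n.+1%:R^-1 ^+ 4 + v @[n --> \oo] --> v.
    by rewrite -[X in _ --> X]add0r; apply: cvgD => //; exact: cvg_cst.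
  have h6 : Num.sqrt (n.+1%:R^-1 ^+ 4 + v) @[n --> \oo] --> Num.sqrt v.
    exact: (cvg_comp _ _ h5 (@sqrt_continuous R v)).
  have h7 : (Num.sqrt (n.+1%:R^-1 ^+ 4 + v))^-1 @[n --> \oo] --> (Num.sqrt v)^-1.
    by apply: cvgV => //; rewrite sqrtr_eq0 -ltNge lt0r vn.
  have h8 : t + sg * n.+1%:R^-1 @[n --> \oo] --> t.
    rewrite -[X in _ --> X]addr0 -(mulr0 sg).
    by apply: cvgD; [exact: cvg_cst|apply: cvgM => //; exact: cvg_cst].
  by apply: Phi_cvg; exact: cvgM.
have tn : t != 0 by apply: vt; apply/eqP.
rewrite v00.
have E n : (t + sg * n.+1%:R^-1) / Num.sqrt (n.+1%:R^-1 ^+ 4 + 0) =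
    n.+1%:R * (t * n.+1%:R + sg).
  rewrite addr0 (exprM _ 2 2) sqrtr_sqr ger0_norm ?exprn_ge0 ?invr_ge0//.
  by field; rewrite nat1r pnatr_eq0.
have [tp|tneg|t0] := ltgtP t 0; last by rewrite t0 eqxx in tn.
- apply: Phi_cvg0.
  apply/cvgrNyPle => B; near=> n; rewrite E.
  have n1 : `|B| + 1 <= n.+1%:R by rewrite -natr1 lerD2r; near: n; exact: nbhs_infty_ger.
  have n2 : 2 / - t <= n.+1%:R.
    by rewrite -[leRHS]natr1 ler_wpDr//; near: n; exact: nbhs_infty_ger.
  have B0 := ler_norm (- B); rewrite normrN in B0.
  have : t * n.+1%:R <= -2.
    by rewrite lerNr -mulNr mulrC -ler_pdivrMr// oppr_gt0.
  have := ler_norm sg; rewrite s1 => sg1 tn2.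
  have : n.+1%:R * (t * n.+1%:R + sg) <= n.+1%:R * (-1) by rewrite ler_wpM2l//; lra.
  have := normr_ge0 B; lra.
- apply: Phi_cvg1.
  apply/cvgryPge => B; near=> n; rewrite E.
  have n1 : `|B| + 1 <= n.+1%:R by rewrite -natr1 lerD2r; near: n; exact: nbhs_infty_ger.
  have n2 : 2 / t <= n.+1%:R.
    by rewrite -[leRHS]natr1 ler_wpDr//; near: n; exact: nbhs_infty_ger.
  have B0 := ler_norm B.
  have : 2 <= t * n.+1%:R by rewrite mulrC -ler_pdivrMr.
  have := ler_norm (- sg); rewrite normrN s1 => sg1 tn2.
  have : n.+1%:R * 1 <= n.+1%:R * (t * n.+1%:R + sg) by rewrite ler_wpM2l//; lra.
  have := normr_ge0 B; lra.
Unshelve. all: by end_near. Qed.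

End normal_limit.

Lemma squeeze_arith {R : realFieldType} (e H up dn eu ed F p1 p0 : R) :
  `|up - eu| <= e / 3 -> `|dn - ed| <= e / 3 -> `|H - up| <= e / 3 ->
  `|H - dn| <= e / 3 -> `|1 - p1| <= e / 3 -> `|0 - p0| <= e / 3 ->
  F <= eu + (1 - p1) -> ed - p0 <= F -> `|H - F| <= e.
Proof.
rewrite !ler_norml => /andP[h1 h2] /andP[h3 h4] /andP[h5 h6] /andP[h7 h8].
by move=> /andP[h9 h10] /andP[h11 h12] h13 h14; apply/andP; split; lra.
Qed.

(** * Central limit theorem for martingale arrays *)

Section array_clt.
Context {d : measure_display} {T : measurableType d} {R : realType}.
Variable P : probability T R.
Local Notation integ f := (P.-integrable setT (EFin \o f)).
Local Notation Ex f := (Rintegral P setT f).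

Variables (G : nat -> nat -> set (set T)) (xi q : nat -> nat -> T -> R) (v : R).
Hypothesis sG : forall S k, subsig (G S k).
Hypothesis Gle : forall S k, G S k `<=` G S k.+1.
Hypothesis gxi : forall S k, gmeas (G S k.+1) (xi S k).
Hypothesis gq : forall S k, gmeas (G S k) (q S k).
Hypothesis q_ge0 : forall S k x, 0 <= q S k x.
Hypothesis qi : forall S k, integ (q S k).
Hypothesis xi2 : forall S k, integ (fun x => xi S k x ^+ 2).
Hypothesis oxi : forall S k, orth P (G S k) (xi S k).
Hypothesis oq : forall S k, orth P (G S k) (fun x => xi S k x ^+ 2 - q S k x).
Hypothesis v_ge0 : 0 <= v.
Hypothesis q_cvg : cvg_in_prob P (fun S x => \sum_(k < S) q S k x) v.
Hypothesis lyap_cvg :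
  \sum_(k < S) Ex (fun x => lyap (xi S k x)) @[S --> \oo] --> (0 : R).

Let M S x := \sum_(k < S) xi S k x.

Lemma smooth_clt a t : 0 < a ->
  Ex (fun x => Phi ((t - M S x) / Num.sqrt (a + a))) @[S --> \oo] -->
  Phi (t / Num.sqrt (a + a + v)).
Proof.
move=> a0; apply/cvgrPdist_le => e e0.
set D := 9 / a + 9 / a ^+ 2.
have D0 : 0 <= D by rewrite addr_ge0// divr_ge0 ?exprn_ge0// ltW.
set K := D * (v + a) + 9 / a.
have va : 0 <= v + a by rewrite addr_ge0// ltW.
have a9 : 0 <= 9 / a by rewrite divr_ge0// ltW.
have K0 : 0 <= K by rewrite addr_ge0// mulr_ge0.
(* [h] is fixed before [S]: the factor [D / h] in front of the Lyapunov sum is large, but constant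
   in [S]. *)
pose h := Num.min (Num.min 1 a) (e / 3 / (K + 1)).
have h0 : 0 < h by rewrite !lt_min ltr01 a0/= !divr_gt0//; lra.
have h1 : h <= 1 by rewrite !ge_min lexx.
have ha : h <= a by rewrite !ge_min lexx orbT.
have hK : K * h <= e / 3.
  apply: (@le_trans _ _ ((K + 1) * (e / 3 / (K + 1)))).
    by rewrite ler_pM//; [exact: ltW|lra|rewrite ge_min lexx orbT].
  by rewrite mulrCA divff ?mulr1//; apply/lt0r_neq0; lra.
set C := heatC a + D / h.
have C0 : 0 <= C.
  apply: addr_ge0; last by rewrite divr_ge0// ltW.
  by rewrite /heatC mulr_ge0// exprn_ge0// addr_ge0// invr_ge0 sqrtr_ge0.
have Pc : fine (P [set x | h < `|\sum_(k < S) q S k x - v| ]) @[S --> \oo] --> (0 : R).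
  exact: fine_cvg (q_cvg h0).
have Lc : C * \sum_(k < S) Ex (fun x => lyap (xi S k x)) @[S --> \oo] --> (0 : R).
  by rewrite -[X in _ --> X](mulr0 C); apply: cvgM => //; exact: cvg_cst.
have e3 : 0 < e / 3 by rewrite divr_gt0.
move/cvgrPdist_le: Pc => /(_ _ e3); move/cvgrPdist_le: Lc => /(_ _ e3).
apply: filterS2 => S; rewrite !sub0r !normrN => LS PS.
have := @martingale_clt_bound _ _ _ P (G S) (xi S) (q S) (sG S) (@Gle S) (@gxi S)
  (@gq S) (@q_ge0 S) (@qi S) (@xi2 S) (@oxi S) (@oq S) a v a0 v_ge0 t S h h0 h1 ha.
rewrite -/D -/C distrC => /le_trans; apply.
have l1 := le_trans (ler_norm _) LS; have l2 := le_trans (ler_norm _) PS.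
have l3 : D * h ^+ 2 * (v + a) + 9 / a * h <= K * h.
  rewrite [leRHS]mulrDl lerD2r mulrAC ler_wpM2l ?mulr_ge0//.
  by rewrite expr2 ler_piMl// ltW.
rewrite -[X in X + _]addrA.
apply: le_trans (lerD (lerD l1 (le_trans l3 hK)) l2) _; lra.
Qed.

Let mM S : measurable_fun setT (M S).
Proof. by apply: measurable_sum => k; exact: (gmeas_meas (sG S k.+1) (@gxi S k)). Qed.

Lemma array_clt : cvg_in_distribution P M (centered_normal v).
Proof.
move=> t t0.
have vt : v == 0 -> t != 0.
  move=> v0; apply/eqP => tz; move: t0; rewrite /centered_normal v0 diracE tz.
  by rewrite mem_set//= => /eqP; rewrite eqe oner_eq0.
rewrite centered_normal_cdf//.
have mset (S : nat) (y : R) : measurable [set x | M S x <= y].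
  rewrite (_ : [set _ | _] = M S @^-1` `]-oo, y]%classic).
    by rewrite -[X in measurable X]setTI; exact: mM.
  by apply/seteqP; split=> x; rewrite /= in_itv.
have PE S : P [set x | M S x <= t] = (fine (P [set x | M S x <= t]))%:E.
  by rewrite fineK// fin_num_measure.
under eq_fun do rewrite PE.
apply: cvg_EFin; first exact: nearW.
apply/cvgrPdist_le => e e0.
have e3 : 0 < e / 3 by rewrite divr_gt0.
have ny : (n.+1%:R : R) @[n --> \oo] --> +oo.
  apply/cvgryPge => B; near=> n.
  have := ler_norm B; have : `|B| <= n%:R by near: n; exact: nbhs_infty_ger.
  by rewrite -natr1; lra.
have nNy : - (n.+1%:R : R) @[n --> \oo] --> -oo by exact/cvgNrNy.
have one1 : `|1| = 1 :> R by rewrite normr1.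
have onem1 : `|-1| = 1 :> R by rewrite normrN1.
have /cvgrPdist_le/(_ _ e3) up := normal_smoothing v_ge0 vt one1.
have /cvgrPdist_le/(_ _ e3) dn := normal_smoothing v_ge0 vt onem1.
have /cvgrPdist_le/(_ _ e3) p1 := Phi_cvg1 ny.
have /cvgrPdist_le/(_ _ e3) p0 := Phi_cvg0 nNy.
(* The width [dl] of the smoothing is fixed first, through [n], with all four Gaussian errors below
   [e / 3]; then [a] is chosen so that the added variance [a + a] is [dl ^ 4]. *)
have [n [[upn dnn] [p1n p0n]]] := filter_ex (filterI (filterI up dn) (filterI p1 p0)).
pose dl : R := n.+1%:R^-1; pose a := dl ^+ 4 / 2.
have dl0 : 0 < dl by rewrite invr_gt0.
have a0 : 0 < a by rewrite divr_gt0// exprn_gt0.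
have aa : a + a = dl ^+ 4 by rewrite /a -splitr.
have sq : Num.sqrt (a + a) = dl ^+ 2.
  by rewrite aa (exprM _ 2 2) sqrtr_sqr ger0_norm// exprn_ge0// ltW.
have /cvgrPdist_le/(_ _ e3) cu := @smooth_clt a (t + 1 * dl) a0.
have /cvgrPdist_le/(_ _ e3) cd := @smooth_clt a (t + -1 * dl) a0.
apply: filterS2 cu cd => S; rewrite sq aa => cuS cdS.
set H := normal_cdf v t in upn dnn *.
pose f (sg : R) x := Phi ((t + sg * dl - M S x) / dl ^+ 2).
have fi sg : integ (f sg).
  apply: (@integ_bnd _ _ _ _ _ 1); last by move=> x; rewrite ger0_norm ?Phi_ge0 ?Phi_le1.
  have mPhi : measurable_fun setT (@Phi R).
    apply: continuous_measurable_fun => x.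
    by have [/derivable1_diffP/differentiable_continuous] := is_derive_Phi x.
  apply: (measurableT_comp mPhi (g := fun x => (t + sg * dl - M S x) / dl ^+ 2)).
  by apply: measurable_funM => //; exact: measurable_funB.
pose B := [set x | M S x <= t]; have mB : measurable B by exact: mset.
have iB : integ (\1_B : T -> R).
  by apply: integ_bnd (norm_indic _); exact: measurable_indic.
have dE : dl / dl ^+ 2 = n.+1%:R by rewrite /dl; field; rewrite nat1r pnatr_eq0.
have d2 : 0 <= (dl ^+ 2)^-1 by rewrite invr_ge0 exprn_ge0// ltW.
have ge1 z : dl <= z -> n.+1%:R <= z / dl ^+ 2.
  by move=> h; rewrite -[leLHS]dE; exact: ler_wpM2r.
have le1 z : z <= - dl -> z / dl ^+ 2 <= - n.+1%:R.
  by move=> h; rewrite -[X in - X]dE -mulNr; exact: ler_wpM2r.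
(* If [M S x <= t], the argument in [f 1] is at least [dl / dl ^+ 2], that is [n.+1%:R], so the
   smoothed indicator misses 1 by at most [1 - Phi n.+1%:R]. The lower bound is its mirror image. *)
have hi : fine (P B) <= Ex (f 1) + (1 - Phi n.+1%:R).
  rewrite -(Ex_indic P mB) -[X in _ + X](Ex_cst P) -ExD//; last exact: integ_cst.
  apply: Ex_le => //; first by apply: integD => //; exact: integ_cst.
  move=> x; rewrite indicE; have [h|h] := leP (M S x) t.
    rewrite mem_set//= addrCA lerDl subr_ge0; apply: Phi_homo.
    by apply: ge1; rewrite mul1r addrAC lerDr subr_ge0.
  rewrite memNset /=; last by apply/negP; rewrite -ltNge.
  by rewrite addr_ge0 ?Phi_ge0// subr_ge0 Phi_le1.
have lo : Ex (f (-1)) - Phi (- n.+1%:R) <= fine (P B).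
  rewrite -(Ex_indic P mB) -[X in _ - X](Ex_cst P) -ExB//; last exact: integ_cst.
  apply: Ex_le => //; first by apply: integB => //; exact: integ_cst.
  move=> x; rewrite indicE; have [h|h] := leP (M S x) t.
    rewrite mem_set//= lerBlDr (le_trans (Phi_le1 _))// lerDl; exact: Phi_ge0.
  rewrite memNset /=; last by apply/negP; rewrite -ltNge.
  rewrite subr_le0; apply: Phi_homo.
  by apply: le1; rewrite mulN1r addrAC gerDr subr_le0 ltW.
exact: (squeeze_arith cuS cdS upn dnn p1n p0n hi lo).
Unshelve. all: by end_near. Qed.

End array_clt.

(** * Quadratic forms in conditionally independent variables *)

(** Grouping the pairs by their larger index is what turns a quadratic form into a sum of increments
    revealed one at a time. *)
Lemma sum_sym {R : ringType} m (F : 'I_m -> 'I_m -> R) :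
  \sum_(t < m) \sum_(u < m) F t u = \sum_(t < m) F t t + \sum_(t < m) \sum_(u < m | (u < t)%N) (F t u + F u t).
Proof.
have e1 : \sum_(t < m) \sum_(u < m | (u < t)%N) F u t = \sum_(t < m) \sum_(u < m | (t < u)%N) F t u.
  by rewrite (exchange_big_dep xpredT).
rewrite (eq_bigr _ (fun t _ => big_split _ _ _ (fun u => F t u) (fun u => F u t))).
rewrite big_split/= e1 addrA -big_split -big_split/=; apply: eq_bigr => t _.
rewrite (bigD1 t)//= -addrA; congr (_ + _).
rewrite (bigID (fun u : 'I_m => (u < t)%N))/=; congr (_ + _); apply: eq_bigl => u.
  by case: ltngtP => //; rewrite ?andbF ?andbT// -(inj_eq val_inj); case: ltngtP.
by rewrite -leqNgt -(inj_eq val_inj) eq_sym ltn_neqAle.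
Qed.

Section fourth_moments.
Context {d : measure_display} {T : measurableType d} {R : realType}.
Variable P : probability T R.
Implicit Types f g h k : T -> R.
Local Notation integ f := (P.-integrable setT (EFin \o f)).

(** A class closed under sums in which products of four members are integrable; it settles the
    integrability of every term in the square of an increment. *)
Definition L4 f := measurable_fun setT f /\ integ (fun x => f x ^+ 4).

Lemma pow4_ge0 (a : R) : 0 <= a ^+ 4.
Proof. by rewrite (exprM _ 2 2) sqr_ge0. Qed.

Lemma L4_bnd f (M : R) : measurable_fun setT f -> (forall x, `|f x| <= M) -> L4 f.
Proof.
move=> mf fM; split=> //; apply: (@integ_bnd _ _ _ _ _ (M ^+ 4)).
  exact: measurable_funX.
by move=> x; rewrite normrX lerXn2r ?nnegrE// (le_trans _ (fM x)).
Qed.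

Lemma L4D f g : L4 f -> L4 g -> L4 (fun x => f x + g x).
Proof.
move=> [mf fi] [mg gi]; split; first exact: measurable_funD.
apply: (integ_le _ (integZ 8 (integD fi gi))).
  by apply: measurable_funX; exact: measurable_funD.
move=> x; rewrite ger0_norm ?pow4_ge0//.
have h1 : (f x + g x) ^+ 2 <= 2 * (f x ^+ 2 + g x ^+ 2).
  by have := sqr_ge0 (f x - g x); rewrite sqrrB sqrrD; lra.
rewrite (exprM _ 2 2); apply: (@le_trans _ _ ((2 * (f x ^+ 2 + g x ^+ 2)) ^+ 2)).
  by rewrite lerXn2r ?nnegrE ?sqr_ge0// mulr_ge0 ?addr_ge0 ?sqr_ge0.
rewrite !(exprM _ 2 2); set a := f x ^+ 2; set b := g x ^+ 2.
by have := sqr_ge0 (a - b); rewrite exprMn sqrrB sqrrD; lra.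
Qed.

Lemma L4M_bnd f g (M : R) : L4 f -> measurable_fun setT g ->
  (forall x, `|g x| <= M) -> L4 (fun x => f x * g x).
Proof.
move=> [mf fi] mg gM; split; first exact: measurable_funM.
have gM4 x : `|g x ^+ 4| <= M ^+ 4.
  by rewrite normrX lerXn2r ?nnegrE// (le_trans _ (gM x)).
apply: integ_ext (integM_bnd fi _ gM4) => [x|]; first by rewrite exprMn.
exact: measurable_funX.
Qed.

Lemma L4_ext f g : f =1 g -> L4 f -> L4 g.
Proof. by move=> /funext ->. Qed.

Lemma L4_sum I (s : seq I) (Q : pred I) (F : I -> T -> R) :
  (forall i, Q i -> L4 (F i)) -> L4 (fun x => \sum_(i <- s | Q i) F i x).
Proof.
move=> iF; elim: s => [|i s IH].
  apply: (L4_ext (f := fun=> 0)) => [x|]; first by rewrite big_nil.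
  by apply: (@L4_bnd _ 0) => // x; rewrite normr0.
have [Qi|nQi] := boolP (Q i).
  by apply: L4_ext (L4D (iF i Qi) IH) => x; rewrite big_cons Qi.
by apply: L4_ext IH => x; rewrite big_cons (negbTE nQi).
Qed.

Lemma L4_cst (c : R) : L4 (fun=> c).
Proof. exact: (L4_bnd (M := `|c|)). Qed.

Lemma integ_prod4 f g h k : L4 f -> L4 g -> L4 h -> L4 k ->
  integ (fun x => f x * g x * h x * k x).
Proof.
move=> [mf fi] [mg gi] [mh hi] [mk ki].
apply: (integ_le _ (integD (integD fi gi) (integD hi ki))).
  by do 3!apply: measurable_funM => //.
move=> x.
have sq2 (a b : R) : `|a * b| <= 2^-1 * (a ^+ 2 + b ^+ 2).
  rewrite ler_norml; have := sqr_ge0 (a - b); have := sqr_ge0 (a + b).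
  by rewrite sqrrB sqrrD => h1 h2; apply/andP; split; lra.
rewrite -mulrA; apply: le_trans (sq2 _ _) _.
rewrite !exprMn.
have sq4 (a b : R) : a ^+ 2 * b ^+ 2 <= 2^-1 * (a ^+ 4 + b ^+ 4).
  by rewrite !(exprM _ 2 2); apply: le_trans (sq2 _ _); exact: ler_norm.
have := sq4 (f x) (g x); have := sq4 (h x) (k x).
have := pow4_ge0 (f x); have := pow4_ge0 (g x); have := pow4_ge0 (h x).
have := pow4_ge0 (k x); lra.
Qed.

Lemma integ_prod3 f g h : L4 f -> L4 g -> L4 h -> integ (fun x => f x * g x * h x).
Proof.
move=> lf lg lh; apply: integ_ext (integ_prod4 lf lg lh (L4_cst 1)) => x.
by rewrite mulr1.
Qed.

Lemma integ_prod2 f g : L4 f -> L4 g -> integ (fun x => f x * g x).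
Proof.
move=> lf lg; apply: integ_ext (integ_prod3 lf lg (L4_cst 1)) => x.
by rewrite mulr1.
Qed.

End fourth_moments.

Section quadratic_form.
Context {d : measure_display} {T : measurableType d} {R : realType}.
Variable P : probability T R.
Local Notation integ f := (P.-integrable setT (EFin \o f)).
Local Notation Ex f := (Rintegral P setT f).

Variables (F : set (set T)) (G : nat -> set (set T)) (m : nat).
Variables (X sig kap chi : 'I_m -> T -> R) (K : R).

(* [sig], [kap], [chi] are bounded versions of the conditional moments of order
   2, 3, 4 of [X t], both given [F] and given the enlargement [G t] of [F] by the
   earlier [X u]. *)
Record cond_moments : Prop := CondMoments {
  cm_subsigF : subsig F ;
  cm_subsig : forall k, subsig (G k) ;
  cm_sub : forall k, F `<=` G k ;
  cm_le : forall k l, (k <= l)%N -> G k `<=` G l ;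
  cm_gX : forall k (t : 'I_m), (t < k)%N -> gmeas (G k) (X t) ;
  cm_L4 : forall t, L4 P (X t) ;
  cm_gsig : forall t, gmeas F (sig t) ;
  cm_gkap : forall t, gmeas F (kap t) ;
  cm_gchi : forall t, gmeas F (chi t) ;
  cm_sig : forall t y, 0 <= sig t y <= K ;
  cm_kap : forall t y, `|kap t y| <= K ;
  cm_chi : forall t y, 0 <= chi t y <= K ;
  cm_o1 : forall t : 'I_m, orth P (G t) (X t) ;
  cm_o2 : forall t : 'I_m, orth P (G t) (fun y => X t y ^+ 2 - sig t y) ;
  cm_o3 : forall t : 'I_m, orth P (G t) (fun y => X t y ^+ 3 - kap t y) ;
  cm_o4 : forall t : 'I_m, orth P (G t) (fun y => X t y ^+ 4 - chi t y) }.

Hypothesis cm : cond_moments.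

(** The linear coefficients [C] carry the outcomes and have only fourth moments; [D] and [e] come
    from shares and effects and are bounded. *)
Record coefs (C D : 'I_m -> T -> R) (e : 'I_m -> 'I_m -> T -> R) : Prop := Coefs {
  cf_gC : forall t, gmeas F (C t) ;
  cf_LC : forall t, L4 P (C t) ;
  cf_gD : forall t, gmeas F (D t) ;
  cf_D : exists B, forall t y, `|D t y| <= B ;
  cf_ge : forall t u, gmeas F (e t u) ;
  cf_e : exists B, forall t u y, `|e t u y| <= B }.

Definition qf_lin (C : 'I_m -> T -> R) (e : 'I_m -> 'I_m -> T -> R) t y : R :=
  C t y + \sum_(u < m | (u < t)%N) e t u y * X u y.

Definition qf_inc C D e t y : R :=
  X t y * qf_lin C e t y + (X t y ^+ 2 - sig t y) * D t y.

Definition qf_form C D e y : R := \sum_(t < m) qf_inc C D e t y.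

(** Conditional variance of [qf_inc] given [G t]: expand the square and replace the second, third
    and fourth powers of [X t] by [sig], [kap] and [chi]. *)
Definition qf_var C D e t y : R :=
  sig t y * qf_lin C e t y ^+ 2 + 2 * kap t y * D t y * qf_lin C e t y +
  (chi t y - sig t y ^+ 2) * D t y ^+ 2.

(** The same variance given [F]: the first two conditional moments of [qf_lin] given [F] replace its
    powers in [qf_var]. *)
Definition qf_var0 (C D : 'I_m -> T -> R) (e : 'I_m -> 'I_m -> T -> R) t y : R :=
  sig t y * (C t y ^+ 2 + \sum_(u < m | (u < t)%N) e t u y ^+ 2 * sig u y) +
  2 * kap t y * D t y * C t y + (chi t y - sig t y ^+ 2) * D t y ^+ 2.

Let mX t : measurable_fun setT (X t).
Proof. by case: (cm_L4 cm t). Qed.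

Let gFG k (f : T -> R) : gmeas F f -> gmeas (G k) f.
Proof. by apply: gmeas_sub; exact: cm_sub cm k. Qed.

Let sigB t y : `|sig t y| <= K.
Proof. by have /andP[h1 h2] := cm_sig cm t y; rewrite ger0_norm. Qed.

Let chiB t y : `|chi t y| <= K.
Proof. by have /andP[h1 h2] := cm_chi cm t y; rewrite ger0_norm. Qed.

Let L4F (f : T -> R) (B : R) : gmeas F f -> (forall y, `|f y| <= B) -> L4 P f.
Proof. by move=> gf; apply: L4_bnd; exact: gmeas_meas (cm_subsigF cm) gf. Qed.

Section one_form.
Variables (C D : 'I_m -> T -> R) (e : 'I_m -> 'I_m -> T -> R).
Hypothesis cf : coefs C D e.

Lemma qf_lin_gmeas (t : 'I_m) : gmeas (G t) (qf_lin C e t).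
Proof.
have sG := cm_subsig cm t; apply: gmeasD => //; first exact/gFG/(cf_gC cf).
apply: gmeas_sum => // u ut; apply: gmeasM => //; first exact/gFG/(cf_ge cf).
exact: (cm_gX cm).
Qed.

Lemma qf_lin_L4 t : L4 P (qf_lin C e t).
Proof.
apply: L4D; first exact: cf_LC cf t.
apply: L4_sum => u _; have [B eB] := cf_e cf.
apply: (L4_ext (f := fun y => X u y * e t u y)) => [y|]; first exact: mulrC.
apply: (L4M_bnd (M := B)) => //; first exact: (cm_L4 cm).
exact: gmeas_meas (cm_subsigF cm) (cf_ge cf t u).
Qed.

Let lD t : L4 P (D t).
Proof. by have [B DB] := cf_D cf; exact: L4F (cf_gD cf t) (DB t). Qed.

Let lsig t : L4 P (sig t).
Proof. exact: L4F (cm_gsig cm t) (sigB t). Qed.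

Let lkap t : L4 P (kap t).
Proof. exact: L4F (cm_gkap cm t) (cm_kap cm t). Qed.

Let lchi t : L4 P (chi t).
Proof. exact: L4F (cm_gchi cm t) (chiB t). Qed.

Lemma qf_inc_gmeas (t : 'I_m) : gmeas (G t.+1) (qf_inc C D e t).
Proof.
have sG := cm_subsig cm t.+1; have gX : gmeas (G t.+1) (X t) by exact: (cm_gX cm).
apply: gmeasD => //; apply: gmeasM => //.
- by apply: gmeas_sub (qf_lin_gmeas t); exact: (cm_le cm).
- by apply: gmeasB => //; [exact: gmeasX|exact/gFG/(cm_gsig cm)].
- exact/gFG/(cf_gD cf).
Qed.

Lemma qf_inc_gmeas_lt k (t : 'I_m) : (t < k)%N -> gmeas (G k) (qf_inc C D e t).
Proof. by move=> tk; apply: gmeas_sub (qf_inc_gmeas t); exact: (cm_le cm). Qed.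

Lemma qf_var_gmeas (t : 'I_m) : gmeas (G t) (qf_var C D e t).
Proof.
have sG := cm_subsig cm t; have gl := qf_lin_gmeas t.
have gs : gmeas (G t) (sig t) by exact/gFG/(cm_gsig cm).
have gk : gmeas (G t) (kap t) by exact/gFG/(cm_gkap cm).
have gc : gmeas (G t) (chi t) by exact/gFG/(cm_gchi cm).
have gD : gmeas (G t) (D t) by exact/gFG/(cf_gD cf).
apply: gmeasD => //; first apply: gmeasD => //.
- by apply: gmeasM => //; exact: gmeasX.
- by apply: gmeasM => //; apply: gmeasM => //; apply: gmeasM => //; exact: gmeas_cst.
- by apply: gmeasM => //; [apply: gmeasB => //; exact: gmeasX|exact: gmeasX].
Qed.

Lemma qf_var0_gmeas t : gmeas F (qf_var0 C D e t).
Proof.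
have sF := cm_subsigF cm; have gs := cm_gsig cm.
have gk := cm_gkap cm t; have gc := cm_gchi cm t.
have gD := cf_gD cf t; have gC := cf_gC cf t.
apply: gmeasD => //; first apply: gmeasD => //.
- apply: gmeasM => //; apply: gmeasD => //; first exact: gmeasX.
  by apply: gmeas_sum => // u _; apply: gmeasM => //; apply: gmeasX; exact: (cf_ge cf).
- by apply: gmeasM => //; apply: gmeasM => //; apply: gmeasM => //; exact: gmeas_cst.
- by apply: gmeasM => //; [apply: gmeasB => //; exact: gmeasX|exact: gmeasX].
Qed.

Lemma qf_inc_orth (t : 'I_m) : orth P (G t) (qf_inc C D e t).
Proof.
have sG := cm_subsig cm t; apply: orthD => //; apply: orthM => //.
- exact: (cm_o1 cm).
- exact: qf_lin_gmeas.
- by apply: integ_prod2; [exact: (cm_L4 cm)|exact: qf_lin_L4].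
- exact: (cm_o2 cm).
- exact/gFG/(cf_gD cf).
- have [B DB] := cf_D cf.
  apply: (integM_bnd _ _ (DB t)); first exact: (cm_o2 cm t).1.
  by case: (lD t).
Qed.

Let integ_bndM (f g : T -> R) : L4 P g -> (exists B, forall y, `|g y| <= B) ->
  integ f -> integ (fun y => f y * g y).
Proof. by move=> [mg _] [B gB] fi; exact: (integM_bnd fi mg gB). Qed.

Lemma qf_var_orth (t : 'I_m) :
  orth P (G t) (fun y => qf_inc C D e t y ^+ 2 - qf_var C D e t y).
Proof.
have sG := cm_subsig cm t.
have gl := qf_lin_gmeas t; have ll := qf_lin_L4 t; have lX := cm_L4 cm t.
have gs : gmeas (G t) (sig t) by exact/gFG/(cm_gsig cm).
have gD : gmeas (G t) (D t) by exact/gFG/(cf_gD cf).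
have [B DB] := cf_D cf.
have bD : exists B, forall y, `|D t y| <= B by exists B.
have bs : exists B, forall y, `|sig t y| <= B by exists K.
have bk : exists B, forall y, `|kap t y| <= B by exists K => y; exact: (cm_kap cm).
set l := qf_lin C e t in gl ll.
(* Every term is a centred power of [X t] times a factor known at time [t], so each is orthogonal by
   one of the four moment conditions. *)
apply: (@orth_ext _ _ _ _ _ (fun y =>
  (X t y ^+ 2 - sig t y) * (l y ^+ 2) +
  (X t y ^+ 3 - kap t y) * (2 * D t y * l y) +
  (X t y * (- 2 * sig t y * D t y * l y)) +
  (X t y ^+ 4 - chi t y) * (D t y ^+ 2) +
  (X t y ^+ 2 - sig t y) * (- 2 * sig t y * D t y ^+ 2))).
  by move=> y; rewrite /qf_inc /qf_var -/l; ring.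
have gc c : gmeas (G t) (fun=> c : R) by exact: gmeas_cst.
do 4?[apply: orthD => //].
- apply: orthM => //; [exact: (cm_o2 cm)|exact: gmeasX|].
  apply: (integ_ext (f := fun y => X t y * X t y * l y * l y - sig t y * l y * l y)).
    by move=> y; ring.
  by apply: integB; [exact: integ_prod4|exact: integ_prod3].
- apply: orthM => //; [exact: (cm_o3 cm)| |].
    by apply: gmeasM => //; exact: gmeasM.
  apply: (integ_ext (f := fun y => 2 * (X t y * X t y * X t y * l y * D t y -
     kap t y * l y * D t y))); first by move=> y; ring.
  apply/integZ/integB; last exact: integ_prod3.
  by apply: integ_bndM => //; exact: integ_prod4.
- apply: orthM => //; [exact: (cm_o1 cm)| |].
    by do 3!apply: gmeasM => //.
  apply: (integ_ext (f := fun y => - 2 * (X t y * l y * sig t y * D t y))).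
    by move=> y; ring.
  exact/integZ/integ_prod4.
- apply: orthM => //; [exact: (cm_o4 cm)|exact: gmeasX|].
  apply: (integ_ext (f := fun y => (X t y ^+ 4 - chi t y) * D t y * D t y)).
    by move=> y; ring.
  by do 2!apply: integ_bndM => //; exact: (cm_o4 cm t).1.
- apply: orthM => //; [exact: (cm_o2 cm)| |].
    by apply: gmeasM => //; [exact: gmeasM|exact: gmeasX].
  apply: (integ_ext (f := fun y =>
    - 2 * ((X t y ^+ 2 - sig t y) * sig t y * D t y * D t y))).
    by move=> y; ring.
  by apply/integZ; do 3!apply: integ_bndM => //; exact: (cm_o2 cm t).1.
Qed.

Lemma qf_inc_integ2 t : integ (fun y => qf_inc C D e t y ^+ 2).
Proof.
have ll := qf_lin_L4 t; have lX := cm_L4 cm t.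
have bD : exists B, forall y, `|D t y| <= B by have [B DB] := cf_D cf; exists B.
have bs : exists B, forall y, `|sig t y| <= B by exists K.
set l := qf_lin C e t in ll.
apply: (integ_ext (f := fun y => X t y * X t y * l y * l y +
  2 * (X t y * X t y * X t y * l y * D t y - X t y * l y * sig t y * D t y) +
  (X t y * X t y * X t y * X t y - 2 * (X t y * X t y * sig t y) +
   sig t y * sig t y) * D t y * D t y)).
  by move=> y; rewrite /qf_inc -/l; ring.
apply: integD; first apply: integD.
- exact: integ_prod4.
- apply/integZ/integB; last exact: integ_prod4.
  by apply: integ_bndM => //; exact: integ_prod4.
- do 2!apply: integ_bndM => //; apply: integD; last exact: integ_prod2.
  by apply: integB; [exact: integ_prod4|apply: integZ; exact: integ_prod3].
Qed.

Lemma qf_var_integ t : integ (qf_var C D e t).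
Proof.
apply: (integ_ext (f := fun y => qf_inc C D e t y ^+ 2 -
  (qf_inc C D e t y ^+ 2 - qf_var C D e t y))); first by move=> y; ring.
by apply: integB; [exact: qf_inc_integ2|exact: (qf_var_orth t).1].
Qed.

Lemma qf_form_orth : orth P F (qf_form C D e).
Proof.
apply: orth_sum; first exact: cm_subsigF cm.
by move=> t _; apply: orth_sub (qf_inc_orth t); exact: cm_sub cm t.
Qed.

(** In the square of the form, a product of two distinct increments is centred given the past of the
    later one, so only the squares contribute. *)
Lemma qf_form_var_orth :
  orth P F (fun y => qf_form C D e y ^+ 2 - \sum_(t < m) qf_var C D e t y).
Proof.
have sF := cm_subsigF cm.
apply: (@orth_ext _ _ _ _ _ (fun y =>
  \sum_(t < m) (qf_inc C D e t y ^+ 2 - qf_var C D e t y) +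
  \sum_(t < m) \sum_(u < m | (u < t)%N) 2 * (qf_inc C D e t y * qf_inc C D e u y))).
  move=> y; rewrite /qf_form expr2 mulr_suml.
  under [in RHS]eq_bigr do rewrite mulr_sumr.
  rewrite sum_sym sumrB addrAC; congr (_ - _); congr (_ + _).
  by apply: eq_bigr => t _; apply: eq_bigr => u _; ring.
apply: orthD => //; apply: orth_sum => // t _.
  by apply: orth_sub (qf_var_orth t); exact: cm_sub cm t.
apply: orth_sum => // u ut; apply: orthZ => //.
apply: (orth_sub (cm_sub cm t)); apply: orthM; first exact: cm_subsig cm t.
- exact: qf_inc_orth.
- exact: qf_inc_gmeas_lt.
- apply: (integ_le _ (integD (qf_inc_integ2 t) (qf_inc_integ2 u))).
    have mi s : measurable_fun setT (qf_inc C D e s).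
      exact: gmeas_meas (cm_subsig cm s.+1) (qf_inc_gmeas s).
    exact: measurable_funM.
  move=> y; rewrite normrM -(real_normK (num_real (qf_inc C D e t y))).
  rewrite -(real_normK (num_real (qf_inc C D e u y))).
  move: (normr_ge0 (qf_inc C D e t y)) (normr_ge0 (qf_inc C D e u y)).
  by move: `|_| `|_| => a b a0 b0; have := sqr_ge0 (a - b); rewrite sqrrB; nra.
Qed.

End one_form.
End quadratic_form.

(** * Fluctuation of the conditional variance of a quadratic form *)

Section conditional_variance.
Context {d : measure_display} {T : measurableType d} {R : realType}.
Variable P : probability T R.
Local Notation integ f := (P.-integrable setT (EFin \o f)).
Local Notation Ex f := (Rintegral P setT f).

Variables (F : set (set T)) (G : nat -> set (set T)) (m : nat).
Variables (X sig kap chi : 'I_m -> T -> R) (K : R).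
Hypothesis cm : cond_moments P F G X sig kap chi K.

Variables (C D : 'I_m -> T -> R) (e : 'I_m -> 'I_m -> T -> R).
Hypothesis cf : coefs P F C D e.

(** Extension by 0 on and above the diagonal, so that sums over pairs can be exchanged freely. *)
Definition qf_mask (t u : 'I_m) y : R := if (u < t)%N then e t u y else 0.
(** The factor of [\sum_u e t u * X u] in [qf_var]. It produces the linear coefficients [qf_C2]; the
    square of that sum produces [qf_D2] on the diagonal and [qf_e2] off it. *)
Definition qf_mix t y : R := 2 * sig t y * C t y + 2 * kap t y * D t y.
Definition qf_C2 u y : R := \sum_(t < m) qf_mix t y * qf_mask t u y.
Definition qf_D2 u y : R := \sum_(t < m) sig t y * qf_mask t u y ^+ 2.
Definition qf_e2 u w y : R := \sum_(t < m) 2 * sig t y * (qf_mask t u y * qf_mask t w y).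

Lemma qf_maskE (t : 'I_m) (a : 'I_m -> R) y :
  \sum_(u < m | (u < t)%N) e t u y * a u = \sum_(u < m) qf_mask t u y * a u.
Proof.
by rewrite big_mkcond; apply: eq_bigr => u _; rewrite /qf_mask; case: ifP; rewrite ?mul0r.
Qed.

(* The fluctuation of the conditional variance of a quadratic form is again a
   quadratic form in the same variables. *)
Lemma qf_var_sub y :
  \sum_(t < m) qf_var X sig kap chi C D e t y -
  \sum_(t < m) qf_var0 sig kap chi C D e t y =
  qf_form X sig qf_C2 qf_D2 qf_e2 y.
Proof.
rewrite -sumrB.
transitivity (\sum_(t < m) \sum_(u < m)
  (X u y * (qf_mix t y * qf_mask t u y +
     \sum_(w < m | (w < u)%N) 2 * sig t y * (qf_mask t u y * qf_mask t w y) * X w y) +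
   (X u y ^+ 2 - sig u y) * (sig t y * qf_mask t u y ^+ 2))).
  apply: eq_bigr => t _; rewrite /qf_var /qf_var0 /qf_lin.
  rewrite (qf_maskE t (X ^~ y)).
  have -> : \sum_(u < m | (u < t)%N) e t u y ^+ 2 * sig u y =
      \sum_(u < m) qf_mask t u y ^+ 2 * sig u y.
    rewrite big_mkcond; apply: eq_bigr => u _; rewrite /qf_mask.
    by case: ifP => //; rewrite expr0n mul0r.
  set U := \sum_(u < m) _; set L := \sum_(u < m) _.
  have U2 : U ^+ 2 = \sum_(u < m) qf_mask t u y ^+ 2 * X u y ^+ 2 +
      \sum_(u < m) \sum_(w < m | (w < u)%N)
        2 * (qf_mask t u y * qf_mask t w y) * X u y * X w y.
    rewrite /U expr2 mulr_suml; under eq_bigr do rewrite mulr_sumr.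
    rewrite sum_sym; congr (_ + _); first by apply: eq_bigr => u _; ring.
    by apply: eq_bigr => u _; apply: eq_bigr => w _; ring.
  transitivity (qf_mix t y * U + sig t y * (U ^+ 2 - L)).
    by rewrite /qf_mix; ring.
  rewrite U2 /U /L addrAC -sumrB -big_split/= !mulr_sumr -big_split/=.
  apply: eq_bigr => u _; rewrite mulrDr [X in _ + (_ + X)]mulr_sumr.
  rewrite [X in _ = X + _]mulrDr mulr_sumr.
  have -> : \sum_(w < m | (w < u)%N) sig t y *
      (2 * (qf_mask t u y * qf_mask t w y) * X u y * X w y) =
    \sum_(w < m | (w < u)%N) X u y * (2 * sig t y *
      (qf_mask t u y * qf_mask t w y) * X w y).
    by apply: eq_bigr => w _; ring.
  by ring.
rewrite exchange_big/=; apply: eq_bigr => u _; rewrite /qf_inc /qf_lin.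
rewrite big_split/= -!mulr_sumr big_split/=; congr (_ * (_ + _) + _).
rewrite exchange_big/=; apply: eq_bigr => w _.
by rewrite /qf_e2 mulr_suml.
Qed.

Let sF := cm_subsigF cm.

Lemma qf_mask_gmeas t u : gmeas F (qf_mask t u).
Proof.
have [ut|ut] := boolP (u < t)%N.
  by apply: gmeas_ext (cf_ge cf t u) => y; rewrite /qf_mask ut.
by apply: gmeas_ext (gmeas_cst sF 0) => y; rewrite /qf_mask (negbTE ut).
Qed.

Lemma qf_mix_gmeas t : gmeas F (qf_mix t).
Proof.
have gk := cm_gkap cm t; have gC := cf_gC cf t; have gD := cf_gD cf t.
have gs := cm_gsig cm t; have g2 := gmeas_cst sF (2 : R).
by apply: gmeasD => //; apply: gmeasM => //; exact: gmeasM.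
Qed.

Lemma qf_mix_L4 t : L4 P (qf_mix t).
Proof.
have [B DB] := cf_D cf.
have K0 (y : T) : 0 <= K by have /andP[h] := cm_sig cm t y; exact: le_trans.
apply: L4D.
  apply: (L4_ext (f := fun y => C t y * (2 * sig t y))) => [y|]; first exact: mulrC.
  apply: (L4M_bnd (M := 2 * K)) => [||y]; first exact: cf_LC cf t.
    apply: (gmeas_meas sF); apply: gmeasM => //; first exact: (gmeas_cst sF).
    exact: cm_gsig cm t.
  by have /andP[h1 h2] := cm_sig cm t y; rewrite ger0_norm ?mulr_ge0 ?ler_wpM2l.
apply: (@L4_bnd _ _ _ P _ (2 * K * B)).
  apply: (gmeas_meas sF); apply: gmeasM; rewrite //; last exact: cf_gD cf t.
  by apply: gmeasM => //; [exact: (gmeas_cst sF)|exact: cm_gkap cm t].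
move=> y; rewrite normrM; apply: ler_pM => //.
by rewrite normrM ger0_norm// ler_wpM2l// (cm_kap cm).
Qed.

Lemma coefs2 : coefs P F qf_C2 qf_D2 qf_e2.
Proof.
have [B eB] := cf_e cf.
have mB t u y : `|qf_mask t u y| <= `|B|.
  rewrite /qf_mask; case: ifP => _; rewrite ?normr0//.
  by rewrite (le_trans (eB t u y))// ler_norm.
have sB t y : `|sig t y| <= `|K|.
  have /andP[h1 h2] := cm_sig cm t y.
  by rewrite ger0_norm// (le_trans h2)// ler_norm.
split.
- move=> u; apply: gmeas_sum => // t _; apply: gmeasM => //; first exact: qf_mix_gmeas.
  exact: qf_mask_gmeas.
- move=> u; apply: L4_sum => t _; apply: (L4M_bnd (M := `|B|)) => //.
    exact: qf_mix_L4.
  exact: gmeas_meas sF (qf_mask_gmeas t u).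
- move=> u; apply: gmeas_sum => // t _; apply: gmeasM => //.
    exact: cm_gsig cm t.
  by apply: gmeasX => //; exact: qf_mask_gmeas.
- exists (\sum_(t < m) `|K| * `|B| ^+ 2) => u y.
  apply: le_trans (ler_norm_sum _ _ _) _; apply: ler_sum => t _.
  by rewrite normrM normrX; apply: ler_pM => //; rewrite lerXn2r ?nnegrE.
- move=> u w; apply: gmeas_sum => // t _; apply: gmeasM => //.
    by apply: gmeasM => //; [exact: (gmeas_cst sF)|exact: cm_gsig cm t].
  by apply: gmeasM => //; exact: qf_mask_gmeas.
- exists (\sum_(t < m) 2 * `|K| * (`|B| * `|B|)) => u w y.
  apply: le_trans (ler_norm_sum _ _ _) _; apply: ler_sum => t _.
  rewrite !normrM; apply: ler_pM; rewrite ?mulr_ge0//.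
    by rewrite ger0_norm// ler_wpM2l.
  by apply: ler_pM.
Qed.

(** The fluctuation between the two variances is itself a form with mean 0 given [F], so one may be
    replaced by the other. *)
Lemma qf_form_var0_orth :
  orth P F (fun y => qf_form X sig C D e y ^+ 2 -
                     \sum_(t < m) qf_var0 sig kap chi C D e t y).
Proof.
apply: (@orth_ext _ _ _ _ _ (fun y =>
  (qf_form X sig C D e y ^+ 2 - \sum_(t < m) qf_var X sig kap chi C D e t y) +
  qf_form X sig qf_C2 qf_D2 qf_e2 y)).
  by move=> y; rewrite -qf_var_sub; ring.
apply: orthD => //; first exact: (qf_form_var_orth cm cf).
exact: (qf_form_orth cm coefs2).
Qed.

End conditional_variance.

(** * Schur test for a symmetric nonnegative kernel *)

Section schur_test.
Context {R : realFieldType} (m : nat).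
Variables (k : 'I_m -> 'I_m -> R) (r : 'I_m -> R) (L s : R).
Hypotheses (k_ge0 : forall t u, 0 <= k t u) (k_sym : forall t u, k t u = k u t).
Hypotheses (k_row : forall t, \sum_(u < m) k t u <= L * r t).
Hypotheses (L_ge0 : 0 <= L) (r_ge0 : forall t, 0 <= r t) (r_le : forall t, r t <= s).
Hypothesis s_ge0 : 0 <= s.

(** Cauchy-Schwarz in double-sum form: the weights symmetrise the right side, and 2 a b <= a^2 + b^2
    applies to each pair. *)
Lemma weighted_sqr_sum (I : finType) (w a : I -> R) : (forall i, 0 <= w i) ->
  (\sum_i w i * a i) ^+ 2 <= (\sum_i w i) * \sum_i w i * a i ^+ 2.
Proof.
move=> w0; rewrite expr2 !mulr_suml.
have -> : \sum_i w i * \sum_j w j * a j ^+ 2 =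
    \sum_i \sum_j w i * w j * (2^-1 * (a i ^+ 2 + a j ^+ 2)).
  transitivity (2^-1 * (\sum_i \sum_j w i * w j * a j ^+ 2 +
                        \sum_i \sum_j w i * w j * a i ^+ 2)).
    rewrite [X in _ + X]exchange_big/=.
    have -> : \sum_i \sum_j w j * w i * a j ^+ 2 = \sum_i \sum_j w i * w j * a j ^+ 2.
      by apply: eq_bigr => i _; apply: eq_bigr => j _; rewrite (mulrC (w j)).
    rewrite (_ : forall z : R, 2^-1 * (z + z) = z); last by move=> z; field.
    by apply: eq_bigr => i _; rewrite mulr_sumr; apply: eq_bigr => j _; rewrite mulrA.
  rewrite -big_split/= mulr_sumr; apply: eq_bigr => i _.
  by rewrite -big_split/= mulr_sumr; apply: eq_bigr => j _; ring.
apply: ler_sum => i _; rewrite mulr_sumr; apply: ler_sum => j _.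
have -> : w i * a i * (w j * a j) = w i * w j * (a i * a j) by ring.
rewrite ler_wpM2l ?mulr_ge0//.
by have := sqr_ge0 (a i - a j); rewrite sqrrB; lra.
Qed.

Let row_s t : \sum_(u < m) k t u <= L * s.
Proof. by apply: le_trans (k_row t) _; rewrite ler_wpM2l. Qed.

Let k_le t u : k t u <= L * r t.
Proof.
by apply: le_trans (k_row t); rewrite (bigD1 u)//= lerDl sumr_ge0.
Qed.

(** Rows and columns both sum to at most [L * s], which bounds the operator norm on square-summable
    vectors. *)
Lemma schur_linear (c : 'I_m -> R) :
  \sum_(u < m) (\sum_(t < m) k t u * c t) ^+ 2 <= (L * s) ^+ 2 * \sum_(t < m) c t ^+ 2.
Proof.
apply: (@le_trans _ _ (\sum_(u < m) (L * s) * \sum_(t < m) k t u * c t ^+ 2)).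
  apply: ler_sum => u _; apply: le_trans (weighted_sqr_sum _ _) _ => //.
  rewrite ler_wpM2r//; first by apply: sumr_ge0 => t _; rewrite mulr_ge0 ?sqr_ge0.
  by rewrite (eq_bigr (fun t => k u t)).
rewrite -mulr_sumr exchange_big/= expr2 -[leRHS]mulrA; apply: ler_wpM2l.
  exact: mulr_ge0.
by rewrite mulr_sumr; apply: ler_sum => t _; rewrite -mulr_suml ler_wpM2r ?sqr_ge0.
Qed.

Lemma schur_sqr u : \sum_(t < m) k t u ^+ 2 <= L ^+ 2 * s * r u.
Proof.
apply: (@le_trans _ _ ((L * r u) * \sum_(t < m) k t u)).
  rewrite mulr_sumr; apply: ler_sum => t _.
  by rewrite expr2 ler_wpM2r// k_sym.
apply: (@le_trans _ _ ((L * r u) * (L * s))).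
  by rewrite ler_wpM2l ?mulr_ge0// (eq_bigr (fun t => k u t)).
rewrite le_eqVlt; apply/orP; left; apply/eqP; ring.
Qed.

(** Entry and row sum of the squared kernel at [u] are both at most [L ^ 2 * s * r u]. Keeping [r u]
    in place of [s] leaves a sum of [r u ^ 2] afterwards, which is bounded in the application. *)
Lemma schur_prod u :
  \sum_(w < m) (\sum_(t < m) k t u * k t w) ^+ 2 <= (L ^+ 2 * s * r u) ^+ 2.
Proof.
have Ls : 0 <= L * s by rewrite mulr_ge0.
have colu : \sum_(t < m) k t u <= L * r u by rewrite (eq_bigr (fun t => k u t)).
have B0 : 0 <= L ^+ 2 * s * r u by rewrite !mulr_ge0// exprn_ge0.
have g_le w : \sum_(t < m) k t u * k t w <= L ^+ 2 * s * r u.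
  apply: (@le_trans _ _ ((\sum_(t < m) k t u) * (L * s))).
    rewrite mulr_suml; apply: ler_sum => t _; rewrite ler_wpM2l//.
    by apply: le_trans (k_le t w) _; rewrite ler_wpM2l.
  apply: le_trans (ler_wpM2r Ls colu) _.
  rewrite le_eqVlt; apply/orP; left; apply/eqP; ring.
apply: (@le_trans _ _ ((L ^+ 2 * s * r u) * \sum_(w < m) \sum_(t < m) k t u * k t w)).
  rewrite mulr_sumr; apply: ler_sum => w _; rewrite expr2 ler_wpM2r//.
  by apply: sumr_ge0 => t _; rewrite mulr_ge0.
rewrite expr2 ler_wpM2l// exchange_big/=.
apply: (@le_trans _ _ ((\sum_(t < m) k t u) * (L * s))).
  by rewrite mulr_suml; apply: ler_sum => t _; rewrite -mulr_sumr ler_wpM2l.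
apply: le_trans (ler_wpM2r Ls colu) _.
rewrite le_eqVlt; apply/orP; left; apply/eqP; ring.
Qed.

End schur_test.

(** * Second moment of the fluctuation *)

Section conditional_variance_bound.
Context {d : measure_display} {T : measurableType d} {R : realType}.
Variable P : probability T R.
Local Notation integ f := (P.-integrable setT (EFin \o f)).
Local Notation Ex f := (Rintegral P setT f).

Variables (F : set (set T)) (G : nat -> set (set T)) (m : nat).
Variables (X sig kap chi : 'I_m -> T -> R) (K : R).
Hypothesis cm : cond_moments P F G X sig kap chi K.

Hypothesis K_ge0 : 0 <= K.

Lemma qf_var0_le C D e t y : qf_var0 sig kap chi C D e t y <=
  2 * K * (C t y ^+ 2 + D t y ^+ 2) + K ^+ 2 * \sum_(u < m | (u < t)%N) e t u y ^+ 2.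
Proof.
have /andP[s0 sK] := cm_sig cm t y; have /andP[c0 cK] := cm_chi cm t y.
have kK := cm_kap cm t y.
have h1 : sig t y * \sum_(u < m | (u < t)%N) e t u y ^+ 2 * sig u y <=
    K ^+ 2 * \sum_(u < m | (u < t)%N) e t u y ^+ 2.
  rewrite expr2 -mulrA; apply: ler_pM => //.
    by apply: sumr_ge0 => u _; rewrite mulr_ge0 ?sqr_ge0//; case/andP: (cm_sig cm u y).
  rewrite mulr_sumr; apply: ler_sum => u _; rewrite mulrC ler_wpM2r ?sqr_ge0//.
  by case/andP: (cm_sig cm u y).
have h2 : 2 * kap t y * D t y * C t y <= K * (C t y ^+ 2 + D t y ^+ 2).
  have -> : 2 * kap t y * D t y * C t y = kap t y * (2 * (D t y * C t y)) by ring.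
  apply: le_trans (ler_norm _) _; rewrite normrM; apply: ler_pM => //.
  rewrite ler_norml; have := sqr_ge0 (C t y - D t y); have := sqr_ge0 (C t y + D t y).
  by rewrite sqrrB sqrrD => ? ?; apply/andP; split; lra.
have h3 : (chi t y - sig t y ^+ 2) * D t y ^+ 2 <= K * D t y ^+ 2.
  by rewrite ler_wpM2r ?sqr_ge0//; have := sqr_ge0 (sig t y); lra.
have h4 : sig t y * C t y ^+ 2 <= K * C t y ^+ 2 by rewrite ler_wpM2r ?sqr_ge0.
by rewrite /qf_var0 mulrDr; lra.
Qed.

(** Sum of the constants for the linear, the diagonal and the off-diagonal coefficients. *)
Definition varC (L : R) : R := 2 * K * L ^+ 2 + 2 * K * (K * L ^+ 2) ^+ 2 +
  K ^+ 2 * (2 * K * L ^+ 2) ^+ 2.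

Variables (C D : 'I_m -> T -> R) (e : 'I_m -> 'I_m -> T -> R).

(** The three Schur estimates handle [qf_C2], [qf_D2] and [qf_e2] in turn. Each gains a factor
    [s ^ 2], later the small ratio [max_rel2]. *)
Lemma qf_var02_le (k : 'I_m -> 'I_m -> R) (r : 'I_m -> R) (L s : R) y :
  (forall t u, 0 <= k t u) -> (forall t u, k t u = k u t) ->
  (forall t, \sum_(u < m) k t u <= L * r t) -> 0 <= L -> 0 <= s ->
  (forall t, 0 <= r t) -> (forall t, r t <= s) ->
  (forall t u, `|e t u y| <= k t u) ->
  \sum_(t < m) qf_var0 sig kap chi (qf_C2 sig kap C D e) (qf_D2 sig e)
    (qf_e2 sig e) t y <=
  varC L * s ^+ 2 * (\sum_(t < m) qf_mix sig kap C D t y ^+ 2 + \sum_(t < m) r t ^+ 2).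
Proof.
move=> k0 ks kr L0 s_ge0 r0 rs ek.
have mk t u : `|qf_mask e t u y| <= k t u.
  by rewrite /qf_mask; case: ifP; rewrite ?normr0.
have sg t : 0 <= sig t y <= K := cm_sig cm t y.
have B1 : \sum_(u < m) qf_C2 sig kap C D e u y ^+ 2 <=
    (L * s) ^+ 2 * \sum_(t < m) qf_mix sig kap C D t y ^+ 2.
  have := schur_linear k0 ks kr L0 rs s_ge0 (fun t => `|qf_mix sig kap C D t y|).
  have -> : \sum_(t < m) `|qf_mix sig kap C D t y| ^+ 2 =
      \sum_(t < m) qf_mix sig kap C D t y ^+ 2.
    by apply: eq_bigr => t _; rewrite real_normK ?num_real.
  apply: le_trans; apply: ler_sum => u _.
  rewrite -(real_normK (num_real (qf_C2 _ _ _ _ _ _ _))) lerXn2r ?nnegrE//.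
    by apply: sumr_ge0 => t _; rewrite mulr_ge0.
  apply: le_trans (ler_norm_sum _ _ _) _; apply: ler_sum => t _.
  by rewrite normrM mulrC ler_wpM2r.
have B2 : \sum_(u < m) qf_D2 sig e u y ^+ 2 <=
    (K * L ^+ 2) ^+ 2 * s ^+ 2 * \sum_(t < m) r t ^+ 2.
  rewrite mulr_sumr; apply: ler_sum => u _.
  rewrite -!exprMn lerXn2r ?nnegrE//.
  - by apply: sumr_ge0 => t _; rewrite mulr_ge0 ?sqr_ge0//; case/andP: (sg t).
  - by rewrite !mulr_ge0 ?exprn_ge0 ?K_ge0 ?s_ge0.
  have -> : K * L ^+ 2 * s * r u = K * (L ^+ 2 * s * r u) by ring.
  apply: le_trans _ (ler_wpM2l K_ge0 (schur_sqr k0 ks kr L0 r0 rs u)).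
  rewrite mulr_sumr; apply: ler_sum => t _; have /andP[? ?] := sg t.
  apply: ler_pM; rewrite ?sqr_ge0// -(real_normK (num_real (qf_mask _ _ _ _))).
  by rewrite lerXn2r ?nnegrE.
have B3 : \sum_(u < m) \sum_(w < m | (w < u)%N) qf_e2 sig e u w y ^+ 2 <=
    (2 * K * L ^+ 2) ^+ 2 * s ^+ 2 * \sum_(t < m) r t ^+ 2.
  rewrite mulr_sumr; apply: ler_sum => u _.
  apply: (@le_trans _ _ ((2 * K) ^+ 2 * (L ^+ 2 * s * r u) ^+ 2)); last first.
    by rewrite -!exprMn !mulrA.
  apply: le_trans _ (ler_wpM2l (sqr_ge0 (2 * K)) (schur_prod k0 ks kr L0 r0 rs s_ge0 u)).
  rewrite mulr_sumr big_mkcond; apply: ler_sum => w _.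
  case: ifP => _; last by rewrite mulr_ge0 ?sqr_ge0.
  rewrite -(real_normK (num_real (qf_e2 _ _ _ _ _))) -exprMn lerXn2r ?nnegrE//.
    rewrite !mulr_ge0 ?K_ge0//.
    by apply: sumr_ge0 => t _; rewrite mulr_ge0.
  apply: le_trans (ler_norm_sum _ _ _) _; rewrite mulr_sumr; apply: ler_sum => t _.
  have /andP[s0 sK] := sg t.
  rewrite !normrM; apply: ler_pM; rewrite ?mulr_ge0//.
    by rewrite !ger0_norm// ler_wpM2l.
  by apply: ler_pM.
apply: (@le_trans _ _ (\sum_(t < m) (2 * K * (qf_C2 sig kap C D e t y ^+ 2 +
    qf_D2 sig e t y ^+ 2) + K ^+ 2 * \sum_(u < m | (u < t)%N) qf_e2 sig e t u y ^+ 2))).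
  by apply: ler_sum => t _; exact: qf_var0_le.
rewrite big_split/= -!mulr_sumr big_split/=.
have c0 : 0 <= \sum_(t < m) qf_mix sig kap C D t y ^+ 2.
  by apply: sumr_ge0 => t _; exact: sqr_ge0.
have r20 : 0 <= \sum_(t < m) r t ^+ 2 by apply: sumr_ge0 => t _; exact: sqr_ge0.
have K2 : 0 <= 2 * K by rewrite mulr_ge0.
apply: le_trans (lerD (ler_wpM2l K2 (lerD B1 B2)) (ler_wpM2l (sqr_ge0 K) B3)) _.
set c2 := \sum_(t < m) _ in c0 *; set r2 := \sum_(t < m) _ in r20 *.
rewrite -subr_ge0.
have -> : varC L * s ^+ 2 * (c2 + r2) - (2 * K * ((L * s) ^+ 2 * c2 +
   (K * L ^+ 2) ^+ 2 * s ^+ 2 * r2) + K ^+ 2 * ((2 * K * L ^+ 2) ^+ 2 * s ^+ 2 * r2)) =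
   s ^+ 2 * ((2 * K * (K * L ^+ 2) ^+ 2 + K ^+ 2 * (2 * K * L ^+ 2) ^+ 2) * c2 +
   2 * K * L ^+ 2 * r2) by rewrite /varC; ring.
by rewrite !(mulr_ge0, addr_ge0) ?sqr_ge0 ?exprn_ge0.
Qed.

End conditional_variance_bound.

(** * Shift-share designs *)

Section nonnegative_version.
Context {d : measure_display} {T : measurableType d} {R : realType}.
Variable P : probability T R.
Implicit Types (f g : T -> R) (G : set (set T)).
Local Notation integ f := (P.-integrable setT (EFin \o f)).
Local Notation Ex f := (Rintegral P setT f).

Lemma cond_version_ge0 G f (K : R) : subsig G -> integ f -> (forall y, 0 <= f y) ->
  (forall A, G A -> Ex (fun x => f x * \1_A x) <= K * Ex (\1_A)) ->
  exists m, [/\ gmeas G m, (forall x, 0 <= m x <= K) &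
    orth P G (fun x => f x - m x)].
Proof.
move=> sG fi f0 fK.
have fA0 A : 0 <= Ex (fun x => f x * \1_A x).
  by apply: Ex_ge0 => x; rewrite mulr_ge0// indicE.
have K0 : 0 <= K.
  have := fK setT (subsigT sG); rewrite Ex_indic// probability_setT/= mulr1.
  exact: le_trans.
have [m [gm mK o]] : exists m, [/\ gmeas G m, (forall x, `|m x| <= K) &
    orth P G (fun x => f x - m x)].
  by apply: cond_version => // A GA; rewrite ger0_norm// fK.
have mi : integ m.
  by apply: integ_ext (integB fi o.1) => x; rewrite opprB addrCA subrr addr0.
have m0 := orth_ge0 sG f0 fi gm mi o.
exists (fun x => Num.max 0 (m x)); split.
- by apply: gmeas_max => //; exact: gmeas_cst.
- move=> x; rewrite le_max lexx/= ge_max K0/=.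
  exact: le_trans (ler_norm _) (mK x).
- apply: orth_ae o _ _ => //.
    apply: measurable_funB; first exact: integ_meas fi.
    by apply: measurable_maxr => //; exact: integ_meas mi.
  by apply: filterS m0 => x h; rewrite (max_idPr h).
Qed.

Lemma condexp_bounded_moment G f (C : R) : subsig G -> condexp_bounded P G f C ->
  (forall x, 0 <= f x) -> cond_le P G f `|C|.
Proof.
move=> sG fC f0 g gg g0 gi; have [fi _] := fC.
have [m [gm mC o]] := cond_version_ge0 sG fi f0 (condexp_boundedP sG fC).
have [h1 h2] := cond_bound sG fi f0 mC o gm gg g0 gi.
split=> //; apply: le_trans h2 _; rewrite ler_wpM2r ?ler_norm//; exact: Ex_ge0.
Qed.

End nonnegative_version.

Section power_bounds.
Context {R : realType}.

Lemma pow4_powR (nu z : R) : 0 <= nu -> `|z| ^+ 4 <= 1 + `|z| `^ (4 + nu).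
Proof.
move=> nu0; have [z1|z1] := leP `|z| 1.
  by rewrite (le_trans (exprn_ile1 _ _ _))// lerDl powR_ge0.
rewrite -powR_mulrn// (le_trans (_ : _ <= `|z| `^ (4 + nu)))//; last first.
  by rewrite lerDr.
by apply: ler_powR; [exact: ltW|rewrite lerDl].
Qed.

Lemma pow_powR (nu z : R) j : 0 <= nu -> (j <= 4)%N ->
  `|z| ^+ j <= 2 + `|z| `^ (4 + nu).
Proof.
move=> nu0 j4; have h := pow4_powR z nu0; have [z1|z1] := leP `|z| 1.
  have := exprn_ile1 j (normr_ge0 z) z1; have := powR_ge0 `|z| (4 + nu); lra.
have : `|z| ^+ j <= `|z| ^+ 4 by apply: ler_weXn2l => //; exact: ltW.
lra.
Qed.

End power_bounds.

(** * Sigma-algebras of a design and conditional moments of the shifters *)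

Section design_sigma_algebras.
Context {d : measure_display} {T : measurableType d} {R : realType}.
Context {P : probability T R} {n m : nat}.
Variable A : design P n m.
Local Notation integ f := (P.-integrable setT (EFin \o f)).
Local Notation Ex f := (Rintegral P setT f).

Lemma preimage_class_measurable (f : {RV P >-> R}) :
  g_sigma_algebra_preimage f `<=` measurable.
Proof.
move=> _ [B mB <-]; rewrite setTI -[X in measurable X]setTI; exact: measurable_funPT.
Qed.

Lemma sigma_W_subsig : subsig (sigma_W A).
Proof. by apply: subsig_gen => E [k _]; exact: preimage_class_measurable. Qed.

Lemma sigma_F0_subsig : subsig (sigma_F0 A).
Proof.
apply: subsig_gen => E [[|]|] [k _]; exact: preimage_class_measurable.
Qed.

Lemma sigma_W_sub_F0 : sigma_W A `<=` sigma_F0 A.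
Proof.
apply: smallest_sub; first exact: smallest_sigma_algebra.
by move=> E h; apply: sub_gen_smallest; right.
Qed.

Lemma gmeas_share_W i s : gmeas (sigma_W A) (share A i s).
Proof.
move=> B mB; apply: sub_gen_smallest; exists (i, s) => //.
by exists B => //; rewrite setTI.
Qed.

Lemma gmeas_share i s : gmeas (sigma_F0 A) (share A i s).
Proof. exact: gmeas_sub sigma_W_sub_F0 (gmeas_share_W i s). Qed.

Lemma gmeas_outcome0 i : gmeas (sigma_F0 A) (outcome0 A i).
Proof.
move=> B mB; apply: sub_gen_smallest; left; left; exists i => //.
by exists B => //; rewrite setTI.
Qed.

Lemma gmeas_effect i s : gmeas (sigma_F0 A) (effect A i s).
Proof.
move=> B mB; apply: sub_gen_smallest; left; right; exists (i, s) => //.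
by exists B => //; rewrite setTI.
Qed.

Variables (nu C : R).
Hypothesis nu_ge0 : 0 <= nu.
Hypothesis mean0 : forall s,
  {ae P, forall x, condexp P (sigma_F0 A) (shifter A s) x = 0}.
Hypothesis indep : cond_independent (sigma_F0 A) (shifter A).
Hypothesis moment : forall s, condexp_bounded P (sigma_F0 A)
  (fun x => `|shifter A s x| `^ (4 + nu)) C.

Let X s : T -> R := shifter A s.
Let sF := sigma_F0_subsig.
(** Every power up to the fourth is at most 2 plus the power [4 + nu], so one constant serves all
    conditional moments. *)
Let K := 2 + `|C|.

Let mX s : measurable_fun setT (X s).
Proof. exact: measurable_funPT. Qed.

Let h s x := `|X s x| `^ (4 + nu).

Let hi s : integ (h s).
Proof. exact: (moment s).1. Qed.

Let pow_integ s j : (j <= 4)%N -> integ (fun x => X s x ^+ j).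
Proof.
move=> j4; apply: (integ_le _ (integD (integ_cst P 2) (hi s))).
  exact: measurable_funX.
by move=> x; rewrite normrX; exact: pow_powR.
Qed.

Let pow_bound s j E : (j <= 4)%N -> sigma_F0 A E ->
  `|Ex (fun x => X s x ^+ j * \1_E x)| <= K * Ex (\1_E).
Proof.
move=> j4 FE; have mE := sF.2 _ FE.
have iE : integ (\1_E : T -> R).
  by apply: integ_bnd (norm_indic E); exact: measurable_indic.
apply: (@le_trans _ _ (Ex (fun x => 2 * \1_E x + h s x * \1_E x))).
  apply: Ex_norm_le; first by apply: integ_indicM => //; exact: pow_integ.
    by apply: integD; [exact: integZ|exact: integ_indicM].
  move=> x; rewrite normrM normrX -mulrDl (ger0_norm (_ : 0 <= \1_E x)) ?indicE//.
  by rewrite ler_wpM2r// pow_powR.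
rewrite ExD; [|exact: integZ|exact: integ_indicM].
rewrite ExZ// [leRHS]mulrDl lerD2l; apply: le_trans (condexp_boundedP sF (moment s) FE) _.
rewrite ler_wpM2r ?ler_norm//; apply: Ex_ge0 => x; by rewrite indicE.
Qed.

Lemma shifter_moments : exists sig kap chi,
  cond_moments P (sigma_F0 A) (filt (sigma_F0 A) (shifter A)) X sig kap chi K.
Proof.
have even (j : nat) : (j <= 4)%N -> ~~ odd j -> forall s, exists v : T -> R,
    [/\ gmeas (sigma_F0 A) v, (forall x, 0 <= v x <= K) &
      orth P (sigma_F0 A) (fun x => X s x ^+ j - v x)].
  move=> j4 oj s; apply: cond_version_ge0 => //; first exact: pow_integ.
    by move=> x; rewrite exprn_even_ge0.
  by move=> E FE; apply: le_trans (pow_bound s j4 FE); exact: ler_norm.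
have /choice[sig sigP] := even 2%N isT isT.
have /choice[chi chiP] := even 4%N isT isT.
have /choice[kap kapP] : forall s, exists v : T -> R,
    [/\ gmeas (sigma_F0 A) v, (forall x, `|v x| <= K) &
      orth P (sigma_F0 A) (fun x => X s x ^+ 3 - v x)].
  move=> s; apply: cond_version => //; first exact: pow_integ.
  by move=> E FE; exact: pow_bound.
have X1 s : integ (X s) by apply: integ_ext (pow_integ s (isT : (1 <= 4)%N)).
have o1 s : orth P (sigma_F0 A) (X s).
  apply: orth_ae (condexp_orth sF (X1 s)) _ _ => //.
  by apply: filterS (mean0 s) => x ->; rewrite subr0.
(* Versions are chosen given [F_0] alone; conditional independence carries them over to the enlarged
   sigma-algebras. *)
have lift (s : 'I_m) (f : R -> R) (v : T -> R) : measurable_fun setT f ->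
    gmeas (sigma_F0 A) v -> (forall x, `|v x| <= K) -> integ (fun x => f (X s x)) ->
    orth P (sigma_F0 A) (fun x => f (X s x) - v x) ->
    orth P (filt (sigma_F0 A) (shifter A) s) (fun x => f (X s x) - v x).
  move=> mf gv vK fi o; exact: (orth_filt sF indep mf fi gv vK o).
have K0 : 0 <= K by rewrite addr_ge0.
exists sig, kap, chi; split.
- exact: sF.
- exact: filt_subsig.
- exact: filt_sub.
- exact: filt_le.
- exact: gmeas_filt.
- by move=> s; split; [exact: mX|exact: pow_integ].
- by move=> s; case: (sigP s).
- by move=> s; case: (kapP s).
- by move=> s; case: (chiP s).
- by move=> s; case: (sigP s).
- by move=> s; case: (kapP s).
- by move=> s; case: (chiP s).
- move=> s; apply: (@orth_ext _ _ _ _ _ (fun x => X s x - 0)) => [x|]; first exact: subr0.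
  apply: (lift s id (fun=> 0)) => //; first exact: gmeas_cst.
    by move=> x; rewrite normr0.
  by apply: orth_ext (o1 s) => x; rewrite subr0.
- move=> s; have [g1 g2 g3] := sigP s.
  apply: (lift s (fun z => z ^+ 2)) => //.
    by move=> x; have /andP[? ?] := g2 x; rewrite ger0_norm.
  exact: pow_integ.
- move=> s; have [g1 g2 g3] := kapP s.
  by apply: (lift s (fun z => z ^+ 3)) => //; exact: pow_integ.
- move=> s; have [g1 g2 g3] := chiP s.
  apply: (lift s (fun z => z ^+ 4)) => //.
    by move=> x; have /andP[? ?] := g2 x; rewrite ger0_norm.
  exact: pow_integ.
Qed.

End design_sigma_algebras.

(** Cauchy-Schwarz twice; weights of total mass at most 1 suffice, which covers sectors of size
    0. *)
Lemma jensen4 {R : realFieldType} (I : finType) (v z : I -> R) :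
  (forall i, 0 <= v i) -> \sum_i v i <= 1 ->
  (\sum_i v i * z i) ^+ 4 <= \sum_i v i * z i ^+ 4.
Proof.
move=> v0 v1.
have sq (a : I -> R) : (\sum_i v i * a i) ^+ 2 <= \sum_i v i * a i ^+ 2.
  apply: le_trans (weighted_sqr_sum a v0) _; rewrite ler_piMl//.
  by apply: sumr_ge0 => i _; rewrite mulr_ge0 ?sqr_ge0.
rewrite (exprM _ 2 2); apply: (@le_trans _ _ ((\sum_i v i * z i ^+ 2) ^+ 2)).
  rewrite lerXn2r ?nnegrE ?sqr_ge0//; apply: sumr_ge0 => i _.
  by rewrite mulr_ge0 ?sqr_ge0.
apply: le_trans (sq _) _; apply: ler_sum => i _.
by rewrite -exprM.
Qed.

Lemma gmeas_bigmax {d : measure_display} {T : measurableType d} {R : realType}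
    (G : set (set T)) I (s : seq I) (F : I -> T -> R) : subsig G ->
  (forall i, gmeas G (F i)) -> gmeas G (fun x => \big[Num.max/0]_(i <- s) F i x).
Proof.
move=> sG gF; elim: s => [|i s IH].
  by apply: gmeas_ext (gmeas_cst sG 0) => x; rewrite big_nil.
by apply: gmeas_ext (gmeas_max sG (gF i) IH) => x; rewrite big_cons.
Qed.

(** Any quadratic form splits into a centred one and its conditional mean, which sits on the
    diagonal. *)
Lemma quad_formE {d : measure_display} {T : measurableType d} {R : realType} m (X sig C : 'I_m -> T -> R)
    (f : 'I_m -> 'I_m -> T -> R) y :
  \sum_(s < m) X s y * C s y + \sum_(s < m) \sum_(t < m) X s y * X t y * f s t y =
  qf_form X sig C (fun s => f s s) (fun s t y => f s t y + f t s y) y +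
  \sum_(s < m) sig s y * f s s y.
Proof.
rewrite /qf_form sum_sym addrA -!big_split/=; apply: eq_bigr => s _.
rewrite /qf_inc /qf_lin mulrDr mulr_sumr.
have -> : \sum_(t < m | (t < s)%N) (X s y * X t y * f s t y + X t y * X s y * f t s y) =
    \sum_(t < m | (t < s)%N) X s y * ((f s t y + f t s y) * X t y).
  by apply: eq_bigr => t _; ring.
ring.
Qed.

(** * Sector sizes and overlaps of sectors *)

Section design_weights.
Context {d : measure_display} {T : measurableType d} {R : realType}.
Context {P : probability T R} {n m : nat}.
Variable A : design P n m.
Hypothesis share_ge0 : forall i s x, 0 <= share A i s x.
Hypothesis share_le1 : forall i x, \sum_(s < m) share A i s x <= 1.

Definition root_size2 x : R := Num.sqrt (sum_size2 A x).
Definition rel_size s x : R := (root_size2 x)^-1 * sector_size A s x.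
Definition overlap s t x : R := \sum_(i < n) share A i s x * share A i t x.
Definition max_rel2 x : R := max_size2 A x / sum_size2 A x.

Lemma share_le_1 i s x : share A i s x <= 1.
Proof.
by apply: le_trans (share_le1 i x); rewrite (bigD1 s)//= lerDl sumr_ge0.
Qed.

Lemma sector_size_ge0 s x : 0 <= sector_size A s x.
Proof. exact: sumr_ge0. Qed.

Lemma share_le_size i s x : share A i s x <= sector_size A s x.
Proof. by rewrite /sector_size (bigD1 i)//= lerDl sumr_ge0. Qed.

Lemma sum_size2_ge0 x : 0 <= sum_size2 A x.
Proof. by apply: sumr_ge0 => s _; exact: sqr_ge0. Qed.

Lemma root_size2_ge0 x : 0 <= (root_size2 x)^-1.
Proof. by rewrite invr_ge0 sqrtr_ge0. Qed.

Lemma root_size2_sqr x : (root_size2 x)^-1 ^+ 2 = (sum_size2 A x)^-1.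
Proof. by rewrite exprVn sqr_sqrtr// sum_size2_ge0. Qed.

Lemma rel_size_ge0 s x : 0 <= rel_size s x.
Proof. by rewrite mulr_ge0 ?root_size2_ge0 ?sector_size_ge0. Qed.

Lemma rel_size_sqr s x : rel_size s x ^+ 2 = sector_size A s x ^+ 2 / sum_size2 A x.
Proof. by rewrite exprMn root_size2_sqr mulrC. Qed.

Lemma sum_rel_size x : \sum_(s < m) rel_size s x ^+ 2 <= 1.
Proof.
rewrite (eq_bigr _ (fun s _ => rel_size_sqr s x)) -mulr_suml -/(sum_size2 A x).
by have [->|h] := eqVneq (sum_size2 A x) 0; rewrite ?mul0r// divff.
Qed.

Lemma max_size2_ge s x : sector_size A s x ^+ 2 <= max_size2 A x.
Proof. exact: (le_bigmax _ (fun s => sector_size A s x ^+ 2)). Qed.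

Lemma max_size2_le x : max_size2 A x <= sum_size2 A x.
Proof.
apply/bigmax_leP; split=> [|s _]; first exact: sum_size2_ge0.
by rewrite /sum_size2 (bigD1 s)//= lerDl sumr_ge0// => t _; exact: sqr_ge0.
Qed.

Lemma max_size2_ge0 x : 0 <= max_size2 A x.
Proof. by rewrite /max_size2; elim/big_ind: _ => [//|a b a0 b0|s _]; rewrite ?le_max ?a0 ?sqr_ge0. Qed.

Lemma rel_size_le_max s x : rel_size s x ^+ 2 <= max_rel2 x.
Proof.
by rewrite rel_size_sqr ler_wpM2r ?invr_ge0 ?sum_size2_ge0 ?max_size2_ge.
Qed.

Lemma max_rel2_ge0 x : 0 <= max_rel2 x.
Proof. by rewrite divr_ge0 ?max_size2_ge0 ?sum_size2_ge0. Qed.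

Lemma max_rel2_le1 x : max_rel2 x <= 1.
Proof.
rewrite /max_rel2; have [->|h] := eqVneq (sum_size2 A x) 0.
  by rewrite invr0 mulr0.
by rewrite ler_pdivrMr ?mul1r ?max_size2_le// lt0r h sum_size2_ge0.
Qed.

Lemma rel_size_le_root s x : rel_size s x <= Num.sqrt (max_rel2 x).
Proof.
rewrite -[leLHS]ger0_norm ?rel_size_ge0// -sqrtr_sqr.
exact/ler_wsqrtr/rel_size_le_max.
Qed.

Lemma rel_size_le1 s x : rel_size s x <= 1.
Proof.
apply: le_trans (rel_size_le_root s x) _.
by rewrite -[leRHS]sqrtr1 ler_wsqrtr ?max_rel2_le1.
Qed.

Lemma scaled_share_le1 i s x : 0 <= (root_size2 x)^-1 * share A i s x <= 1.
Proof.
rewrite mulr_ge0 ?root_size2_ge0//=; apply: le_trans (rel_size_le1 s x).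
by rewrite ler_wpM2l ?root_size2_ge0 ?share_le_size.
Qed.

Lemma overlap_ge0 s t x : 0 <= overlap s t x.
Proof. by apply: sumr_ge0 => i _; rewrite mulr_ge0. Qed.

Lemma overlap_sym s t x : overlap s t x = overlap t s x.
Proof. by apply: eq_bigr => i _; exact: mulrC. Qed.

(** Summing over [t] first leaves [share A i s] times the total share of region [i], which is at
    most 1. This is the row bound behind the Schur test. *)
Lemma sum_overlap s x : \sum_(t < m) overlap s t x <= sector_size A s x.
Proof.
rewrite exchange_big/=; apply: ler_sum => i _; rewrite -mulr_sumr.
by rewrite ler_piMr.
Qed.

Lemma gmeas_sector_size s : gmeas (sigma_W A) (sector_size A s).
Proof.
apply: gmeas_sum => [|i _]; [exact: sigma_W_subsig|exact: gmeas_share_W].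
Qed.

Lemma gmeas_sum_size2 : gmeas (sigma_W A) (sum_size2 A).
Proof.
have sW := sigma_W_subsig A.
by apply: gmeas_sum => // s _; apply: gmeasX => //; exact: gmeas_sector_size.
Qed.

Lemma gmeas_root_size2 : gmeas (sigma_W A) (fun x => (root_size2 x)^-1).
Proof.
have sW := sigma_W_subsig A; apply: gmeasV => //.
apply: (gmeas_comp (k := Num.sqrt)); last exact: gmeas_sum_size2.
by apply: continuous_measurable_fun; exact: sqrt_continuous.
Qed.

Lemma gmeas_rel_size s : gmeas (sigma_W A) (rel_size s).
Proof.
have sW := sigma_W_subsig A.
by apply: gmeasM => //; [exact: gmeas_root_size2|exact: gmeas_sector_size].
Qed.

Lemma gmeas_max_rel2 : gmeas (sigma_W A) max_rel2.
Proof.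
have sW := sigma_W_subsig A; apply: gmeasM => //.
  by apply: gmeas_bigmax => // s; apply: gmeasX => //; exact: gmeas_sector_size.
by apply: gmeasV => //; exact: gmeas_sum_size2.
Qed.

Lemma gmeas_overlap s t : gmeas (sigma_W A) (overlap s t).
Proof.
have sW := sigma_W_subsig A.
by apply: gmeas_sum => // i _; apply: gmeasM => //; exact: gmeas_share_W.
Qed.

End design_weights.

(** * The score as a quadratic form in the shifters *)

Section design_forms.
Context {d : measure_display} {T : measurableType d} {R : realType}.
Context {P : probability T R} {n m : nat}.
Variable A : design P n m.
Hypothesis share_ge0 : forall i s x, 0 <= share A i s x.
Hypothesis share_le1 : forall i x, \sum_(s < m) share A i s x <= 1.
Local Notation integ f := (P.-integrable setT (EFin \o f)).
Local Notation Ex f := (Rintegral P setT f).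
Local Notation F := (sigma_F0 A).
Local Notation G := (filt (sigma_F0 A) (shifter A)).
Local Notation X := (fun s => shifter A s : T -> R).

Variables (B K : R) (eff : 'I_n -> 'I_m -> T -> R) (sig kap chi : 'I_m -> T -> R).
Hypothesis B_ge0 : 0 <= B.
Hypothesis K_ge0 : 0 <= K.
Hypothesis eff_gmeas : forall i s, gmeas F (eff i s).
Hypothesis eff_bound : forall i s x, `|eff i s x| <= B.
Hypothesis cm : cond_moments P F G X sig kap chi K.
Hypothesis L4Y : forall i, L4 P (outcome0 A i).

Let sF : subsig F := sigma_F0_subsig A.
Let sW : subsig (sigma_W A) := sigma_W_subsig A.
Let WF (f : T -> R) : gmeas (sigma_W A) f -> gmeas F f.
Proof. by apply: gmeas_sub; exact: sigma_W_sub_F0. Qed.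
Let gsh i s : gmeas F (share A i s).
Proof. exact: gmeas_share. Qed.
Let sig0 s x : 0 <= sig s x. Proof. by case/andP: (cm_sig cm s x). Qed.

(** Denominator of [beta] written with the versions [sig] of the conditional variances, hence
    defined and nonnegative at every point. *)
Definition mean_den x : R := \sum_(i < n) \sum_(s < m) share A i s x ^+ 2 * sig s x.
Definition mean_num x : R :=
  \sum_(i < n) \sum_(s < m) share A i s x ^+ 2 * sig s x * eff i s x.
Definition mean_effect x : R := mean_num x / mean_den x.
Definition dev i s x : R := eff i s x - mean_effect x.
Definition base s x : R := \sum_(i < n) share A i s x * outcome0 A i x.
(** Coefficient of [X s * X t] in the score. It is not symmetric, as [dev] sees [t] only; the
    off-diagonal coefficient of the form is its symmetrisation. *)
Definition pair_dev s t x : R := \sum_(i < n) share A i s x * share A i t x * dev i t x.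

Lemma mean_den_ge0 x : 0 <= mean_den x.
Proof. by do 2!apply: sumr_ge0 => ? _; rewrite mulr_ge0 ?sqr_ge0. Qed.

Lemma mean_num_bound x : `|mean_num x| <= B * mean_den x.
Proof.
apply: le_trans (ler_norm_sum _ _ _) _; rewrite mulr_sumr; apply: ler_sum => i _.
apply: le_trans (ler_norm_sum _ _ _) _; rewrite mulr_sumr; apply: ler_sum => s _.
have h : 0 <= share A i s x ^+ 2 * sig s x by rewrite mulr_ge0 ?sqr_ge0.
by rewrite normrM mulrC (ger0_norm h) ler_wpM2r.
Qed.

Lemma mean_effect_bound x : `|mean_effect x| <= B.
Proof.
rewrite /mean_effect normrM; have [->|h] := eqVneq (mean_den x) 0.
  by rewrite invr0 normr0 mulr0.
have dp : 0 < mean_den x by rewrite lt0r h mean_den_ge0.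
by rewrite normfV (gtr0_norm dp) ler_pdivrMr// mean_num_bound.
Qed.

(** A vanishing denominator forces the numerator to vanish, so the identity survives division by
    0. *)
Lemma mean_effectE x : mean_num x = mean_effect x * mean_den x.
Proof.
rewrite /mean_effect; have [h|h] := eqVneq (mean_den x) 0; last by rewrite divfK.
by apply/eqP; have := mean_num_bound x; rewrite h !mulr0 normr_le0.
Qed.

Lemma mean_effect_gmeas : gmeas F mean_effect.
Proof.
have gs := cm_gsig cm.
apply: gmeasM => //; last apply: gmeasV => //.
  apply: gmeas_sum => // i _; apply: gmeas_sum => // s _.
  by apply: gmeasM => //; apply: gmeasM => //; exact: gmeasX.
apply: gmeas_sum => // i _; apply: gmeas_sum => // s _.
by apply: gmeasM => //; exact: gmeasX.
Qed.

Lemma dev_gmeas i s : gmeas F (dev i s).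
Proof. by apply: gmeasB => //; exact: mean_effect_gmeas. Qed.

Lemma dev_bound i s x : `|dev i s x| <= 2 * B.
Proof.
apply: le_trans (ler_normB _ _) _.
have := eff_bound i s x; have := mean_effect_bound x; lra.
Qed.

Lemma pair_dev_gmeas s t : gmeas F (pair_dev s t).
Proof.
apply: gmeas_sum => // i _; apply: gmeasM => //; last exact: dev_gmeas.
exact: gmeasM.
Qed.

Lemma pair_dev_bound s t x : `|pair_dev s t x| <= 2 * B * overlap A s t x.
Proof.
apply: le_trans (ler_norm_sum _ _ _) _; rewrite mulr_sumr; apply: ler_sum => i _.
by rewrite normrM mulrC (ger0_norm (mulr_ge0 _ _))// ler_wpM2r ?mulr_ge0// dev_bound.
Qed.

Lemma overlap_le_size s t x : overlap A s t x <= sector_size A s x.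
Proof.
apply: le_trans (sum_overlap share_ge0 share_le1 s x); rewrite (bigD1 t)//= lerDl.
by apply: sumr_ge0 => u _; exact: overlap_ge0.
Qed.

Definition base_rel s x : R := (root_size2 A x)^-1 * base s x.
Definition diag_rel s x : R := (root_size2 A x)^-1 * pair_dev s s x.
Definition off_rel s t x : R :=
  (root_size2 A x)^-1 * (pair_dev s t x + pair_dev t s x).
(** Symmetric kernel dominating [off_rel]: two terms [pair_dev], each at most [2 * B] times the
    overlap. *)
Definition overlap_rel s t x : R := 4 * B * ((root_size2 A x)^-1 * overlap A s t x).

Lemma off_rel_bound s t x : `|off_rel s t x| <= overlap_rel s t x.
Proof.
rewrite /off_rel /overlap_rel normrM (ger0_norm (root_size2_ge0 A x)) mulrCA.
rewrite ler_wpM2l ?root_size2_ge0//; apply: le_trans (ler_normD _ _) _.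
have := pair_dev_bound s t x; have := pair_dev_bound t s x.
by rewrite (overlap_sym A t s); lra.
Qed.

Lemma overlap_rel_ge0 s t x : 0 <= overlap_rel s t x.
Proof. by rewrite !mulr_ge0 ?root_size2_ge0 ?overlap_ge0. Qed.

Lemma overlap_rel_sym s t x : overlap_rel s t x = overlap_rel t s x.
Proof. by rewrite /overlap_rel overlap_sym. Qed.

Lemma sum_overlap_rel s x :
  \sum_(t < m) overlap_rel s t x <= 4 * B * rel_size A s x.
Proof.
rewrite -mulr_sumr ler_wpM2l ?mulr_ge0// -mulr_sumr ler_wpM2l ?root_size2_ge0//.
exact: sum_overlap.
Qed.

Lemma overlap_rel_le s t x : overlap_rel s t x <= 4 * B.
Proof.
apply: (@le_trans _ _ (4 * B * rel_size A s x)).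
  by rewrite ler_wpM2l ?mulr_ge0// ler_wpM2l ?root_size2_ge0// overlap_le_size.
by rewrite ler_piMr ?mulr_ge0// rel_size_le1.
Qed.

Lemma diag_rel_bound s x : `|diag_rel s x| <= 2 * B * rel_size A s x.
Proof.
rewrite normrM (ger0_norm (root_size2_ge0 A x)) /rel_size mulrCA.
rewrite ler_wpM2l ?root_size2_ge0//; apply: le_trans (pair_dev_bound s s x) _.
by rewrite ler_wpM2l ?mulr_ge0// overlap_le_size.
Qed.

Lemma base_coefs : coefs P F base (fun s => pair_dev s s)
  (fun s t x => pair_dev s t x + pair_dev t s x).
Proof.
(* A bound growing with [n] is harmless here: [coefs] asks for boundedness within one design. *)
have pb s t x : `|pair_dev s t x| <= 2 * B * n%:R.
  apply: le_trans (pair_dev_bound s t x) _; rewrite ler_wpM2l ?mulr_ge0//.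
  apply: le_trans (overlap_le_size s t x) _.
  apply: (@le_trans _ _ (\sum_(i < n) 1)); last by rewrite sumr_const card_ord.
  by apply: ler_sum => i _; exact: share_le_1.
split.
- move=> s; apply: gmeas_sum => // i _; apply: gmeasM => //.
  exact: gmeas_outcome0.
- move=> s; apply: L4_sum => i _.
  apply: (L4_ext (f := fun x => outcome0 A i x * share A i s x)) => [x|].
    exact: mulrC.
  apply: (L4M_bnd (M := 1)) => // x; rewrite ger0_norm//; exact: share_le_1.
- by move=> s; exact: pair_dev_gmeas.
- by exists (2 * B * n%:R) => s x; exact: pb.
- by move=> s t; apply: gmeasD => //; exact: pair_dev_gmeas.
- exists (2 * B * n%:R + 2 * B * n%:R) => s t x.
  by apply: le_trans (ler_normD _ _) _; exact: lerD.
Qed.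

Lemma rel_coefs : coefs P F base_rel diag_rel off_rel.
Proof.
have gr : gmeas F (fun x => (root_size2 A x)^-1) by apply: WF; exact: gmeas_root_size2.
have bc := base_coefs.
split.
- by move=> s; apply: gmeasM => //; exact: cf_gC bc s.
- move=> s; apply: (L4_ext (f := fun x => \sum_(i < n) outcome0 A i x *
    ((root_size2 A x)^-1 * share A i s x))) => [x|].
    by rewrite /base_rel /base mulr_sumr; apply: eq_bigr => i _; ring.
  apply: L4_sum => i _; apply: (L4M_bnd (M := 1)) => // [|x].
    by apply: (gmeas_meas sF); exact: gmeasM.
  by have /andP[h1 h2] := scaled_share_le1 share_ge0 i s x; rewrite ger0_norm.
- by move=> s; apply: gmeasM => //; exact: pair_dev_gmeas.
- exists (2 * B) => s x; apply: le_trans (diag_rel_bound s x) _.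
  by rewrite ler_piMr ?mulr_ge0// rel_size_le1.
- move=> s t; apply: gmeasM => //; apply: gmeasD => //; exact: pair_dev_gmeas.
- exists (4 * B) => s t x.
  exact: le_trans (off_rel_bound s t x) (overlap_rel_le s t x).
Qed.

Lemma qf_inc_rel t x : qf_inc X sig base_rel diag_rel off_rel t x =
  (root_size2 A x)^-1 * qf_inc X sig base (fun s => pair_dev s s)
    (fun s t x => pair_dev s t x + pair_dev t s x) t x.
Proof.
rewrite /qf_inc /qf_lin /base_rel /diag_rel.
have -> : \sum_(u < m | (u < t)%N) off_rel t u x * shifter A u x =
    (root_size2 A x)^-1 * \sum_(u < m | (u < t)%N)
      (pair_dev t u x + pair_dev u t x) * shifter A u x.
  by rewrite mulr_sumr; apply: eq_bigr => u _; rewrite /off_rel mulrA.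
ring.
Qed.

Lemma qf_form_rel x : qf_form X sig base_rel diag_rel off_rel x =
  (root_size2 A x)^-1 * qf_form X sig base (fun s => pair_dev s s)
    (fun s t x => pair_dev s t x + pair_dev t s x) x.
Proof. by rewrite /qf_form mulr_sumr; apply: eq_bigr => t _; exact: qf_inc_rel. Qed.

Lemma qf_var0_rel t x : qf_var0 sig kap chi base_rel diag_rel off_rel t x =
  (root_size2 A x)^-1 ^+ 2 * qf_var0 sig kap chi base (fun s => pair_dev s s)
    (fun s t x => pair_dev s t x + pair_dev t s x) t x.
Proof.
rewrite /qf_var0 /base_rel /diag_rel.
have -> : \sum_(u < m | (u < t)%N) off_rel t u x ^+ 2 * sig u x =
    (root_size2 A x)^-1 ^+ 2 * \sum_(u < m | (u < t)%N)
      (pair_dev t u x + pair_dev u t x) ^+ 2 * sig u x.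
  by rewrite mulr_sumr; apply: eq_bigr => u _; rewrite /off_rel; ring.
ring.
Qed.

Lemma score_form x :
  \sum_(i < n) exposure A i x * (outcome0 A i x +
    \sum_(s < m) share A i s x * shifter A s x * eff i s x -
    exposure A i x * mean_effect x) =
  qf_form X sig base (fun s => pair_dev s s)
    (fun s t x => pair_dev s t x + pair_dev t s x) x.
Proof.
(* The conditional mean of the form is 0 exactly because the effects are centred at their weighted
   mean. *)
have z : \sum_(s < m) sig s x * pair_dev s s x = 0.
  transitivity (mean_num x - mean_effect x * mean_den x); last first.
    by rewrite mean_effectE subrr.
  rewrite /mean_num /mean_den mulr_sumr -sumrB.
  under eq_bigr do rewrite mulr_sumr; rewrite exchange_big/=.
  apply: eq_bigr => i _; rewrite mulr_sumr -sumrB; apply: eq_bigr => s _.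
  by rewrite /dev; ring.
have := quad_formE (fun s => shifter A s : T -> R) sig base pair_dev x.
rewrite z addr0 => <-.
transitivity (\sum_(i < n) (\sum_(s < m) shifter A s x * (share A i s x * outcome0 A i x) +
  \sum_(s < m) \sum_(t < m) shifter A s x * shifter A t x *
    (share A i s x * share A i t x * dev i t x))).
  apply: eq_bigr => i _.
  have -> : outcome0 A i x + \sum_(s < m) share A i s x * shifter A s x * eff i s x -
      exposure A i x * mean_effect x =
      outcome0 A i x + \sum_(s < m) share A i s x * shifter A s x * dev i s x.
    rewrite -addrA; congr (_ + _); rewrite /exposure mulr_suml -sumrB.
    by apply: eq_bigr => s _; rewrite /dev; ring.
  rewrite mulrDr /exposure !mulr_suml; congr (_ + _); apply: eq_bigr => s _.
    by ring.
  by rewrite mulr_sumr; apply: eq_bigr => t _; ring.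
rewrite big_split/= exchange_big/=; congr (_ + _).
  by apply: eq_bigr => s _; rewrite mulr_sumr.
rewrite exchange_big/=; apply: eq_bigr => s _; rewrite exchange_big/=.
by apply: eq_bigr => t _; rewrite mulr_sumr.
Qed.

End design_forms.

(** * Fourth moments of share-weighted outcomes *)

Section weighted_outcomes.
Context {d : measure_display} {T : measurableType d} {R : realType}.
Context {P : probability T R} {n m : nat}.
Variable A : design P n m.
Hypothesis share_ge0 : forall i s x, 0 <= share A i s x.
Local Notation integ f := (P.-integrable setT (EFin \o f)).
Local Notation Ex f := (Rintegral P setT f).

Definition avg s x : R := (sector_size A s x)^-1 * base A s x.

(** Separates the small deterministic-given-[W] factor from an average with bounded moments. A
    sector of size 0 has only zero shares, so both sides vanish there. *)
Lemma base_relE s x : base_rel A s x = rel_size A s x * avg s x.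
Proof.
rewrite /base_rel /rel_size /avg; have [n0|n0] := eqVneq (sector_size A s x) 0.
  have s0 i : share A i s x = 0.
    by apply/eqP; rewrite eq_le share_ge0 -n0 share_le_size.
  rewrite /base big1 ?invr0 ?mul0r ?mulr0//.
  by move=> i _; rewrite s0 mul0r.
by rewrite mulrA mulfK.
Qed.

Lemma norm_share i s x : 0 <= (sector_size A s x)^-1 * share A i s x <= 1.
Proof.
rewrite mulr_ge0 ?invr_ge0 ?sector_size_ge0//=.
have [->|n0] := eqVneq (sector_size A s x) 0; first by rewrite invr0 mul0r.
by rewrite mulrC ler_pdivrMr ?mul1r ?share_le_size// lt0r n0 sector_size_ge0.
Qed.

Lemma sum_norm_share s x : \sum_(i < n) (sector_size A s x)^-1 * share A i s x <= 1.
Proof.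
rewrite -mulr_sumr -/(sector_size A s x).
by have [->|n0] := eqVneq (sector_size A s x) 0; rewrite ?mulr0// mulVf.
Qed.

Lemma avg4_le s x : avg s x ^+ 4 <=
  \sum_(i < n) (sector_size A s x)^-1 * share A i s x * outcome0 A i x ^+ 4.
Proof.
rewrite /avg /base mulr_sumr; under eq_bigr do rewrite mulrA.
apply: jensen4; first by move=> i; case/andP: (norm_share i s x).
exact: sum_norm_share.
Qed.

Variable Cy : R.
Hypothesis Cy_ge0 : 0 <= Cy.
Hypothesis Y4 : forall i, cond_le P (sigma_W A) (fun x => outcome0 A i x ^+ 4) Cy.

Lemma avg_gmeas s : gmeas (sigma_F0 A) (avg s).
Proof.
have sF := sigma_F0_subsig A; apply: gmeasM => //.
  apply: gmeasV => //; apply: gmeas_sub; first exact: sigma_W_sub_F0.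
  exact: gmeas_sector_size.
apply: gmeas_sum => // i _; apply: gmeasM => //; first exact: gmeas_share.
exact: gmeas_outcome0.
Qed.

(** By Jensen the fourth power is at most an average of fourth powers of outcomes. Its weights are
    [W]-measurable, so together with [g] they form test functions for the moment bounds given
    [W]. *)
Lemma avg4_moment s : cond_le P (sigma_W A) (fun x => avg s x ^+ 4) Cy.
Proof.
move=> g gg g0 gi; have sW := sigma_W_subsig A.
pose v i x := (sector_size A s x)^-1 * share A i s x * g x.
have v0 i x : 0 <= v i x by rewrite mulr_ge0//; case/andP: (norm_share i s x).
have gv i : gmeas (sigma_W A) (v i).
  apply: gmeasM => //; apply: gmeasM => //; last exact: gmeas_share_W.
  by apply: gmeasV => //; exact: gmeas_sector_size.
have vi i : integ (v i).
  apply: integ_le gi _; first exact: gmeas_meas (gv i).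
  by move=> x; rewrite ger0_norm// ler_piMl//; case/andP: (norm_share i s x).
have yi i := (Y4 i (gv i) (v0 i) (vi i)).1.
have ui : integ (fun x => \sum_(i < n) outcome0 A i x ^+ 4 * v i x).
  by apply: integ_sum => i _.
have le x : avg s x ^+ 4 * g x <= \sum_(i < n) outcome0 A i x ^+ 4 * v i x.
  apply: le_trans (ler_wpM2r (g0 x) (avg4_le s x)) _.
  rewrite mulr_suml le_eqVlt; apply/orP; left; apply/eqP.
  by apply: eq_bigr => i _; rewrite /v; ring.
have ai : integ (fun x => avg s x ^+ 4 * g x).
  apply: integ_le ui _.
    apply: measurable_funM; last exact: gmeas_meas gg.
    apply: measurable_funX; exact: gmeas_meas (sigma_F0_subsig A) (avg_gmeas s).
  by move=> x; rewrite ger0_norm ?le// mulr_ge0 ?pow4_ge0.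
split=> //; apply: le_trans (Ex_le ai ui le) _.
rewrite Ex_sum//; apply: (@le_trans _ _ (\sum_(i < n) Cy * Ex (v i))).
  by apply: ler_sum => i _; exact: (Y4 i (gv i) (v0 i) (vi i)).2.
rewrite -mulr_sumr ler_wpM2l// -Ex_sum//; apply: Ex_le => //; first exact: integ_sum.
by move=> x; rewrite /v -mulr_suml ler_piMl// sum_norm_share.
Qed.

End weighted_outcomes.

(** * The conditional variances add up to the score variance in mean square *)

Section fluctuation.
Context {d : measure_display} {T : measurableType d} {R : realType}.
Context {P : probability T R} {n m : nat}.
Variable A : design P n m.
Hypothesis share_ge0 : forall i s x, 0 <= share A i s x.
Hypothesis share_le1 : forall i x, \sum_(s < m) share A i s x <= 1.
Local Notation integ f := (P.-integrable setT (EFin \o f)).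
Local Notation Ex f := (Rintegral P setT f).
Local Notation F := (sigma_F0 A).
Local Notation G := (filt (sigma_F0 A) (shifter A)).
Local Notation X := (fun s => shifter A s : T -> R).

Variables (B K Cy : R) (eff : 'I_n -> 'I_m -> T -> R) (sig kap chi : 'I_m -> T -> R).
Hypothesis B_ge0 : 0 <= B.
Hypothesis K_ge0 : 0 <= K.
Hypothesis eff_gmeas : forall i s, gmeas F (eff i s).
Hypothesis eff_bound : forall i s x, `|eff i s x| <= B.
Hypothesis cm : cond_moments P F G X sig kap chi K.
Hypothesis Cy_ge0 : 0 <= Cy.
Hypothesis Y4 : forall i, cond_le P (sigma_W A) (fun x => outcome0 A i x ^+ 4) Cy.

Lemma outcome0_L4 i : L4 P (outcome0 A i).
Proof.
split; first exact: measurable_funPT.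
apply: integ_ext (Y4 i (gmeas_cst (sigma_W_subsig A) 1) (fun=> ler01)
  (integ_cst P 1)).1 => x; exact: mulr1.
Qed.

Let cf := rel_coefs share_ge0 share_le1 B_ge0 eff_gmeas eff_bound cm outcome0_L4.
Local Notation C := (base_rel A).
Local Notation D := (diag_rel A eff sig).
Local Notation e := (off_rel A eff sig).

Definition fluct x : R := \sum_(t < m) qf_var X sig kap chi C D e t x -
                          \sum_(t < m) qf_var0 sig kap chi C D e t x.

Lemma mix_rel_bound s x : qf_mix sig kap C D s x ^+ 2 <=
  rel_size A s x ^+ 2 * (8 * K ^+ 2 * (1 + avg A s x ^+ 4 + 4 * B ^+ 2)).
Proof.
have /andP[s0 sK] := cm_sig cm s x; have kK := cm_kap cm s x.
have sqr_le (a b : R) : `|a| <= b -> a ^+ 2 <= b ^+ 2.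
  move=> ab; rewrite -(real_normK (num_real a)) lerXn2r ?nnegrE//.
  exact: le_trans ab.
have h1 : (sig s x * C s x) ^+ 2 <= K ^+ 2 * C s x ^+ 2.
  by rewrite exprMn ler_wpM2r ?sqr_ge0// sqr_le// ger0_norm.
have h2 : (kap s x * D s x) ^+ 2 <= K ^+ 2 * D s x ^+ 2.
  by rewrite exprMn ler_wpM2r ?sqr_ge0// sqr_le.
(* From a^2 <= 1 + a^4, so that only the fourth moment of [avg] is used. *)
have h3 : C s x ^+ 2 <= rel_size A s x ^+ 2 * (1 + avg A s x ^+ 4).
  rewrite base_relE// exprMn ler_wpM2l ?sqr_ge0// (exprM _ 2 2).
  by have := sqr_ge0 (avg A s x ^+ 2 - 2^-1); rewrite sqrrB; lra.
have h4 : D s x ^+ 2 <= rel_size A s x ^+ 2 * (4 * B ^+ 2).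
  apply: le_trans (sqr_le _ _ (diag_rel_bound share_ge0 share_le1 B_ge0 eff_bound cm s x)) _.
  by rewrite le_eqVlt; apply/orP; left; apply/eqP; ring.
have -> : qf_mix sig kap C D s x = 2 * (sig s x * C s x + kap s x * D s x).
  by rewrite /qf_mix; ring.
set a := sig s x * C s x in h1 *; set b := kap s x * D s x in h2 *.
apply: (@le_trans _ _ (8 * (a ^+ 2 + b ^+ 2))).
  by have := sqr_ge0 (a - b); rewrite exprMn sqrrB sqrrD; lra.
have -> : rel_size A s x ^+ 2 * (8 * K ^+ 2 * (1 + avg A s x ^+ 4 + 4 * B ^+ 2)) =
  8 * (K ^+ 2 * (rel_size A s x ^+ 2 * (1 + avg A s x ^+ 4)) +
       K ^+ 2 * (rel_size A s x ^+ 2 * (4 * B ^+ 2))) by ring.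
rewrite ler_wpM2l//; apply: lerD.
  by apply: le_trans h1 _; rewrite ler_wpM2l ?sqr_ge0.
by apply: le_trans h2 _; rewrite ler_wpM2l ?sqr_ge0.
Qed.

Definition fluctC : R :=
  varC K (4 * B) * (8 * K ^+ 2 * (1 + Cy + 4 * B ^+ 2) + 1).

Let varC_ge0 : 0 <= varC K (4 * B).
Proof. by rewrite /varC !(addr_ge0, mulr_ge0, sqr_ge0, exprn_ge0). Qed.

(** The fluctuation is a centred form, so its second moment is the mean of the conditional variance
    of that form. The Schur bound for this variance is linear in [avg ^ 4] with [W]-measurable
    weights, hence can be averaged. *)
Lemma fluct_bound : integ (fun x => fluct x ^+ 2) /\
  Ex (fun x => fluct x ^+ 2) <= fluctC * Ex (max_rel2 A).
Proof.
have sW := sigma_W_subsig A; have sF := sigma_F0_subsig A.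
have gr s : gmeas (sigma_W A) (rel_size A s) by exact: gmeas_rel_size.
have gM : gmeas (sigma_W A) (max_rel2 A) by exact: gmeas_max_rel2.
have rho x : 0 <= max_rel2 A x <= 1 by rewrite max_rel2_ge0 max_rel2_le1.
have ri : integ (max_rel2 A).
  apply: (@integ_bnd _ _ _ _ _ 1); first exact: gmeas_meas gM.
  by move=> x; have /andP[h1 h2] := rho x; rewrite ger0_norm.
(* The [W]-measurable weights of the Schur bound; since [rel_size] is square-summable to at most 1,
   they add up to at most [max_rel2]. *)
pose g s x := max_rel2 A x * rel_size A s x ^+ 2.
have g0 s x : 0 <= g s x by rewrite mulr_ge0 ?sqr_ge0//; case/andP: (rho x).
have gg s : gmeas (sigma_W A) (g s) by apply: gmeasM => //; exact: gmeasX.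
have gi s : integ (g s).
  apply: (integ_le _ ri); first exact: gmeas_meas (gg s).
  move=> x; rewrite ger0_norm// ler_piMr//; first by case/andP: (rho x).
  by rewrite exprn_ile1 ?rel_size_ge0 ?rel_size_le1.
pose c1 : R := 8 * K ^+ 2 * (1 + 4 * B ^+ 2) + 1.
pose U x := varC K (4 * B) *
  \sum_(s < m) (c1 * g s x + 8 * K ^+ 2 * (avg A s x ^+ 4 * g s x)).
have am s := avg4_moment share_ge0 Cy_ge0 Y4 s (gg s) (g0 s) (gi s).
have ti s : integ (fun x => c1 * g s x + 8 * K ^+ 2 * (avg A s x ^+ 4 * g s x)).
  by apply: integD; apply: integZ => //; exact: (am s).1.
have Ui : integ U by apply: integZ; apply: integ_sum => s _.
have cf2 := coefs2 cm cf.
have := qf_form_var0_orth cm cf2.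
have -> : qf_form X sig (qf_C2 sig kap C D e) (qf_D2 sig e) (qf_e2 sig e) = fluct.
  by apply/funext => x; exact/esym/qf_var_sub.
set V := fun y : T => \sum_(t < m) qf_var0 sig kap chi (qf_C2 sig kap C D e)
  (qf_D2 sig e) (qf_e2 sig e) t y.
move=> [fi fo].
have VU x : V x <= U x.
  have Mx := rho x; pose r s := rel_size A s x.
  apply: le_trans (qf_var02_le cm K_ge0 C D (k := fun s t => overlap_rel A B s t x)
    (r := r) (L := 4 * B) (s := Num.sqrt (max_rel2 A x)) _ _ _ _ _ _ _ _) _.
  - by move=> t u; exact: overlap_rel_ge0.
  - by move=> t u; exact: overlap_rel_sym.
  - by move=> t; exact: sum_overlap_rel.
  - exact: mulr_ge0.
  - exact: sqrtr_ge0.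
  - by move=> t; exact: rel_size_ge0.
  - by move=> t; exact: rel_size_le_root.
  - by move=> t u; exact: (off_rel_bound share_ge0 B_ge0 eff_bound cm).
  rewrite sqr_sqrtr; last by case/andP: Mx.
  rewrite -mulrA ler_wpM2l// -big_split/= mulr_sumr; apply: ler_sum => s _.
  have -> : c1 * g s x + 8 * K ^+ 2 * (avg A s x ^+ 4 * g s x) = max_rel2 A x *
    (rel_size A s x ^+ 2 * (8 * K ^+ 2 * (1 + avg A s x ^+ 4 + 4 * B ^+ 2)) + r s ^+ 2).
    by rewrite /c1 /g /r; ring.
  by rewrite ler_wpM2l ?lerD2r ?mix_rel_bound//; case/andP: Mx.
(* The difference with [V] is integrable with mean 0, so domination by [U] gives integrability and
   the bound together. *)
have fU x : fluct x ^+ 2 <= (fluct x ^+ 2 - V x) + U x.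
  by have := VU x; lra.
have fUi := integD fi Ui.
have mf : measurable_fun setT fluct.
  apply: measurable_funB; apply: measurable_sum => t.
    exact: gmeas_meas (cm_subsig cm t) (qf_var_gmeas cm cf t).
  exact: gmeas_meas sF (qf_var0_gmeas cm cf t).
have f2i : integ (fun x => fluct x ^+ 2).
  apply: (integ_le _ fUi); first exact: measurable_funX.
  by move=> x; rewrite ger0_norm ?sqr_ge0.
split=> //; apply: le_trans (Ex_le f2i fUi fU) _; rewrite ExD//.
have -> : Ex (fun x => fluct x ^+ 2 - V x) = 0.
  rewrite -(fo setT (subsigT sF)); apply: Ex_ext => x.
  by rewrite indicT mulr1.
rewrite add0r ExZ ?Ex_sum//; last by apply: integ_sum.
rewrite /fluctC -mulrA ler_wpM2l//.
apply: (@le_trans _ _ (\sum_(s < m) (8 * K ^+ 2 * (1 + Cy + 4 * B ^+ 2) + 1) * Ex (g s))).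
  apply: ler_sum => s _; rewrite ExD; [|exact: integZ|apply: integZ; exact: (am s).1].
  rewrite !ExZ//; last exact: (am s).1.
  have K8 : 0 <= 8 * K ^+ 2 by rewrite mulr_ge0 ?sqr_ge0.
  have := ler_wpM2l K8 (am s).2; rewrite /c1; set a := Ex (g s); set b := Ex _ => h.
  by apply: le_trans (lerD (lexx _) h) _; rewrite le_eqVlt; apply/orP; left; apply/eqP; ring.
rewrite -mulr_sumr ler_wpM2l//.
  by rewrite !(addr_ge0, mulr_ge0, sqr_ge0).
rewrite -Ex_sum//; apply: Ex_le => //; first exact: integ_sum.
move=> x; rewrite /g -mulr_sumr ler_piMr//; first by case/andP: (rho x).
exact: sum_rel_size.
Qed.

End fluctuation.

(** * Elementary inequalities for [lyap] *)

Section lyapunov_bounds.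
Context {R : realType}.

Lemma le_lyap (a b : R) : `|a| <= `|b| -> lyap a <= lyap b.
Proof.
move=> ab; rewrite /lyap -(real_normK (num_real a)) -(real_normK (num_real b)).
have h2 : `|a| ^+ 2 <= `|b| ^+ 2 by rewrite lerXn2r ?nnegrE.
have h3 : `|a| ^+ 3 <= `|b| ^+ 3 by rewrite lerXn2r ?nnegrE.
by rewrite le_min !ge_min h2 h3 orbT.
Qed.

Lemma lyap_triple (z : R) : lyap (3 * z) <= 27 * lyap z.
Proof.
rewrite {2}/lyap minr_pMr// le_min; apply/andP; split.
  apply: le_trans (lyap_le _) _; have := sqr_ge0 z; rewrite exprMn; lra.
rewrite /lyap ge_min; apply/orP; right; rewrite normrM exprMn ger0_norm//.
by rewrite le_eqVlt; apply/orP; left; apply/eqP; ring.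
Qed.

(** The sum is at most 3 times the largest term in absolute value, and 27 is the cube of 3. *)
Lemma lyap_add3 (a b c : R) : lyap (a + b + c) <= 27 * (lyap a + lyap b + lyap c).
Proof.
have := lyap_ge0 a; have := lyap_ge0 b; have := lyap_ge0 c => c0 b0 a0.
have tri : `|a + b + c| <= `|a| + `|b| + `|c|.
  by rewrite (le_trans (ler_normD _ _))// lerD2r ler_normD.
have step (z : R) : `|a| <= `|z| -> `|b| <= `|z| -> `|c| <= `|z| ->
    lyap (a + b + c) <= 27 * lyap z.
  move=> az bz cz; apply: le_trans (lyap_triple z); apply: le_lyap.
  by rewrite normrM (ger0_norm (_ : 0 <= 3))//; lra.
have [ab|/ltW ab] := leP `|a| `|b|; have [bc|/ltW bc] := leP `|b| `|c|.
- apply: le_trans (step c _ _ _) _ => //; first exact: le_trans bc.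
  lra.
- by apply: le_trans (step b _ _ _) _ => //; lra.
- have [ac|/ltW ac] := leP `|a| `|c|.
    by apply: le_trans (step c _ _ _) _ => //; lra.
  by apply: le_trans (step a _ _ _) _ => //; lra.
- apply: le_trans (step a _ _ _) _ => //; last by lra.
  exact: le_trans ab.
Qed.

Lemma lyap_scale (r z : R) : 0 <= r -> lyap (r * z) <= r ^+ 3 * (1 + z ^+ 4).
Proof.
move=> r0; rewrite /lyap ge_min; apply/orP; right.
rewrite normrM (ger0_norm r0) exprMn ler_wpM2l ?exprn_ge0//.
have -> : z ^+ 4 = `|z| ^+ 4 by rewrite -normrX ger0_norm// pow4_ge0.
move: (normr_ge0 z); move: `|z| => w w0.
have [w1|/ltW w1] := leP w 1.
  have := exprn_ile1 3 w0 w1; have := exprn_ge0 4 w0; lra.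
have := ler_weXn2l w1 (isT : (3 <= 4)%N); lra.
Qed.

Variable gam : R.
Hypotheses (gam_ge0 : 0 <= gam) (gam_le1 : gam <= 1).

(** The exponent [2 + gam] lies between those of the two branches: the cube is smaller below 1, the
    square above 1. *)
Lemma lyap_powR (z : R) : lyap z <= `|z| `^ (2 + gam).
Proof.
rewrite /lyap ge_min; have [z1|z1] := leP `|z| 1; apply/orP; [right|left].
  have [->|z0] := eqVneq z 0; first by rewrite normr0 expr0n/= powR_ge0.
  rewrite -powR_mulrn//; apply: ger_powR; first by rewrite normr_gt0 z0.
  have -> : (3%:R : R) = 2 + 1 by rewrite -natr1.
  by rewrite lerD2l.
rewrite -(real_normK (num_real z)) -powR_mulrn//.
by apply: ler_powR; [exact: ltW|rewrite lerDl].
Qed.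

Lemma lyap_scale_powR (r s w : R) : 0 <= r -> r <= s -> 0 <= w ->
  lyap (r * w) <= r ^+ 2 * s `^ gam * w `^ (2 + gam).
Proof.
move=> r0 rs w0; apply: le_trans (lyap_powR _) _.
rewrite ger0_norm ?mulr_ge0// powRM// ler_wpM2r ?powR_ge0//.
rewrite powRD; last by apply/implyP => /eqP h; have := gam_ge0; lra.
rewrite (powR_mulrn 2)// ler_wpM2l ?sqr_ge0//.
by rewrite ge0_ler_powR ?nnegrE// (le_trans r0).
Qed.

(** The squared shifter is raised to [2 + gam], so the exponent becomes [4 + 2 * gam], available
    when [2 * gam <= nu]. *)
Lemma pow_moment (nu K z : R) : 0 <= K -> 2 * gam <= nu ->
  (z ^+ 2 + K) `^ (2 + gam) <= (1 + K) `^ (2 + gam) * (1 + `|z| `^ (4 + nu)).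
Proof.
move=> K0 gn; pose u := Num.max 1 `|z|.
have u1 : 1 <= u by rewrite le_max lexx.
have u0 : 0 <= u := le_trans ler01 u1.
have zu : `|z| <= u by rewrite le_max lexx orbT.
have g2 : 0 <= 2 + gam by rewrite addr_ge0.
apply: (@le_trans _ _ (((1 + K) * u ^+ 2) `^ (2 + gam))).
  apply: ge0_ler_powR; rewrite // ?nnegrE ?addr_ge0 ?sqr_ge0//.
    by rewrite mulr_ge0 ?addr_ge0 ?sqr_ge0.
  have h1 : z ^+ 2 <= u ^+ 2.
    by rewrite -(real_normK (num_real z)) lerXn2r ?nnegrE.
  have h2 : K <= K * u ^+ 2 by rewrite ler_peMr// expr_ge1.
  by rewrite mulrDl mul1r lerD.
rewrite powRM ?addr_ge0 ?sqr_ge0// ler_wpM2l ?powR_ge0//.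
rewrite -powR_mulrn// -powRrM.
apply: (@le_trans _ _ (u `^ (4 + nu))); first by apply: ler_powR => //; lra.
rewrite /u; have [z1|z1] := leP 1 `|z|; first by rewrite lerDr.
by rewrite powR1 lerDl powR_ge0.
Qed.

End lyapunov_bounds.

(** * The Lyapunov sum of the increments *)

Section lyapunov_sum.
Context {d : measure_display} {T : measurableType d} {R : realType}.
Context {P : probability T R} {n m : nat}.
Variable A : design P n m.
Hypothesis share_ge0 : forall i s x, 0 <= share A i s x.
Hypothesis share_le1 : forall i x, \sum_(s < m) share A i s x <= 1.
Local Notation integ f := (P.-integrable setT (EFin \o f)).
Local Notation Ex f := (Rintegral P setT f).
Local Notation F := (sigma_F0 A).
Local Notation G := (filt (sigma_F0 A) (shifter A)).
Local Notation X := (fun s => shifter A s : T -> R).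

(** Weights in [t] of total mass at most 1, so that Jensen applies to the sum over the earlier
    shifters. *)
Definition norm_overlap s t x : R := (sector_size A s x)^-1 * overlap A s t x.

Lemma norm_overlap_ge0 s t x : 0 <= norm_overlap s t x.
Proof. by rewrite mulr_ge0 ?overlap_ge0 ?invr_ge0 ?sector_size_ge0. Qed.

Lemma sum_norm_overlap s x : \sum_(t < m) norm_overlap s t x <= 1.
Proof.
rewrite -mulr_sumr; have := sum_overlap share_ge0 share_le1 s x.
have := sector_size_ge0 share_ge0 s x; move: (sector_size _ _ _) => k k0 h.
have [->|kn0] := eqVneq k 0; first by rewrite invr0 mul0r.
by rewrite mulrC ler_pdivrMr ?mul1r// lt0r kn0.
Qed.

Lemma overlap_relE (B : R) s t x :
  overlap_rel A B s t x = rel_size A s x * (4 * B * norm_overlap s t x).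
Proof.
rewrite /overlap_rel /rel_size /norm_overlap.
have [n0|n0] := eqVneq (sector_size A s x) 0; last first.
  by move: (root_size2 A x)^-1 => a; field.
have -> : overlap A s t x = 0.
  apply/eqP; rewrite eq_le overlap_ge0// andbT -n0.
  exact: overlap_le_size.
by rewrite n0; ring.
Qed.

Variables (B K Cy Cx nu gam : R) (eff : 'I_n -> 'I_m -> T -> R).
Variables sig kap chi : 'I_m -> T -> R.
Hypothesis B_ge0 : 0 <= B.
Hypothesis K_ge0 : 0 <= K.
Hypothesis eff_gmeas : forall i s, gmeas F (eff i s).
Hypothesis eff_bound : forall i s x, `|eff i s x| <= B.
Hypothesis cm : cond_moments P F G X sig kap chi K.
Hypothesis Cy_ge0 : 0 <= Cy.
Hypothesis Y4 : forall i, cond_le P (sigma_W A) (fun x => outcome0 A i x ^+ 4) Cy.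
Hypothesis Cx_ge0 : 0 <= Cx.
Hypothesis Xnu : forall s, cond_le P F (fun x => `|shifter A s x| `^ (4 + nu)) Cx.
Hypotheses (gam_ge0 : 0 <= gam) (gam_le1 : gam <= 1) (gam_nu : 2 * gam <= nu).

Local Notation C := (base_rel A).
Local Notation D := (diag_rel A eff sig).
Local Notation e := (off_rel A eff sig).

Let L4Y := outcome0_L4 Y4.
Let cf := rel_coefs share_ge0 share_le1 B_ge0 eff_gmeas eff_bound cm L4Y.

Definition root_rel x : R := Num.sqrt (max_rel2 A x) `^ gam.
(** One weight for all pieces of an increment: it dominates [rel_size ^ 3], as [gam <= 1], and
    arises from [rel_size ^ (2 + gam)]. Summed over [t] it is at most [root_rel]. *)
Definition wt t x : R := rel_size A t x ^+ 2 * root_rel x.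
Definition diagC : R := (2 * B) `^ (2 + gam) * (1 + K) `^ (2 + gam).
Definition lyapC : R :=
  27 * (1 + K * Cy + (1 + (4 * B) ^+ 4 * K ^+ 2) + diagC * (1 + Cx)).

Lemma root_rel_ge0 x : 0 <= root_rel x. Proof. exact: powR_ge0. Qed.

Let sqrt_le1 x : Num.sqrt (max_rel2 A x) <= 1.
Proof. by rewrite -[leRHS]sqrtr1 ler_wsqrtr// max_rel2_le1. Qed.

Lemma root_rel_le1 x : root_rel x <= 1.
Proof.
have <- : (1 : R) `^ gam = 1 by rewrite powR1.
apply: ge0_ler_powR; rewrite // nnegrE//.
Qed.

Lemma rel_size_le_root_rel t x : rel_size A t x <= root_rel x.
Proof.
apply: le_trans (rel_size_le_root share_ge0 t x) _.
have := sqrtr_ge0 (max_rel2 A x); rewrite le_eqVlt => /orP[/eqP<-|s0].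
  exact: root_rel_ge0.
by rewrite -{1}[Num.sqrt _]powRr1 ?sqrtr_ge0//; apply: ger_powR; rewrite ?s0 ?sqrt_le1.
Qed.

Lemma root_rel_gmeas : gmeas (sigma_W A) root_rel.
Proof.
apply: (gmeas_comp (k := fun y => y `^ gam)); first exact: measurable_powR.
apply: (gmeas_comp (k := Num.sqrt)); last exact: gmeas_max_rel2.
by apply: continuous_measurable_fun; exact: sqrt_continuous.
Qed.

Lemma wt_ge0 t x : 0 <= wt t x.
Proof. by rewrite mulr_ge0 ?sqr_ge0 ?root_rel_ge0. Qed.

Lemma wt_gmeas t : gmeas (sigma_W A) (wt t).
Proof.
have sW := sigma_W_subsig A; apply: gmeasM => //; last exact: root_rel_gmeas.
by apply: gmeasX => //; exact: gmeas_rel_size.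
Qed.

Lemma cube_le_wt t x : rel_size A t x ^+ 3 <= wt t x.
Proof. by rewrite exprSr ler_wpM2l ?sqr_ge0 ?rel_size_le_root_rel. Qed.

Lemma wt_le1 t x : wt t x <= 1.
Proof.
rewrite mulr_ile1 ?sqr_ge0 ?root_rel_ge0 ?root_rel_le1//.
by rewrite exprn_ile1 ?rel_size_ge0 ?rel_size_le1.
Qed.

Lemma wt_integ t : integ (wt t).
Proof.
apply: (@integ_bnd _ _ _ _ _ 1); first exact: gmeas_meas (sigma_W_subsig A) (wt_gmeas t).
by move=> x; rewrite ger0_norm ?wt_ge0 ?wt_le1.
Qed.

Definition inc_bound t x : R := 27 * (
  wt t x * (1 + shifter A t x ^+ 4 * avg A t x ^+ 4) +
  wt t x * (1 + (4 * B) ^+ 4 * (shifter A t x ^+ 4 *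
    \sum_(u < m | (u < t)%N) norm_overlap t u x * shifter A u x ^+ 4)) +
  diagC * (wt t x * (1 + `|shifter A t x| `^ (4 + nu)))).

(** The outcome part and the part with the earlier shifters have fourth moments and use the cube.
    The diagonal part contains the square of the shifter and can only be raised to [2 + gam]. *)
Lemma lyap_inc_le t x : lyap (qf_inc X sig C D e t x) <= inc_bound t x.
Proof.
have r0 := rel_size_ge0 share_ge0 t x.
rewrite /qf_inc /qf_lin mulrDr; apply: le_trans (lyap_add3 _ _ _) _.
rewrite ler_wpM2l//; apply: lerD; first apply: lerD.
- rewrite base_relE// mulrCA; apply: le_trans (lyap_scale _ r0) _.
  rewrite [(_ * _) ^+ 4]exprMn ler_wpM2r ?cube_le_wt//.
  by apply: addr_ge0 => //; apply: mulr_ge0; exact: pow4_ge0.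
- pose H := \sum_(u < m | (u < t)%N) norm_overlap t u x * `|shifter A u x|.
  have H0 : 0 <= H by apply: sumr_ge0 => u _; rewrite mulr_ge0 ?norm_overlap_ge0.
  apply: (@le_trans _ _ (lyap (rel_size A t x * (4 * B * (shifter A t x * H))))).
    apply: le_lyap.
    have -> : rel_size A t x * (4 * B * (shifter A t x * H)) =
        shifter A t x * (rel_size A t x * (4 * B) * H) by ring.
    rewrite normrM [leRHS]normrM ler_wpM2l// [leRHS]ger0_norm; last first.
      by do 2!apply: mulr_ge0 => //; exact: mulr_ge0.
    apply: le_trans (ler_norm_sum _ _ _) _; rewrite mulr_sumr; apply: ler_sum => u _.
    rewrite normrM mulrA ler_wpM2r//.
    apply: le_trans (off_rel_bound share_ge0 B_ge0 eff_bound cm t u x) _.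
    by rewrite overlap_relE mulrA.
  apply: le_trans (lyap_scale _ r0) _.
  have H4 : H ^+ 4 <= \sum_(u < m | (u < t)%N) norm_overlap t u x * shifter A u x ^+ 4.
    rewrite /H big_mkcond [leRHS]big_mkcond/=.
    pose p (u : 'I_m) := if (u < t)%N then norm_overlap t u x else 0.
    have -> : \sum_(u < m) (if (u < t)%N then norm_overlap t u x * `|shifter A u x| else 0) =
        \sum_(u < m) p u * `|shifter A u x|.
      by apply: eq_bigr => u _; rewrite /p; case: ifP; rewrite ?mul0r.
    have -> : \sum_(u < m) (if (u < t)%N then norm_overlap t u x * shifter A u x ^+ 4 else 0) =
        \sum_(u < m) p u * `|shifter A u x| ^+ 4.
      apply: eq_bigr => u _; rewrite -normrX ger0_norm ?pow4_ge0//.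
      by rewrite /p; case: ifP; rewrite ?mul0r.
    apply: jensen4 => [u|]; first by rewrite /p; case: ifP; rewrite ?norm_overlap_ge0.
    apply: le_trans _ (sum_norm_overlap t x); apply: ler_sum => u _.
    by rewrite /p; case: ifP; rewrite ?norm_overlap_ge0.
  apply: (@le_trans _ _ (wt t x * (1 + (4 * B * (shifter A t x * H)) ^+ 4))).
    by rewrite ler_wpM2r ?cube_le_wt// addr_ge0 ?pow4_ge0.
  by rewrite ler_wpM2l ?wt_ge0// lerD2l !exprMn !ler_wpM2l ?pow4_ge0// mulr_ge0 ?pow4_ge0.
- have /andP[s0 sK] := cm_sig cm t x.
  pose w := 2 * B * (shifter A t x ^+ 2 + K).
  have w0 : 0 <= w by rewrite !mulr_ge0 ?addr_ge0 ?sqr_ge0.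
  apply: (@le_trans _ _ (lyap (rel_size A t x * w))).
    apply: le_lyap; rewrite normrM [leRHS]ger0_norm; last exact: mulr_ge0.
    have -> : rel_size A t x * w =
      (shifter A t x ^+ 2 + K) * (2 * B * rel_size A t x) by rewrite /w; ring.
    apply: ler_pM => //; last exact: (diag_rel_bound share_ge0 share_le1 B_ge0 eff_bound cm).
    apply: le_trans (ler_normB _ _) _.
    by rewrite (ger0_norm s0) ger0_norm ?sqr_ge0// lerD2l.
  apply: le_trans (lyap_scale_powR gam_ge0 gam_le1 r0 (rel_size_le_root share_ge0 t x) w0) _.
  rewrite -/(root_rel x) -/(wt t x) mulrCA ler_wpM2l ?wt_ge0//.
  rewrite /w /diagC powRM ?mulr_ge0 ?addr_ge0 ?sqr_ge0// -mulrA.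
  rewrite ler_wpM2l ?powR_ge0//; exact: pow_moment.
Qed.

Lemma diagC_ge0 : 0 <= diagC. Proof. by rewrite mulr_ge0 ?powR_ge0. Qed.

Let sG t := cm_subsig cm t.

Let X4_moment (t : 'I_m) : cond_le P (G t) (fun x => shifter A t x ^+ 4) K.
Proof.
apply: (@cond_bound _ _ _ _ (G t) _ (chi t)) => //.
- exact: (cm_L4 cm t).2.
- by move=> x; exact: pow4_ge0.
- exact: cm_chi cm t.
- exact: cm_o4 cm t.
- exact: gmeas_sub (cm_sub cm t) (cm_gchi cm t).
Qed.

Lemma inc_bound_moment t : integ (inc_bound t) /\ Ex (inc_bound t) <= lyapC * Ex (wt t).
Proof.
have sW := sigma_W_subsig A; have sF := sigma_F0_subsig A.
have WF (f : T -> R) : gmeas (sigma_W A) f -> gmeas F f.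
  by apply: gmeas_sub; exact: sigma_W_sub_F0.
have FG k (f : T -> R) : gmeas F f -> gmeas (G k) f.
  by apply: gmeas_sub; exact: cm_sub cm k.
have gw := wt_gmeas t.
have wi := wt_integ t.
have [ai aE] := avg4_moment share_ge0 Cy_ge0 Y4 t gw (wt_ge0 t) wi.
have ga : gmeas F (fun x => avg A t x ^+ 4 * wt t x).
  by apply: gmeasM => //; [apply: gmeasX => //; exact: avg_gmeas|exact: WF].
have a0 x : 0 <= avg A t x ^+ 4 * wt t x by rewrite mulr_ge0 ?pow4_ge0 ?wt_ge0.
(* The expectation is peeled from the last variable on: [X t] given [G t] first, then [avg] given
   [W]. *)
have [bi bE] := X4_moment (FG t _ ga) a0 ai.
pose v u x := norm_overlap t u x * wt t x.
have v0 u x : 0 <= v u x by rewrite mulr_ge0 ?norm_overlap_ge0 ?wt_ge0.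
have gv u : gmeas F (v u).
  apply: WF; apply: gmeasM => //; apply: gmeasM => //; last exact: gmeas_overlap.
  by apply: gmeasV => //; exact: gmeas_sector_size.
have vi u : integ (v u).
  apply: (integ_le _ wi); first exact: gmeas_meas (gv u).
  move=> x; rewrite ger0_norm// ler_piMl ?wt_ge0//.
  apply: le_trans (sum_norm_overlap t x); rewrite (bigD1 u)//= lerDl.
  by apply: sumr_ge0 => k _; exact: norm_overlap_ge0.
have um (u : 'I_m) := X4_moment (FG u _ (gv u)) (v0 u) (vi u).
(* For [u < t] the variable [X u] belongs to [G t]; conditioning on [G t] and then on [G u] costs
   one factor [K] each. *)
have tm (u : 'I_m) : (u < t)%N ->
    integ (fun x => shifter A t x ^+ 4 * (shifter A u x ^+ 4 * v u x)) /\
    Ex (fun x => shifter A t x ^+ 4 * (shifter A u x ^+ 4 * v u x)) <=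
      K ^+ 2 * Ex (v u).
  move=> ut.
  have [h1 h2] : integ (fun x => shifter A t x ^+ 4 * (shifter A u x ^+ 4 * v u x)) /\
    Ex (fun x => shifter A t x ^+ 4 * (shifter A u x ^+ 4 * v u x)) <=
      K * Ex (fun x => shifter A u x ^+ 4 * v u x).
    apply: X4_moment; last exact: (um u).1.
      apply: gmeasM => //; last exact: FG.
      by apply: gmeasX => //; exact: (cm_gX cm).
    by move=> x; rewrite mulr_ge0 ?pow4_ge0.
  split=> //; apply: le_trans h2 _; rewrite expr2 -mulrA ler_wpM2l//.
  exact: (um u).2.
have [ni nE] := Xnu t (WF _ gw) (wt_ge0 t) wi.
pose S x := \sum_(u < m | (u < t)%N) shifter A t x ^+ 4 * (shifter A u x ^+ 4 * v u x).
have Si : integ S by apply: integ_sum => u ut; exact: (tm u ut).1.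
have SE : Ex S <= K ^+ 2 * Ex (wt t).
  rewrite Ex_sum; last by move=> u ut; exact: (tm u ut).1.
  apply: (@le_trans _ _ (\sum_(u < m) K ^+ 2 * Ex (v u))).
    rewrite big_mkcond; apply: ler_sum => u _; case: ifPn => [ut|_].
      exact: (tm u ut).2.
    by rewrite mulr_ge0 ?sqr_ge0//; exact: Ex_ge0.
  rewrite -mulr_sumr ler_wpM2l ?sqr_ge0// -Ex_sum//.
  apply: Ex_le => //; first exact: integ_sum.
  by move=> x; rewrite -mulr_suml ler_piMl ?wt_ge0 ?sum_norm_overlap.
have E : inc_bound t =1 fun x => 27 * ((wt t x + shifter A t x ^+ 4 * (avg A t x ^+ 4 * wt t x)) +
    (wt t x + (4 * B) ^+ 4 * S x) +
    diagC * (wt t x + `|shifter A t x| `^ (4 + nu) * wt t x)).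
  move=> x; rewrite /inc_bound.
  have -> : S x = shifter A t x ^+ 4 * (\sum_(u < m | (u < t)%N)
      norm_overlap t u x * shifter A u x ^+ 4) * wt t x.
    rewrite -mulrA mulr_suml mulr_sumr; apply: eq_bigr => u _; rewrite /v; ring.
  ring.
have i1 := integD wi bi; have i2 := integD wi (integZ ((4 * B) ^+ 4) Si).
have i3 := integZ diagC (integD wi ni); have i12 := integD i1 i2.
split; first by apply: integ_ext (integZ 27 (integD i12 i3)) => x; rewrite E.
rewrite (Ex_ext _ E) ExZ; last exact: integD.
rewrite /lyapC -mulrA ler_wpM2l// ExD// ExD// ExD// ExD//; last exact: integZ.
rewrite !ExZ//; last exact: integD.
rewrite ExD//.
have B4 : 0 <= (4 * B) ^+ 4 by exact: pow4_ge0.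
have bE' : Ex (fun x => shifter A t x ^+ 4 * (avg A t x ^+ 4 * wt t x)) <=
    K * (Cy * Ex (wt t)) by apply: le_trans bE _; rewrite ler_wpM2l.
have S4 := ler_wpM2l B4 SE; have n4 := ler_wpM2l diagC_ge0 nE.
move: bE' S4 n4.
set a := Ex (wt t); set b := Ex _; set c := Ex S; set k := Ex _ => h1 h2 h3.
apply: (@le_trans _ _ (a + K * (Cy * a) + (a + (4 * B) ^+ 4 * (K ^+ 2 * a)) +
  (diagC * a + diagC * (Cx * a)))).
  by rewrite mulrDr; do 2!apply: lerD; rewrite ?lerD2l.
by rewrite le_eqVlt; apply/orP; left; apply/eqP; ring.
Qed.

Lemma lyap_sum_bound :
  \sum_(t < m) Ex (fun x => lyap (qf_inc X sig C D e t x)) <= lyapC * Ex root_rel.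
Proof.
have sW := sigma_W_subsig A.
have wi := wt_integ.
apply: (@le_trans _ _ (\sum_(t < m) lyapC * Ex (wt t))).
  apply: ler_sum => t _; have [bi bE] := inc_bound_moment t.
  apply: le_trans _ bE; apply: Ex_le => //; last by move=> x; exact: lyap_inc_le.
  apply: (integ_le _ bi); last by move=> x; rewrite ger0_norm ?lyap_ge0 ?lyap_inc_le.
  apply: measurableT_comp; first exact: measurable_lyap.
  exact: gmeas_meas (cm_subsig cm t.+1) (qf_inc_gmeas cm cf t).
rewrite -mulr_sumr ler_wpM2l//.
  apply: mulr_ge0 => //; apply: addr_ge0; first apply: addr_ge0.
  - by apply: addr_ge0 => //; exact: mulr_ge0.
  - by apply: addr_ge0 => //; apply: mulr_ge0; [exact: pow4_ge0|exact: sqr_ge0].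
  - by apply: mulr_ge0; [exact: diagC_ge0|exact: addr_ge0].
rewrite -Ex_sum//; apply: Ex_le => [||x]; first exact: integ_sum.
  apply: (@integ_bnd _ _ _ _ _ 1); first exact: gmeas_meas root_rel_gmeas.
  by move=> x; rewrite ger0_norm ?root_rel_ge0 ?root_rel_le1.
by rewrite -mulr_suml ler_piMl ?root_rel_ge0// sum_rel_size.
Qed.

End lyapunov_sum.

(** * [beta], the score and its variance in terms of the chosen versions *)

Section conditional_score.
Context {d : measure_display} {T : measurableType d} {R : realType}.
Context {P : probability T R} {n m : nat}.
Variables (A : design P n m) (Y : 'I_n -> {RV P >-> R}).
Hypothesis share_ge0 : forall i s x, 0 <= share A i s x.
Hypothesis share_le1 : forall i x, \sum_(s < m) share A i s x <= 1.
Hypothesis outcomeE : forall i x, Y i x = outcome0 A i x +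
  \sum_(s < m) share A i s x * shifter A s x * effect A i s x.
Local Notation integ f := (P.-integrable setT (EFin \o f)).
Local Notation Ex f := (Rintegral P setT f).
Local Notation F := (sigma_F0 A).
Local Notation G := (filt (sigma_F0 A) (shifter A)).
Local Notation X := (fun s => shifter A s : T -> R).

Variables (B K : R) (eff : 'I_n -> 'I_m -> T -> R) (sig kap chi : 'I_m -> T -> R).
Hypothesis B_ge0 : 0 <= B.
Hypothesis eff_gmeas : forall i s, gmeas F (eff i s).
Hypothesis eff_bound : forall i s x, `|eff i s x| <= B.
Hypothesis effE : forall i s, {ae P, forall x, effect A i s x = eff i s x}.
Hypothesis cm : cond_moments P F G X sig kap chi K.
Hypothesis L4Y : forall i, L4 P (outcome0 A i).

Let sF : subsig F := sigma_F0_subsig A.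
Let gsh i s : gmeas F (share A i s). Proof. exact: gmeas_share. Qed.

Let ae_all (I : finType) (Q : I -> T -> Prop) :
  (forall i, {ae P, forall x, Q i x}) -> {ae P, forall x, forall i, Q i x}.
Proof. by move=> h; apply: (filter_forall _ h). Qed.

(** One computation serves both the numerator and the denominator of [beta]; [h] need only agree
    with the form almost surely, since effects are replaced by truncated ones. *)
Lemma quad_condexp (C : 'I_m -> T -> R) (f : 'I_m -> 'I_m -> T -> R) (M : R) (h : T -> R) :
  (forall s, gmeas F (C s)) -> (forall s, L4 P (C s)) ->
  (forall s t, gmeas F (f s t)) -> (forall s t x, `|f s t x| <= M) ->
  measurable_fun setT h ->
  {ae P, forall x, h x = \sum_(s < m) shifter A s x * C s x +
    \sum_(s < m) \sum_(t < m) shifter A s x * shifter A t x * f s t x} ->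
  {ae P, forall x, condexp P F h x = \sum_(s < m) sig s x * f s s x}.
Proof.
move=> gC LC gf fM mh hE.
have cf : coefs P F C (fun s => f s s) (fun s t x => f s t x + f t s x).
  split=> //.
  - by exists M.
  - by move=> s t; exact: gmeasD.
  - exists (M + M) => s t x; apply: le_trans (ler_normD _ _) _; exact: lerD.
pose g x := \sum_(s < m) sig s x * f s s x.
have gg : gmeas F g.
  by apply: gmeas_sum => // s _; apply: gmeasM => //; exact: (cm_gsig cm).
have gi : integ g.
  apply: integ_sum => s _; apply: (@integM_bnd _ _ _ _ _ _ M) => //.
    have mg := gmeas_meas sF (cm_gsig cm s).
    apply: (@integ_bnd _ _ _ _ _ K) => // x.
    by have /andP[h1 h2] := cm_sig cm s x; rewrite ger0_norm.
  exact: gmeas_meas (gf s s).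
have o : orth P F (fun x => h x - g x).
  apply: orth_ae sF (qf_form_orth cm cf) _ _.
    by apply: measurable_funB => //; exact: gmeas_meas gg.
  apply: filterS hE => x ->; have := quad_formE X sig C f x => /= ->.
  by rewrite addrK.
apply: condexp_ae => //; apply: integ_ext (integD o.1 gi) => x.
by rewrite subrK.
Qed.

Let exposure_meas i : measurable_fun setT (exposure A i).
Proof. by apply: measurable_sum => s; apply: measurable_funM. Qed.

Let share_bound i s t x : `|share A i s x * share A i t x| <= 1.
Proof.
by rewrite ger0_norm ?mulr_ge0// mulr_ile1//; exact: share_le_1.
Qed.

Lemma exposure_sqr_condexp i :
  {ae P, forall x, condexp P F (fun y => exposure A i y ^+ 2) x =
    \sum_(s < m) sig s x * (share A i s x * share A i s x)}.
Proof.
apply: (@quad_condexp (fun _ _ => 0) (fun s t x => share A i s x * share A i t x) 1).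
- by move=> s; exact: gmeas_cst.
- by move=> s; exact: L4_cst.
- by move=> s t; exact: gmeasM.
- by move=> s t x; exact: share_bound.
- exact: measurable_funX.
apply: aeW => x; rewrite big1 ?add0r => [|s _]; last exact: mulr0.
rewrite expr2 mulr_suml; apply: eq_bigr => s _; rewrite mulr_sumr.
by apply: eq_bigr => t _; ring.
Qed.

Lemma exposure_outcome_condexp i :
  {ae P, forall x, condexp P F (fun y => exposure A i y * Y i y) x =
    \sum_(s < m) sig s x * (share A i s x * share A i s x * eff i s x)}.
Proof.
apply: (@quad_condexp (fun s x => outcome0 A i x * share A i s x)
  (fun s t x => share A i s x * share A i t x * eff i t x) (1 * B)).
- by move=> s; apply: gmeasM => //; exact: gmeas_outcome0.
- move=> s; apply: (L4M_bnd (M := 1)) => // x; rewrite ger0_norm//; exact: share_le_1.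
- by move=> s t; apply: gmeasM => //; exact: gmeasM.
- by move=> s t x; rewrite normrM; apply: ler_pM.
- exact: measurable_funM.
apply: filterS (ae_all (effE i)) => x h.
rewrite outcomeE mulrDr; congr (_ + _); rewrite /exposure mulr_suml.
  by apply: eq_bigr => s _; ring.
apply: eq_bigr => s _; rewrite mulr_sumr; apply: eq_bigr => t _.
by rewrite h; ring.
Qed.

Lemma beta_mean_effect : {ae P, forall x, beta A Y x = mean_effect A eff sig x}.
Proof.
apply: filterS2 (ae_all exposure_sqr_condexp) (ae_all exposure_outcome_condexp).
move=> x h1 h2; rewrite /beta /mean_effect /mean_num /mean_den.
congr (_ / _); apply: eq_bigr => i _; rewrite ?h1 ?h2.
  by apply: eq_bigr => s _; ring.
by apply: eq_bigr => s _; ring.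
Qed.

Definition score x : R := \sum_(i < n) exposure A i x * residual A Y i x.

Local Notation Z := (qf_form X sig (base A) (fun s => pair_dev A eff sig s s)
  (fun s t x => pair_dev A eff sig s t x + pair_dev A eff sig t s x)).

Lemma score_ae : {ae P, forall x, score x = Z x}.
Proof.
apply: filterS2 beta_mean_effect (ae_all (fun i => ae_all (effE i))) => x h1 h2.
rewrite -(score_form eff_bound cm); apply: eq_bigr => i _.
rewrite /residual h1 outcomeE; congr (_ * (_ + _ - _)).
by apply: eq_bigr => s _; rewrite h2.
Qed.

Lemma beta_meas : measurable_fun setT (beta A Y).
Proof.
apply: gmeas_meas (sF) _; apply: gmeasM => //; last apply: gmeasV => //.
  by apply: gmeas_sum => // i _; exact: condexp_gmeas.
by apply: gmeas_sum => // i _; exact: condexp_gmeas.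
Qed.

Lemma score_meas : measurable_fun setT score.
Proof.
apply: measurable_sum => i; apply: measurable_funM => //.
apply: measurable_funB => //; apply: measurable_funM => //; exact: beta_meas.
Qed.

Let cb := base_coefs share_ge0 share_le1 B_ge0 eff_gmeas eff_bound cm L4Y.

Lemma score_condexp0 : {ae P, forall x, condexp P F score x = 0}.
Proof.
have o : orth P F score.
  apply: orth_ae sF (qf_form_orth cm cb) score_meas _.
  by apply: filterS score_ae => x ->.
apply: condexp_ae => //; [exact: gmeas_cst|exact: o.1|].
by apply: orth_ext o => x; rewrite subr0.
Qed.

Lemma score_condvar : {ae P, forall x, condvar P F score x = \sum_(t < m)
  qf_var0 sig kap chi (base A) (fun s => pair_dev A eff sig s s)
    (fun s t x => pair_dev A eff sig s t x + pair_dev A eff sig t s x) t x}.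
Proof.
pose V x := \sum_(t < m) qf_var0 sig kap chi (base A) (fun s => pair_dev A eff sig s s)
  (fun s t x => pair_dev A eff sig s t x + pair_dev A eff sig t s x) t x.
have gV : gmeas F V by apply: gmeas_sum => // t _; exact: (qf_var0_gmeas cm cb).
have mf : measurable_fun setT (fun x => (score x - condexp P F score x) ^+ 2).
  apply: measurable_funX; apply: measurable_funB; first exact: score_meas.
  apply: (gmeas_meas sF); exact: condexp_gmeas.
have o : orth P F (fun x => (score x - condexp P F score x) ^+ 2 - V x).
  apply: orth_ae sF (qf_form_var0_orth cm cb) _ _.
    by apply: measurable_funB => //; exact: gmeas_meas gV.
  apply: filterS2 score_ae score_condexp0 => x -> ->.
  by rewrite subr0.
apply: (@condexp_ae _ _ _ _ _ _ V) => //.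
(* Cauchy-Schwarz with unit weights reduces square integrability of the form to that of its [m]
   increments. *)
have Z2 : integ (fun x => Z x ^+ 2).
  apply: (integ_le _ (integZ (m%:R) (integ_sum (index_enum 'I_m) (fun t _ =>
    qf_inc_integ2 cm cb t)))).
    apply: measurable_funX; exact: integ_meas (qf_form_orth cm cb).1.
  move=> x; rewrite ger0_norm ?sqr_ge0//.
  pose z t := qf_inc X sig (base A) (fun s => pair_dev A eff sig s s)
    (fun s t x => pair_dev A eff sig s t x + pair_dev A eff sig t s x) t x.
  have := @weighted_sqr_sum _ 'I_m (fun=> 1) z (fun=> ler01).
  have e1 (f : 'I_m -> R) : \sum_t 1 * f t = \sum_t f t.
    by apply: eq_bigr => t _; exact: mul1r.
  rewrite !e1 sumr_const card_ord; exact.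
apply: integ_ae Z2 mf _; apply: filterS2 score_ae score_condexp0 => x -> ->.
by rewrite subr0.
Qed.

Lemma score_variance_ae : {ae P, forall x, score_variance A Y x = \sum_(t < m)
  qf_var0 sig kap chi (base_rel A) (diag_rel A eff sig) (off_rel A eff sig) t x}.
Proof.
apply: filterS score_condvar => x h; rewrite /score_variance h.
under [RHS]eq_bigr do rewrite qf_var0_rel.
by rewrite -mulr_sumr mulrC root_size2_sqr.
Qed.

(** The sample second moment cancels the denominator of [beta_hat] at every point. If it is 0, all
    exposures vanish and so does the score; with no regions both sides are empty sums. *)
Lemma scaled_errorE x :
  n%:R^-1 * (\sum_(i < n) exposure A i x ^+ 2) *
  (n%:R / Num.sqrt (sum_size2 A x) * (beta_hat A Y x - beta A Y x)) =
  (root_size2 A x)^-1 * score x.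
Proof.
have [n0|n0] := eqVneq (n%:R : R) 0.
  have z (f : 'I_n -> R) : \sum_(i < n) f i = 0.
    apply: big1 => i _; exfalso; move/eqP: n0; rewrite pnatr_eq0 => /eqP n0.
    by case: i => i; rewrite n0.
  by rewrite /score !z !(mulr0, mul0r).
have sE : score x = \sum_(i < n) exposure A i x * Y i x -
    (\sum_(i < n) exposure A i x ^+ 2) * beta A Y x.
  by rewrite mulr_suml -sumrB; apply: eq_bigr => i _; rewrite /residual; ring.
rewrite sE /beta_hat -/(root_size2 A x).
have [E0|E0] := eqVneq (\sum_(i < n) exposure A i x ^+ 2) 0.
  have e0 i : exposure A i x = 0.
    apply/eqP; rewrite -sqrf_eq0; have /eqP := E0.
    by rewrite psumr_eq0 => [/allP/(_ i)|j _]; rewrite ?mem_index_enum ?sqr_ge0// => /(_ isT).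
  rewrite E0 mulr0 !mul0r subr0 big1 ?mulr0// => i _.
  by rewrite e0 mul0r.
move: (root_size2 A x)^-1 E0 => r; move: (\sum_(i < n) exposure A i x ^+ 2) => E E0.
by field; rewrite E0 n0.
Qed.

Lemma scaled_error_ae : {ae P, forall x,
  n%:R^-1 * (\sum_(i < n) exposure A i x ^+ 2) *
  (n%:R / Num.sqrt (sum_size2 A x) * (beta_hat A Y x - beta A Y x)) =
  qf_form X sig (base_rel A) (diag_rel A eff sig) (off_rel A eff sig) x}.
Proof.
by apply: filterS score_ae => x h; rewrite scaled_errorE h qf_form_rel.
Qed.

End conditional_score.

(** * Asymptotics *)

Section convergence.
Context {d : measure_display} {T : measurableType d} {R : realType}.
Variable P : probability T R.
Local Notation integ f := (P.-integrable setT (EFin \o f)).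
Local Notation Ex f := (Rintegral P setT f).

Lemma prob_Ex (E : set T) : measurable E -> P E = (Ex (\1_E))%:E.
Proof. by move=> mE; rewrite Ex_indic// fineK// fin_num_measure. Qed.

Lemma prob_ae (E E' : set T) : measurable E -> measurable E' ->
  {ae P, forall x, E x <-> E' x} -> P E = P E'.
Proof.
move=> mE mE' h; rewrite !prob_Ex//; congr EFin; apply: Ex_ae.
- exact: measurable_indic.
- exact: measurable_indic.
apply: filterS h => x h; rewrite !indicE; congr (_%:R).
by congr nat_of_bool; apply/idP/idP; rewrite !inE => /h.
Qed.

Lemma le_set_meas (f : T -> R) (t : R) : measurable_fun setT f ->
  measurable [set x | f x <= t].
Proof.
move=> mf; rewrite (_ : [set _ | _] = f @^-1` `]-oo, t]%classic).
  by rewrite -[X in measurable X]setTI; exact: mf.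
by apply/seteqP; split=> x; rewrite /= in_itv.
Qed.

Lemma dist_set_meas (f : T -> R) (l e : R) : measurable_fun setT f ->
  measurable [set x | e < `|f x - l|].
Proof.
move=> mf; rewrite (_ : [set _ | _] = ~` [set x | `|f x - l| <= e]).
  apply: measurableC; apply: (@le_set_meas (fun x => `|f x - l|)).
  by apply: measurableT_comp => //; exact: measurable_funB.
by apply/seteqP; split=> x /=; rewrite ltNge => /negP.
Qed.

Lemma cvg_in_distribution_ae (Z Z' : nat -> T -> R) mu :
  (forall S, measurable_fun setT (Z S)) -> (forall S, measurable_fun setT (Z' S)) ->
  (forall S, {ae P, forall x, Z S x = Z' S x}) ->
  cvg_in_distribution P Z mu -> cvg_in_distribution P Z' mu.
Proof.
move=> mZ mZ' h cv t mt.
rewrite (_ : (fun S => P [set x | Z' S x <= t]) = fun S => P [set x | Z S x <= t]).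
  exact: cv.
apply/funext => S; apply: prob_ae; [exact: le_set_meas|exact: le_set_meas|].
by apply: filterS (h S) => x /= ->.
Qed.

(** A negative [v] would be at distance more than [- v / 2] from every nonnegative value, with
    probability 1. *)
Lemma cvg_in_prob_ge0 (Z : nat -> T -> R) v : (forall S x, 0 <= Z S x) ->
  cvg_in_prob P Z v -> 0 <= v.
Proof.
move=> Z0 cv; rewrite leNgt; apply/negP => v0.
have e0 : 0 < - v / 2 by lra.
have := cv _ e0; rewrite (_ : (fun S => _) = fun=> 1%E).
  move=> /cvg_lim; rewrite lim_cst// => /(_ (@ereal_hausdorff R)) [] /eqP.
  by rewrite oner_eq0.
apply/funext => S; rewrite (_ : [set x | _] = setT) ?probability_setT//.
apply/seteqP; split=> // x _ /=; apply: lt_le_trans (ler_norm _).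
have := Z0 S x; lra.
Qed.

(** Chebyshev: a deviation above [e] of [Z'] needs a deviation above [e / 2] of [Z] or a gap of at
    least [e / 2], hence the factor [4 / e ^ 2]. *)
Lemma cvg_in_prob_L2 (Z Z' : nat -> T -> R) v :
  (forall S, measurable_fun setT (Z S)) -> (forall S, measurable_fun setT (Z' S)) ->
  (forall S, integ (fun x => (Z' S x - Z S x) ^+ 2)) ->
  Ex (fun x => (Z' S x - Z S x) ^+ 2) @[S --> \oo] --> (0 : R) ->
  cvg_in_prob P Z v -> cvg_in_prob P Z' v.
Proof.
move=> mZ mZ' iZ cE cv e e0.
have e2 : 0 < e / 2 by lra.
have mA S := dist_set_meas v (e / 2) (mZ S).
have mA' S := dist_set_meas v e (mZ' S).
have ub S : (P [set x | (e < `|Z' S x - v|)%R] <= P [set x | (e / 2 < `|Z S x - v|)%R] +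
    (4 / e ^+ 2 * Ex (fun x => (Z' S x - Z S x) ^+ 2))%R%:E)%E.
  rewrite !prob_Ex// -EFinD lee_fin -ExZ// -ExD.
  - apply: Ex_le => [||x].
    + by apply: integ_bnd (norm_indic _); exact: measurable_indic.
    + apply: integD; last exact: integZ.
      by apply: integ_bnd (norm_indic _); exact: measurable_indic.
    have c0 : 0 <= 4 / e ^+ 2 by rewrite divr_ge0// sqr_ge0.
    have q0 := mulr_ge0 c0 (sqr_ge0 (Z' S x - Z S x)).
    have memE (f : T -> R) c : (x \in [set x | c < `|f x - v|]) = (c < `|f x - v|).
      by apply/idP/idP; rewrite inE.
    rewrite !indicE !memE; have [h|h] := ltP (e / 2) `|Z S x - v|.
      by apply: ler_wpDr => //; case: (_ < _).
    have [h'|h'] := ltP e `|Z' S x - v|; last by rewrite addr_ge0.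
    rewrite add0r mulrAC ler_pdivlMr ?exprn_gt0// mul1r.
    have h2 : e / 2 <= `|Z' S x - Z S x|.
      have := ler_distD (Z S x) (Z' S x) v; lra.
    have : (e / 2) ^+ 2 <= `|Z' S x - Z S x| ^+ 2.
      by apply: lerXn2r => //; rewrite nnegrE//; exact: ltW.
    by rewrite real_normK ?num_real// expr_div_n; lra.
  - by apply: integ_bnd (norm_indic _); exact: measurable_indic.
  - exact: integZ.
apply: (@squeeze_cvge _ _ _ _ (cst 0%E) _ (fun S =>
  P [set x | (e / 2 < `|Z S x - v|)%R] +
  (4 / e ^+ 2 * Ex (fun x => (Z' S x - Z S x) ^+ 2))%R%:E)%E).
- by apply: nearW => S; rewrite measure_ge0 ub.
- exact: cvg_cst.
rewrite -[X in _ --> X]adde0; apply: cvgeD => //; first exact: cv.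
apply: cvg_EFin; first exact: nearW.
by rewrite -[X in _ --> X](mulr0 (4 / e ^+ 2)); apply: cvgM => //; exact: cvg_cst.
Qed.

End convergence.

Section martingale_row.
Context {d : measure_display} {T : measurableType d} {R : realType}.
Variable P : probability T R.
Local Notation integ f := (P.-integrable setT (EFin \o f)).
Local Notation Ex f := (Rintegral P setT f).

(* [Z] is almost surely the sum of the first [m] increments [xi], whose conditional
   variances [q] add up to [V], up to an error of second moment at most [b]. *)
Record martingale_row (m : nat) (Z V : T -> R) (b c : R) (G : nat -> set (set T))
  (xi q : nat -> T -> R) : Prop := MartingaleRow {
  row_subsig : forall k, subsig (G k) ;
  row_le : forall k, G k `<=` G k.+1 ;
  row_gxi : forall k, gmeas (G k.+1) (xi k) ;
  row_gq : forall k, gmeas (G k) (q k) ;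
  row_q_ge0 : forall k x, 0 <= q k x ;
  row_qi : forall k, integ (q k) ;
  row_xi2 : forall k, integ (fun x => xi k x ^+ 2) ;
  row_oxi : forall k, orth P (G k) (xi k) ;
  row_oq : forall k, orth P (G k) (fun x => xi k x ^+ 2 - q k x) ;
  row_sum : {ae P, forall x, Z x = \sum_(k < m) xi k x} ;
  row_var : integ (fun x => (\sum_(k < m) q k x - V x) ^+ 2) ;
  row_var_le : Ex (fun x => (\sum_(k < m) q k x - V x) ^+ 2) <= b ;
  row_lyap : \sum_(k < m) Ex (fun x => lyap (xi k x)) <= c }.

(** A design has finitely many increments while the martingale theorem indexes them by all integers;
    they are padded with zeros. *)
Definition ext0 m (f : 'I_m -> T -> R) (k : nat) x : R :=
  if insub k is Some t then f t x else 0.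

Lemma ext0_ord m (f : 'I_m -> T -> R) (t : 'I_m) : ext0 f t = f t.
Proof. by apply/funext => x; rewrite /ext0 valK. Qed.

Lemma ext0P m (f : 'I_m -> T -> R) (Q : nat -> (T -> R) -> Prop) :
  (forall t : 'I_m, Q t (f t)) -> (forall k, Q k (fun=> 0)) -> forall k, Q k (ext0 f k).
Proof.
move=> Qf Q0 k; rewrite /ext0; case: insubP => [t _ <-|_]; [exact: Qf|exact: Q0].
Qed.

End martingale_row.

(** * A design as one row of the martingale array *)

Section design_row.
Context {d : measure_display} {T : measurableType d} {R : realType}.
Context {P : probability T R} {n m : nat}.
Variables (A : design P n m) (Y : 'I_n -> {RV P >-> R}).
Hypothesis share_ge0 : forall i s x, 0 <= share A i s x.
Hypothesis share_le1 : forall i x, \sum_(s < m) share A i s x <= 1.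
Hypothesis outcomeE : forall i x, Y i x = outcome0 A i x +
  \sum_(s < m) share A i s x * shifter A s x * effect A i s x.
Local Notation integ f := (P.-integrable setT (EFin \o f)).
Local Notation Ex f := (Rintegral P setT f).
Local Notation F := (sigma_F0 A).
Local Notation G := (filt (sigma_F0 A) (shifter A)).
Local Notation X := (fun s => shifter A s : T -> R).

Variables (B Cx Cy nu gam : R).
Hypothesis mean0 : forall s, {ae P, forall x, condexp P F (shifter A s) x = 0}.
Hypothesis indep : cond_independent F (shifter A).
Hypothesis effect_bound : forall i s, {ae P, forall x, `|effect A i s x| <= B}.
Hypotheses (nu_ge0 : 0 <= nu) (gam_ge0 : 0 <= gam) (gam_le1 : gam <= 1).
Hypothesis gam_nu : 2 * gam <= nu.
Hypothesis moment : forall s,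
  condexp_bounded P F (fun x => `|shifter A s x| `^ (4 + nu)) Cx.
Hypothesis moment4 : forall i,
  condexp_bounded P (sigma_W A) (fun x => outcome0 A i x ^+ 4) Cy.

Definition scaled_error x : R := n%:R^-1 * (\sum_(i < n) exposure A i x ^+ 2) *
  (n%:R / Num.sqrt (sum_size2 A x) * (beta_hat A Y x - beta A Y x)).

Lemma score_variance_meas : measurable_fun setT (score_variance A Y).
Proof.
have sF := sigma_F0_subsig A; apply: (gmeas_meas sF); apply: gmeasM => //.
  exact: condexp_gmeas.
apply: gmeasV => //; apply: gmeas_sub; first exact: sigma_W_sub_F0.
exact: gmeas_sum_size2.
Qed.

Lemma scaled_error_meas : measurable_fun setT scaled_error.
Proof.
rewrite (_ : scaled_error = fun x => (root_size2 A x)^-1 * score A Y x); last first.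
  by apply/funext => x; exact: scaled_errorE.
apply: measurable_funM; last exact: score_meas.
by apply: gmeas_meas (sigma_W_subsig A) _; exact: gmeas_root_size2.
Qed.

Lemma design_row : exists G' xi q, martingale_row P m scaled_error
  (score_variance A Y) (fluctC `|B| (2 + `|Cx|) `|Cy| * Ex (max_rel2 A))
  (lyapC `|B| (2 + `|Cx|) `|Cy| `|Cx| gam * Ex (root_rel A gam)) G' xi q.
Proof.
have sF := sigma_F0_subsig A; have sW := sigma_W_subsig A.
have [sig [kap [chi cm]]] := shifter_moments nu_ge0 mean0 indep moment.
set K := 2 + `|Cx| in cm *.
have K_ge0 : 0 <= K by rewrite addr_ge0.
(* Truncation makes the almost sure bound on the effects hold at every point. *)
pose eff i s x : R := Num.max (- `|B|) (Num.min `|B| (effect A i s x)).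
have eff_gmeas i s : gmeas F (eff i s).
  apply: gmeas_max => //; first exact: gmeas_cst.
  by apply: gmeas_min => //; [exact: gmeas_cst|exact: gmeas_effect].
have eff_bound i s x : `|eff i s x| <= `|B|.
  by rewrite ler_norml /eff le_max lexx/= ge_max ge_min lexx/= andbT ge0_cp.
have effE i s : {ae P, forall x, effect A i s x = eff i s x}.
  apply: filterS (effect_bound i s) => x h.
  have /ler_normlP[h1 h2] := le_trans h (ler_norm B).
  by rewrite /eff (min_idPr _)// (max_idPr _)// lerNl.
have Y4 i := condexp_bounded_moment sW (moment4 i) (fun x => pow4_ge0 _).
have Xnu s := condexp_bounded_moment sF (moment s) (fun x => powR_ge0 _ _).
have L4Y := outcome0_L4 Y4.
have B0 : 0 <= `|B| by [].
have cf := rel_coefs share_ge0 share_le1 B0 eff_gmeas eff_bound cm L4Y.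
pose f t := qf_inc X sig (base_rel A) (diag_rel A eff sig) (off_rel A eff sig) t.
pose w t := qf_var X sig kap chi (base_rel A) (diag_rel A eff sig) (off_rel A eff sig) t.
(* [w t] is a version of the conditional expectation of a square, hence nonnegative almost surely
   only; its positive part [p] is what the martingale theorem receives. *)
have w0 t : {ae P, forall x, 0 <= w t x}.
  apply: (orth_ge0 (cm_subsig cm t) (f := fun x => f t x ^+ 2)).
  - by move=> x; exact: sqr_ge0.
  - exact: (qf_inc_integ2 cm cf).
  - exact: (qf_var_gmeas cm cf).
  - exact: (qf_var_integ cm cf).
  - exact: (qf_var_orth cm cf).
pose p (t : 'I_m) x : R := Num.max (w t x) 0.
have pw t : {ae P, forall x, w t x = p t x}.
  by apply: filterS (w0 t) => x h; rewrite /p (max_idPl h).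
have gp (t : 'I_m) : gmeas (G t) (p t).
  apply: gmeas_max; first exact: (cm_subsig cm t).
    exact: (qf_var_gmeas cm cf).
  by apply: gmeas_cst; exact: (cm_subsig cm t).
have mp (t : 'I_m) := gmeas_meas (cm_subsig cm t) (gp t).
have mf (t : 'I_m) := gmeas_meas (cm_subsig cm t.+1) (qf_inc_gmeas cm cf t).
exists G, (ext0 f), (ext0 p).
have sums (g : 'I_m -> T -> R) x : \sum_(k < m) ext0 g k x = \sum_(t < m) g t x.
  by apply: eq_bigr => t _; rewrite ext0_ord.
have [f2 f2E] := fluct_bound share_ge0 share_le1 B0 K_ge0 eff_gmeas eff_bound cm
  (normr_ge0 Cy) Y4.
have varE : {ae P, forall x, fluct A eff sig kap chi x ^+ 2 =
    (\sum_(k < m) ext0 p k x - score_variance A Y x) ^+ 2}.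
  have h := score_variance_ae share_ge0 share_le1 outcomeE B0 eff_gmeas eff_bound effE cm L4Y.
  apply: filterS2 h (filter_forall _ pw) => x h1 h2.
  rewrite sums h1; congr ((_ - _) ^+ 2).
  by apply: eq_bigr => t _; rewrite -h2.
have mv : measurable_fun setT
    (fun x => (\sum_(k < m) ext0 p k x - score_variance A Y x) ^+ 2).
  apply: measurable_funX; apply: measurable_funB; last exact: score_variance_meas.
  by apply: measurable_sum => t; rewrite ext0_ord.
have GS k : subsig (G k) by exact: (cm_subsig cm).
split.
- exact: GS.
- by move=> k; exact: (cm_le cm).
- apply: (ext0P (Q := fun k g => gmeas (G k.+1) g)) => [t|k].
    exact: (qf_inc_gmeas cm cf).
  exact: gmeas_cst.
- apply: (ext0P (Q := fun k g => gmeas (G k) g)) => [t|k]; first exact: gp.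
  exact: gmeas_cst.
- apply: (ext0P (Q := fun k g => forall x, 0 <= g x)) => // t x.
  by rewrite le_max lexx orbT.
- apply: (ext0P (Q := fun k g => integ g)) => [t|k]; last exact: integ_cst.
  exact: integ_ae (qf_var_integ cm cf t) (mp t) (pw t).
- apply: (ext0P (Q := fun k g => integ (fun x => g x ^+ 2))) => [t|k].
    exact: (qf_inc_integ2 cm cf).
  exact: (integ_cst P (0 ^+ 2)).
- apply: (ext0P (Q := fun k g => orth P (G k) g)) => [t|k]; last exact: orth0.
  exact: (qf_inc_orth cm cf).
- move=> k; rewrite /ext0; case: insubP => [t _ <-|_]; last first.
    by apply: orth_ext (orth0 P (G k)) => x; rewrite expr0n subr0.
  apply: orth_ae (GS t) (qf_var_orth cm cf t) _ _.
    by apply: measurable_funB => //; exact: measurable_funX.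
  by apply: filterS (pw t) => x <-.
- apply: filterS (scaled_error_ae share_ge0 share_le1 outcomeE eff_gmeas eff_bound
    effE cm L4Y) => x h.
  by rewrite sums.
- exact: integ_ae f2 mv varE.
- rewrite -(Ex_ae _ mv varE)//; exact: integ_meas f2.
- apply: le_trans (lyap_sum_bound share_ge0 share_le1 B0 K_ge0 eff_gmeas eff_bound cm
    (normr_ge0 Cy) Y4 (normr_ge0 Cx) Xnu gam_ge0 gam_le1 gam_nu).
  by apply: ler_sum => t _; rewrite ext0_ord.
Qed.

End design_row.

Theorem proposition2 (R : realType) (d : measure_display) (T : measurableType d)
  (P : probability T R) (N : nat -> nat)
  (A : forall S : nat, design P (N S) S)
  (Y : forall S : nat, 'I_(N S) -> {RV P >-> R})
  (nu ell v : R)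
  (share_ge0 : forall S i s x, 0 <= share (A S) i s x)
  (share_le1 : forall S i x, \sum_(s < S) share (A S) i s x <= 1)
  (outcomeE : forall S i x, Y S i x = outcome0 (A S) i x +
    \sum_(s < S) share (A S) i s x * shifter (A S) s x * effect (A S) i s x)
  (shifter_mean0 : forall S s,
    {ae P, forall x, condexp P (sigma_F0 (A S)) (shifter (A S) s) x = 0})
  (shifter_indep : forall S,
    cond_independent (sigma_F0 (A S)) (shifter (A S)))
  (max_size_cvg : {ae P, forall x,
    max_size (A S) x / sum_size (A S) x @[S --> \oo] --> (0 : R)})
  (max_size2_cvg : {ae P, forall x,
    max_size2 (A S) x / sum_size2 (A S) x @[S --> \oo] --> (0 : R)})
  (effect_bounded : exists B : R, forall S i s,
    {ae P, forall x, `|effect (A S) i s x| <= B})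
  (ell_gt0 : 0 < ell)
  (exposure_var_cvg : cvg_in_prob P (fun S x => (N S)%:R^-1 *
    \sum_(i < N S) \sum_(s < S)
      condvar P (sigma_F0 (A S)) (shifter (A S) s) x *
      share (A S) i s x ^+ 2) ell)
  (nu_gt0 : 0 < nu)
  (shifter_moment : exists C : R, forall S s,
    condexp_bounded P (sigma_F0 (A S))
      (fun x => `|shifter (A S) s x| `^ (4 + nu)) C)
  (outcome0_moment : exists C : R, forall S i,
    condexp_bounded P (sigma_W (A S)) (fun x => outcome0 (A S) i x ^+ 4) C)
  (score_variance_cvg :
    cvg_in_prob P (fun S => score_variance (A S) (Y S)) v) :
  approx_normal P
    (fun S x => (N S)%:R / Num.sqrt (sum_size2 (A S) x) *
                (beta_hat (A S) (Y S) x - beta (A S) (Y S) x))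
    (fun S => score_variance (A S) (Y S))
    (fun S x => (N S)%:R^-1 * \sum_(i < N S) exposure (A S) i x ^+ 2).
Proof.
have [B effB] := effect_bounded; have [Cx momX] := shifter_moment.
have [Cy momY] := outcome0_moment.
(* The bound 1 keeps [2 + gam] at most 3, where [lyap_powR] holds; the bound [nu / 2] keeps
   [4 + 2 * gam] within the moments of the shifters. *)
pose gam := Num.min 1 (nu / 2).
have g0 : 0 < gam by rewrite lt_min ltr01 divr_gt0.
have g1 : gam <= 1 by rewrite ge_min lexx.
have gn : 2 * gam <= nu by rewrite mulrC -ler_pdivlMr// ge_min lexx orbT.
have row S := design_row (share_ge0 S) (share_le1 S) (outcomeE S) (shifter_mean0 S)
  (shifter_indep S) (effB S) (ltW nu_gt0) (ltW g0) g1 gn (momX S) (momY S).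
have /choice[G /choice[xi /choice[q rows]]] := row.
have sW S := sigma_W_subsig (A S).
have rho01 S x : 0 <= max_rel2 (A S) x <= 1 by rewrite max_rel2_ge0 max_rel2_le1.
have mrho S : measurable_fun setT (max_rel2 (A S)).
  by apply: gmeas_meas (sW S) _; exact: gmeas_max_rel2.
have cst0 : P.-integrable setT (EFin \o (fun=> 1 : R)) by exact: integ_cst.
(* The ratio lies between 0 and 1, so almost sure convergence gives convergence of its mean. *)
have rho_cvg : Rintegral P setT (max_rel2 (A S)) @[S --> \oo] --> (0 : R).
  rewrite -(Ex_cst P 0); apply: (dominated_Ex _ _ cst0) => // S x.
  by have /andP[h1 h2] := rho01 S x; rewrite ger0_norm.
have root_cvg : Rintegral P setT (root_rel (A S) gam) @[S --> \oo] --> (0 : R).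
  rewrite -(Ex_cst P 0); apply: (dominated_Ex _ _ cst0) => //.
  - by move=> S; apply: gmeas_meas (sW S) _; exact: root_rel_gmeas.
  - apply: filterS max_size2_cvg => x h; rewrite /root_rel.
    have sc : Num.sqrt (max_rel2 (A S) x) @[S --> \oo] --> (0 : R).
      by rewrite -(sqrtr0 R); exact: (cvg_comp _ _ h (@sqrt_continuous R 0)).
    apply/cvgr0Pnorm_lt => e e0.
    (* The threshold whose power [gam] is [e]. *)
    have d0 : 0 < e `^ gam^-1 by rewrite powR_gt0.
    move/cvgr0Pnorm_lt : sc => /(_ _ d0); apply: filterS => S.
    rewrite ger0_norm ?sqrtr_ge0// => lt; rewrite ger0_norm ?powR_ge0//.
    have -> : e = (e `^ gam^-1) `^ gam.
      by rewrite -powRrM mulVf ?powRr1 ?gt_eqF// ltW.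
    by apply: gt0_ltr_powR; rewrite // nnegrE ?sqrtr_ge0// powR_ge0.
  - by move=> S x; rewrite ger0_norm ?root_rel_ge0// root_rel_le1// ltW.
have zero (c : R) (u : nat -> R) (z : nat -> R) : z S @[S --> \oo] --> (0 : R) ->
    (forall S, 0 <= u S <= c * z S) -> u S @[S --> \oo] --> (0 : R).
  move=> z0 uz; apply: (squeeze_cvgr (f := cst 0) (h := fun S => c * z S)).
  - exact: nearW.
  - exact: cvg_cst.
  - by rewrite -[X in _ --> X](mulr0 c); apply: cvgM => //; exact: cvg_cst.
have mq S k : measurable_fun setT (q S k).
  by apply: gmeas_meas (row_gq (rows S) k); exact: row_subsig (rows S) k.
have mxi S k : measurable_fun setT (xi S k).
  by apply: gmeas_meas (row_gxi (rows S) k); exact: row_subsig (rows S) k.+1.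
have q_cvg : cvg_in_prob P (fun S x => \sum_(k < S) q S k x) v.
  apply: cvg_in_prob_L2 score_variance_cvg.
  - by move=> S; exact: score_variance_meas.
  - by move=> S; exact: measurable_sum.
  - by move=> S; exact: row_var (rows S).
  - apply: (zero _ _ _ rho_cvg) => S; apply/andP; split.
      by apply: Ex_ge0 => x; exact: sqr_ge0.
    exact: row_var_le (rows S).
have v0 : 0 <= v.
  apply: cvg_in_prob_ge0 q_cvg => S x; apply: sumr_ge0 => k _.
  exact: (row_q_ge0 (rows S)).
exists v; split=> //.
apply: (@cvg_in_distribution_ae _ _ _ _ (fun S x => \sum_(k < S) xi S k x)).
- by move=> S; exact: measurable_sum.
- by move=> S; exact: scaled_error_meas.
- by move=> S; apply: filterS (row_sum (rows S)) => x <-.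
apply: (array_clt (G := G) (q := q)) => //.
- by move=> S; exact: (row_subsig (rows S)).
- by move=> S; exact: (row_le (rows S)).
- by move=> S; exact: (row_gxi (rows S)).
- by move=> S; exact: (row_gq (rows S)).
- by move=> S; exact: (row_q_ge0 (rows S)).
- by move=> S; exact: (row_qi (rows S)).
- by move=> S; exact: (row_xi2 (rows S)).
- by move=> S; exact: (row_oxi (rows S)).
- by move=> S; exact: (row_oq (rows S)).
apply: (zero _ _ _ root_cvg) => S; apply/andP; split.
  by apply: sumr_ge0 => k _; apply: Ex_ge0 => x; exact: lyap_ge0.
exact: row_lyap (rows S).
Qed.
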